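(* Let $f$ and $g$ be transcendental entire functions. (i) If $f\circ g=g\circ f$ and $f,g$ are of bounded type, then $\overline{I(f)}=\overline{I(f\circ g)}$. (ii) If $f$ is periodic with period $c\neq0$ and $g=f^m+c$ for some $m\in\mathbb{N}$ (where $f^m$ is the $m$-th iterate), then $\overline{I(f)}=\overline{I(f\circ g)}$.
   Context: For an entire function $f$, $f^n$ denotes the $n$-th iterate and $I(f)=\{z\in\mathbb{C}: f^n(z)\to\infty\}$ is its escaping set; $\overline{E}$ denotes closure in $\mathbb{C}$. A transcendental entire function is of bounded type if the set of its critical values and finite asymptotic values, together with their finite limit points, is bounded. *)

(* Defs.v *)
From Stdlib Require Import Reals List.
Open Scope R_scope.

Definition Cplx : Type := (R * R)%type.
Definition Cadd (z w : Cplx) : Cplx := (fst z + fst w, snd z + snd w).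
Definition Copp (z : Cplx) : Cplx := (- fst z, - snd z).
Definition Csub (z w : Cplx) : Cplx := Cadd z (Copp w).
Definition Cmul (z w : Cplx) : Cplx :=
  (fst z * fst w - snd z * snd w, fst z * snd w + snd z * fst w).
Definition C0 : Cplx := (0, 0).
Definition C1 : Cplx := (1, 0).
Definition Cnorm (z : Cplx) : R := sqrt (fst z * fst z + snd z * snd z).
Fixpoint Cpow (z : Cplx) (n : nat) : Cplx :=
  match n with O => C1 | S k => Cmul z (Cpow z k) end.

Definition has_cderiv (f : Cplx -> Cplx) (z l : Cplx) : Prop :=
  forall eps, 0 < eps -> exists delta, 0 < delta /\
    forall h, 0 < Cnorm h < delta ->
      Cnorm (Csub (Csub (f (Cadd z h)) (f z)) (Cmul l h)) <= eps * Cnorm h.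

Definition entire (f : Cplx -> Cplx) : Prop := forall z, exists l, has_cderiv f z l.

Definition poly_eval (a : list Cplx) (z : Cplx) : Cplx :=
  fold_right Cadd C0 (map (fun p => Cmul (fst p) (Cpow z (snd p)))
                          (combine a (seq 0 (length a)))).
Definition is_polynomial (f : Cplx -> Cplx) : Prop :=
  exists a : list Cplx, forall z, f z = poly_eval a z.

Definition transcendental_entire (f : Cplx -> Cplx) : Prop :=
  entire f /\ ~ is_polynomial f.

Definition iter (n : nat) (f : Cplx -> Cplx) : Cplx -> Cplx := fun z => Nat.iter n f z.

Definition escaping_set (f : Cplx -> Cplx) (z : Cplx) : Prop :=
  forall M, exists N : nat, forall n, (N <= n)%nat -> M < Cnorm (iter n f z).

Definition closure (S : Cplx -> Prop) (z : Cplx) : Prop :=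
  forall eps, 0 < eps -> exists w, S w /\ Cnorm (Csub w z) < eps.

Definition critical_value (f : Cplx -> Cplx) (w : Cplx) : Prop :=
  exists z, has_cderiv f z C0 /\ f z = w.

Definition asymptotic_value (f : Cplx -> Cplx) (a : Cplx) : Prop :=
  exists gamma : R -> Cplx,
    (forall t, 0 <= t -> forall eps, 0 < eps -> exists delta, 0 < delta /\
        forall s, 0 <= s -> Rabs (s - t) < delta -> Cnorm (Csub (gamma s) (gamma t)) < eps)
    /\ (forall M, exists T, forall t, T <= t -> M < Cnorm (gamma t))
    /\ (forall eps, 0 < eps -> exists T, forall t, T <= t ->
          Cnorm (Csub (f (gamma t)) a) < eps).

Definition singular_value (f : Cplx -> Cplx) (w : Cplx) : Prop :=
  critical_value f w \/ asymptotic_value f w.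

Definition bounded_type (f : Cplx -> Cplx) : Prop :=
  transcendental_entire f /\
  exists B, forall w, closure (singular_value f) w -> Cnorm w <= B.

Definition same_set (A B : Cplx -> Prop) : Prop := forall z, A z <-> B z.

(* Main.v *)
From Pilot Require Import Defs.
From Coquelicot Require Import Coquelicot.
From Stdlib Require Import ZArith Reals Lra Lia List Classical ClassicalEpsilon.
Open Scope R_scope.

(** If [F o G = G o F] for entire functions, then [F u] escaping under [G] implies that [u] escapes
    under [G]. So for (i) it suffices that the forward images of any disc around an escaping point
    of [f] (or of [f o g]) contain an escaping point of [f o g] (or of [f]).

    For [h] transcendental of bounded type, [exp] lifts through [h o exp] over a half-plane
    [Re > L] to a holomorphic [psi], because [h] has no singular value there. Bloch's covering
    argument gives [|psi' z| <= K / (Re z - L)] unless [psi] is equivariant for translations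
    [z -> z + i p] and [w -> w + 2 pi i]; in that case [psi] grows linearly by Harnack's inequality,
    it covers a right half-plane, and [h] is a polynomial. Hence in logarithmic coordinates inverse
    branches of [h] contract discs: around an escaping orbit, small discs are blown up to discs
    of radius comparable to [log |z_n|], and pulling back along points of maximum modulus gives
    escaping points close to every point of large modulus. Both arguments apply to orbits that
    alternate between [g] and [f], which avoids studying the singular values of [f o g].

    The function theory comes from Goursat's lemma on rectangles applied to
    [w -> F (c + exp w)], which gives [|F c| <= max |F|] over circles around [c].

    For (ii), [f o g = f^(m+1)], and iterates have the same escaping set. *)

(** The orbit of a point escaping under [f] says nothing about its orbit under [f o g]. Commutation
    moves the question forward in time: a nearby [u] may be judged by its image after many steps of
    [f], and these images fill a disc that is large in logarithmic coordinates. Such a disc contains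
    a point escaping under [f o g], because escaping points lie within distance 5 of every point far
    to the right: 4 for moving to a point of maximum modulus, which costs at most pi, and 1 for the
    contracted error.

    The bound on [psi'] rests on one feature of the image of [psi]: no two values differ by
    [2 pi i]. Such a pair would be joined by a path whose exponential winds once around 0 and on
    which [|h|] stays above all singular values, so that [h] would behave near infinity like a
    finite covering; transcendence excludes this. *)

Notation C := Complex.C.

(** * Complex derivatives and compactness *)

Definition cderiv (f : C -> C) (z l : C) : Prop :=
  forall eps, 0 < eps -> exists delta, 0 < delta /\
    forall h, Cmod h < delta -> Cmod (f (z + h)%C - f z - l * h) <= eps * Cmod h.

Definition ccont (f : C -> C) (z : C) : Prop :=
  forall eps, 0 < eps -> exists delta, 0 < delta /\
    forall w, Cmod (w - z) < delta -> Cmod (f w - f z) < eps.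

Lemma Cmod_dist_triangle a b c : Cmod (a - c) <= Cmod (a - b) + Cmod (b - c).
Proof. replace (a - c)%C with ((a - b) + (b - c))%C by ring. apply Cmod_triangle. Qed.

Lemma Cmod_dist_sym a b : Cmod (a - b) = Cmod (b - a).
Proof. rewrite <- Cmod_opp. f_equal. ring. Qed.

Lemma Cmod_sub_le a b : Cmod (a - b) <= Cmod a + Cmod b.
Proof. unfold Cminus. rewrite <- (Cmod_opp b). apply Cmod_triangle. Qed.

Lemma Cmod_le_sub_add a b : Cmod a <= Cmod (a - b) + Cmod b.
Proof. replace a with ((a - b) + b)%C at 1 by ring. apply Cmod_triangle. Qed.

Lemma Cmod_le_add_sub a b : Cmod b <= Cmod a + Cmod (a - b).
Proof. rewrite (Cmod_dist_sym a b). pose proof (Cmod_le_sub_add b a). lra. Qed.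

Lemma Cmod_dist_refl a : Cmod (a - a) = 0.
Proof. replace (a - a)%C with (RtoC 0) by ring. apply Cmod_0. Qed.

Lemma Cmod_sub_eq_0 a b : Cmod (a - b) = 0 -> a = b.
Proof. intros H. apply Cmod_eq_0 in H. apply Ceq_minus. exact H. Qed.

Lemma Im_le_Cmod z : Rabs (Im z) <= Cmod z.
Proof. eapply Rle_trans; [apply Rmax_r | apply (Rmax_Cmod z)]. Qed.

Lemma Cmod_le_Re_Im z : Cmod z <= Rabs (Re z) + Rabs (Im z).
Proof.
pose proof (Rabs_pos (Re z)). pose proof (Rabs_pos (Im z)).
apply Rsqr_incr_0_var; [|lra]. unfold Rsqr.
replace (Cmod z * Cmod z) with (Cmod z ^ 2) by ring. rewrite Cmod2_alt.
rewrite <- (pow2_abs (Re z)), <- (pow2_abs (Im z)). nra.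
Qed.

Lemma Re_plus z w : Re (z + w)%C = Re z + Re w. Proof. reflexivity. Qed.
Lemma Im_plus z w : Im (z + w)%C = Im z + Im w. Proof. reflexivity. Qed.
Lemma Re_minus z w : Re (z - w)%C = Re z - Re w. Proof. reflexivity. Qed.
Lemma Im_minus z w : Im (z - w)%C = Im z - Im w. Proof. reflexivity. Qed.

Lemma C_ext (z w : C) : Re z = Re w -> Im z = Im w -> z = w.
Proof. destruct z, w; simpl; intros; subst; reflexivity. Qed.

(** Gives access to the sum, product and chain rules of [is_derive]; elsewhere derivatives are
    handled in epsilon-delta form. *)
Lemma cderiv_is_derive f z l :
  cderiv f z l <-> is_derive (K := C_AbsRing) (V := AbsRing_NormedModule C_AbsRing) f z l.
Proof.
assert (E : forall y, minus (minus (f y) (f z)) (scal (minus y z) l) = (f y - f z - l * (y - z))%C).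
{ intros y. change ((f y + - f z + - ((y + - z) * l) = f y - f z - l * (y - z))%C). ring. }
assert (Ey : forall y : C, (z + (y - z))%C = y) by (intros; ring).
split.
- intros H. split; [apply (is_linear_scal_l (K := C_AbsRing) (V := AbsRing_NormedModule C_AbsRing))|].
  intros x Hx. apply (is_filter_lim_locally_unique (V := AbsRing_NormedModule C_AbsRing)) in Hx. subst x.
  intros eps. destruct (H eps (cond_pos eps)) as [d [Hd H1]].
  exists (mkposreal d Hd). intros y Hy.
  specialize (H1 (y - z)%C). rewrite Ey in H1.
  rewrite <- E in H1. apply H1, Hy.
- intros [_ H] eps He.
  destruct (H z (fun P H => H) (mkposreal eps He)) as [d Hd].
  exists d. split; [apply cond_pos|]. intros h Hh.
  specialize (Hd (z + h)%C).
  rewrite E in Hd.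
  replace (z + h - z)%C with h in Hd by ring.
  lapply Hd.
  + clear Hd; intros Hd.
    change (Cmod (f (z + h)%C - f z - l * h) <= eps * Cmod (z + h + - z)) in Hd.
    replace (z + h + - z)%C with h in Hd by ring. exact Hd.
  + change (Cmod (z + h + - z) < d). replace (z + h + - z)%C with h by ring. exact Hh.
Qed.

Lemma cderiv_const c z : cderiv (fun _ => c) z 0.
Proof.
intros eps He. exists 1. split; [lra|]. intros h _.
replace (c - c - 0 * h)%C with (RtoC 0) by ring. rewrite Cmod_0.
apply Rmult_le_pos; [lra | apply Cmod_ge_0].
Qed.

Lemma cderiv_id z : cderiv (fun x => x) z 1.
Proof.
intros eps He. exists 1. split; [lra|]. intros h _.
replace (z + h - z - 1 * h)%C with (RtoC 0) by ring. rewrite Cmod_0.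
apply Rmult_le_pos; [lra | apply Cmod_ge_0].
Qed.

Lemma cderiv_plus f g z a b :
  cderiv f z a -> cderiv g z b -> cderiv (fun x => f x + g x)%C z (a + b)%C.
Proof.
rewrite !cderiv_is_derive. intros Hf Hg.
exact (is_derive_plus (K := C_AbsRing) (V := AbsRing_NormedModule C_AbsRing) f g z a b Hf Hg).
Qed.

Lemma cderiv_mult f g z a b :
  cderiv f z a -> cderiv g z b -> cderiv (fun x => f x * g x)%C z (a * g z + f z * b)%C.
Proof.
rewrite !cderiv_is_derive. intros Hf Hg.
exact (is_derive_mult (K := C_AbsRing) f g z a b Hf Hg Cmult_comm).
Qed.

Lemma cderiv_comp f g z a b :
  cderiv f (g z) a -> cderiv g z b -> cderiv (fun x => f (g x)) z (a * b)%C.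
Proof.
rewrite !cderiv_is_derive. intros Hf Hg. rewrite Cmult_comm.
exact (is_derive_comp (K := C_AbsRing) (V := AbsRing_NormedModule C_AbsRing) f g z a b Hf Hg).
Qed.

Lemma cderiv_scal c f z a : cderiv f z a -> cderiv (fun x => c * f x)%C z (c * a)%C.
Proof.
intros H. replace (c * a)%C with (0 * f z + c * a)%C by ring.
apply (cderiv_mult (fun _ => c)); [apply cderiv_const | exact H].
Qed.

Lemma cderiv_minus f g z a b :
  cderiv f z a -> cderiv g z b -> cderiv (fun x => f x - g x)%C z (a - b)%C.
Proof.
intros Hf Hg. replace (a - b)%C with (a + (- (1)) * b)%C by ring.
assert (H := cderiv_plus _ _ _ _ _ Hf (cderiv_scal (- (1))%C _ _ _ Hg)).
intros eps He. destruct (H eps He) as [d [Hd H1]]. exists d. split; [exact Hd|].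
intros h Hh. specialize (H1 h Hh). eapply Rle_trans; [|exact H1]. apply Req_le. f_equal. ring.
Qed.

Lemma cderiv_ext_loc f g z l r :
  0 < r -> (forall w, Cmod (w - z) < r -> f w = g w) -> cderiv f z l -> cderiv g z l.
Proof.
intros Hr E H eps He. destruct (H eps He) as [d [Hd H1]].
exists (Rmin d r). split; [apply Rmin_pos; lra|]. intros h Hh.
assert (Cmod h < d /\ Cmod h < r) as [A B] by (split; eapply Rlt_le_trans; [exact Hh | apply Rmin_l | exact Hh | apply Rmin_r]).
rewrite <- !E; [apply H1, A | rewrite Cmod_dist_refl; lra |].
replace (z + h - z)%C with h by ring. exact B.
Qed.

Lemma cderiv_ext f g z l : (forall w, f w = g w) -> cderiv f z l -> cderiv g z l.
Proof. intros E. apply cderiv_ext_loc with 1; [lra | auto]. Qed.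

Lemma cderiv_cont f z l : cderiv f z l -> ccont f z.
Proof.
intros H eps He. destruct (H 1 Rlt_0_1) as [d [Hd H1]].
pose proof (Cmod_ge_0 l) as Hl.
set (e' := eps / (Cmod l + 2)).
assert (He' : 0 < e') by (apply Rdiv_lt_0_compat; lra).
exists (Rmin d e'). split; [apply Rmin_pos; lra|]. intros w Hw.
assert (Cmod (w - z) < d /\ Cmod (w - z) < e') as [A B] by (split; eapply Rlt_le_trans; [exact Hw | apply Rmin_l | exact Hw | apply Rmin_r]).
specialize (H1 _ A). replace (z + (w - z))%C with w in H1 by ring.
pose proof (Cmod_le_sub_add (f w - f z) (l * (w - z))) as T. rewrite Cmod_mult in T.
assert (Cmod (f w - f z) <= (Cmod l + 1) * Cmod (w - z)) by lra.
assert (E : e' * (Cmod l + 2) = eps) by (unfold e'; field; lra).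
pose proof (Cmod_ge_0 (w - z)). nra.
Qed.

Lemma cderiv_inv (z : C) : z <> 0%C -> cderiv (fun x => / x)%C z (- / (z * z))%C.
Proof.
intros Hz eps He. pose proof (proj1 (Cmod_gt_0 z) Hz) as Hm.
set (d := Rmin (Cmod z / 2) (eps * (Cmod z * Cmod z * Cmod z) / 2)).
assert (Hd : 0 < d). { apply Rmin_pos; [lra|]. assert (0 < Cmod z * Cmod z * Cmod z) by (repeat apply Rmult_lt_0_compat; lra). nra. }
exists d. split; [exact Hd|]. intros h Hh.
assert (A : Cmod h < Cmod z / 2) by (eapply Rlt_le_trans; [exact Hh | apply Rmin_l]).
assert (B : Cmod h < eps * (Cmod z * Cmod z * Cmod z) / 2) by (eapply Rlt_le_trans; [exact Hh | apply Rmin_r]).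
assert (M : Cmod z / 2 < Cmod (z + h)).
{ pose proof (Cmod_le_sub_add z (- h)) as T. rewrite Cmod_opp in T.
  replace (z - - h)%C with (z + h)%C in T by ring. lra. }
assert (Hzh : (z + h)%C <> 0%C) by (apply Cmod_gt_0; lra).
replace (/ (z + h) - / z - - / (z * z) * h)%C with (h * (h / (z * z * (z + h))))%C by (field; auto).
rewrite Cmod_mult, Rmult_comm. apply Rmult_le_compat_r; [apply Cmod_ge_0|].
assert (Hzz : (z * z * (z + h))%C <> 0%C) by (repeat apply Cmult_neq_0; auto).
rewrite Cmod_div, !Cmod_mult by exact Hzz.
assert (P : 0 < Cmod z * Cmod z * Cmod (z + h)) by (repeat apply Rmult_lt_0_compat; lra).
apply Rmult_le_reg_r with (1 := P). unfold Rdiv. rewrite Rmult_assoc, Rinv_l, Rmult_1_r by lra.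
assert (Cmod z * Cmod z * (Cmod z / 2) <= Cmod z * Cmod z * Cmod (z + h)).
{ apply Rmult_le_compat_l; [apply Rmult_le_pos; lra | lra]. }
nra.
Qed.

Lemma cderiv_inv_comp f z a :
  cderiv f z a -> f z <> 0%C -> cderiv (fun x => / f x)%C z (- a / (f z * f z))%C.
Proof.
intros H Hz. replace (- a / (f z * f z))%C with (- / (f z * f z) * a)%C by (field; exact Hz).
apply (cderiv_comp (fun x => / x)%C); [apply cderiv_inv, Hz | exact H].
Qed.

Lemma cderiv_unique f z a b : cderiv f z a -> cderiv f z b -> a = b.
Proof.
intros Ha Hb. apply Cmod_sub_eq_0. apply Rle_antisym; [|apply Cmod_ge_0].
apply Rnot_lt_le. intros Hlt. set (e := Cmod (a - b) / 4).
destruct (Ha e) as [d1 [Hd1 H1]]; [unfold e; lra|].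
destruct (Hb e) as [d2 [Hd2 H2]]; [unfold e; lra|].
set (d := Rmin d1 d2 / 2).
assert (Hd : 0 < d) by (unfold d; assert (0 < Rmin d1 d2) by (apply Rmin_pos; lra); lra).
assert (L1 : d < d1) by (unfold d in *; pose proof (Rmin_l d1 d2); lra).
assert (L2 : d < d2) by (unfold d in *; pose proof (Rmin_r d1 d2); lra).
assert (E : Cmod (RtoC d) = d) by (rewrite Cmod_R; apply Rabs_pos_eq; lra).
specialize (H1 (RtoC d)). specialize (H2 (RtoC d)). rewrite E in H1, H2.
specialize (H1 L1). specialize (H2 L2).
pose proof (Cmod_sub_le (f (z + d)%C - f z - b * d) (f (z + d)%C - f z - a * d)) as T.
replace (f (z + d)%C - f z - b * d - (f (z + d)%C - f z - a * d))%C with ((a - b) * d)%C in T by ring.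
rewrite Cmod_mult, E in T. unfold e in *. nra.
Qed.

Lemma ccont_Cmod f z : ccont f z ->
  forall eps, 0 < eps -> exists delta, 0 < delta /\
    forall w, Cmod (w - z) < delta -> Rabs (Cmod (f w) - Cmod (f z)) < eps.
Proof.
intros H eps He. destruct (H eps He) as [d [Hd H1]]. exists d. split; [exact Hd|].
intros w Hw. specialize (H1 w Hw).
pose proof (Cmod_le_sub_add (f w) (f z)). pose proof (Cmod_le_add_sub (f w) (f z)).
apply Rabs_def1; lra.
Qed.

Definition entire_fun (f : C -> C) : Prop := forall z, exists l, cderiv f z l.

Lemma entire_cont f z : entire_fun f -> ccont f z.
Proof. intros H. destruct (H z) as [l Hl]. apply (cderiv_cont _ _ _ Hl). Qed.


Lemma bolzano_weierstrass_C (u : nat -> C) c r :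
  (forall n, Cmod (u n - c) <= r) ->
  exists l, forall eps, 0 < eps -> forall N, exists n, (N <= n)%nat /\ Cmod (u n - l) < eps.
Proof.
intros Hu.
assert (K1 := compact_P3 (Re c - r) (Re c + r)).
assert (K2 := compact_P3 (Im c - r) (Im c + r)).
destruct (Bolzano_Weierstrass (fun n => Re (u n)) _ K1) as [l1 Hl1].
{ intros n. pose proof (re_le_Cmod (u n - c)) as H. rewrite Re_minus in H.
  apply Rabs_le_between in H. specialize (Hu n). lra. }
(* The selection [s] satisfies [k <= s k] without having to increase; that is enough for a cluster
   point. *)
assert (Hsub : forall k : nat, exists n, (k <= n)%nat /\ Rabs (Re (u n) - l1) < / (INR k + 1)).
{ intros k. assert (Hk : 0 < / (INR k + 1)) by (apply Rinv_0_lt_compat; pose proof (pos_INR k); lra).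
  destruct (Hl1 (disc l1 (mkposreal _ Hk)) k) as [p [Hp1 Hp2]].
  - exists (mkposreal _ Hk). intros x Hx. exact Hx.
  - exists p. split; [exact Hp1 | exact Hp2]. }
apply choice in Hsub. destruct Hsub as [s Hs].
destruct (Bolzano_Weierstrass (fun n => Im (u (s n))) _ K2) as [l2 Hl2].
{ intros n. pose proof (Im_le_Cmod (u (s n) - c)) as H. rewrite Im_minus in H.
  apply Rabs_le_between in H. specialize (Hu (s n)). lra. }
exists (l1, l2). intros eps He N.
assert (He2 : 0 < eps / 2) by lra.
destruct (archimed_cor1 (eps / 2) He2) as [K [HK HK0]].
destruct (Hl2 (disc l2 (mkposreal _ He2)) (Nat.max K N)) as [p [Hp1 Hp2]].
- exists (mkposreal _ He2). intros x Hx. exact Hx.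
- destruct (Hs p) as [Hs1 Hs2]. exists (s p). split; [lia|].
  eapply Rle_lt_trans; [apply Cmod_le_Re_Im|].
  rewrite Re_minus, Im_minus. unfold disc in Hp2; simpl in Hp2 |- *.
  assert (INR K <= INR p) by (apply le_INR; lia).
  assert (0 < INR K) by (apply lt_0_INR; lia).
  assert (/ (INR p + 1) <= / INR K) by (apply Rinv_le_contravar; lra).
  lra.
Qed.

(** Continuity is asked relative to the disc because [branch_deriv_bound] maximises a function built
    from a choice of derivatives that is controlled only inside a half-plane. *)
Lemma max_on_disc (F : C -> R) c r : 0 <= r ->
  (forall z, Cmod (z - c) <= r -> forall eps, 0 < eps -> exists delta, 0 < delta /\
     forall w, Cmod (w - c) <= r -> Cmod (w - z) < delta -> Rabs (F w - F z) < eps) ->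
  exists z, Cmod (z - c) <= r /\ forall w, Cmod (w - c) <= r -> F w <= F z.
Proof.
intros Hr HF.
assert (clos : forall (u : nat -> C) l, (forall n, Cmod (u n - c) <= r) ->
   (forall eps, 0 < eps -> forall N, exists n, (N <= n)%nat /\ Cmod (u n - l) < eps) -> Cmod (l - c) <= r).
{ intros u l Hu Hl. apply Rnot_lt_le. intros H.
  destruct (Hl (Cmod (l - c) - r) ltac:(lra) 0%nat) as [n [_ Hn]].
  pose proof (Cmod_dist_triangle l (u n) c). specialize (Hu n). rewrite (Cmod_dist_sym l (u n)) in H0. lra. }
set (E := fun y => exists z, Cmod (z - c) <= r /\ y = F z).
destruct (classic (bound E)) as [HB | HB].
- destruct (completeness E HB) as [S [HS1 HS2]].
  { exists (F c), c. split; [rewrite Cmod_dist_refl; lra | reflexivity]. }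
  assert (Hseq : forall n : nat, exists z, Cmod (z - c) <= r /\ S - / (INR n + 1) < F z).
  { intros n. apply NNPP. intros Hn.
    assert (Hk : 0 < / (INR n + 1)) by (apply Rinv_0_lt_compat; pose proof (pos_INR n); lra).
    assert (S <= S - / (INR n + 1)); [|lra]. apply HS2. intros y [z [Hz ->]].
    apply Rnot_lt_le. intros H. apply Hn. exists z. auto. }
  apply choice in Hseq. destruct Hseq as [u Hu].
  destruct (bolzano_weierstrass_C u c r (fun n => proj1 (Hu n))) as [l Hl].
  assert (Hlc := clos u l (fun n => proj1 (Hu n)) Hl).
  exists l. split; [exact Hlc|]. intros w Hw. apply Rle_trans with S; [apply HS1; exists w; auto|].
  apply Rnot_lt_le. intros HSl.
  destruct (HF l Hlc ((S - F l) / 2) ltac:(lra)) as [d [Hd H1]].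
  destruct (archimed_cor1 ((S - F l) / 2) ltac:(lra)) as [K [HK HK0]].
  destruct (Hl d Hd K) as [n [Hn1 Hn2]].
  destruct (Hu n) as [Hu1 Hu2]. specialize (H1 _ Hu1 Hn2). apply Rabs_def2 in H1.
  assert (INR K <= INR n) by (apply le_INR; lia).
  assert (0 < INR K) by (apply lt_0_INR; lia).
  assert (/ (INR n + 1) <= / INR K) by (apply Rinv_le_contravar; lra). lra.
- exfalso.
  assert (Hseq : forall n : nat, exists z, Cmod (z - c) <= r /\ INR n < F z).
  { intros n. apply NNPP. intros Hn. apply HB. exists (INR n). intros y [z [Hz ->]].
    apply Rnot_lt_le. intros H. apply Hn. exists z. auto. }
  apply choice in Hseq. destruct Hseq as [u Hu].
  destruct (bolzano_weierstrass_C u c r (fun n => proj1 (Hu n))) as [l Hl].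
  assert (Hlc := clos u l (fun n => proj1 (Hu n)) Hl).
  destruct (HF l Hlc 1 ltac:(lra)) as [d [Hd H1]].
  destruct (INR_unbounded (F l + 1)) as [K HK].
  destruct (Hl d Hd K) as [n [Hn1 Hn2]].
  destruct (Hu n) as [Hu1 Hu2]. specialize (H1 _ Hu1 Hn2). apply Rabs_def2 in H1.
  assert (INR K <= INR n) by (apply le_INR; lia). lra.
Qed.

Lemma cderiv_segment_Re f a b c l t :
  cderiv f (a + RtoC t * b)%C l ->
  is_derive (fun s : R => Re (c * f (a + RtoC s * b)%C)) t (Re (c * (l * b))%C).
Proof.
intros H. apply is_derive_Reals. intros eps He.
set (K := (Cmod c * Cmod b + 1)).
assert (HK : 0 < K) by (unfold K; pose proof (Rmult_le_pos _ _ (Cmod_ge_0 c) (Cmod_ge_0 b)); lra).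
destruct (H (eps / (2 * K))) as [d [Hd H1]]; [apply Rdiv_lt_0_compat; lra|].
set (B := Cmod b + 1). assert (HB : 0 < B) by (unfold B; pose proof (Cmod_ge_0 b); lra).
assert (Hdd : 0 < d / B) by (apply Rdiv_lt_0_compat; lra).
exists (mkposreal _ Hdd). intros h Hh0 Hh. simpl in Hh.
specialize (H1 (RtoC h * b)%C). rewrite Cmod_mult, Cmod_R in H1.
assert (Hlt : Rabs h * Cmod b < d).
{ apply Rle_lt_trans with (Rabs h * B).
  - apply Rmult_le_compat_l; [apply Rabs_pos | unfold B; lra].
  - apply Rmult_lt_reg_r with (/ B); [apply Rinv_0_lt_compat; lra|].
    rewrite Rmult_assoc, Rinv_r, Rmult_1_r by lra. exact Hh. }
specialize (H1 Hlt).
replace (a + RtoC t * b + RtoC h * b)%C with (a + RtoC (t + h) * b)%C in H1 by (rewrite RtoC_plus; ring).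
set (D := (f (a + RtoC (t + h) * b)%C - f (a + RtoC t * b)%C - l * (RtoC h * b))%C) in *.
assert (E : (Re (c * f (a + RtoC (t + h) * b)%C) - Re (c * f (a + RtoC t * b)%C)) / h - Re (c * (l * b))
           = Re (c * D)%C / h).
{ replace (c * D)%C with (c * f (a + RtoC (t + h) * b)%C - c * f (a + RtoC t * b)%C - RtoC h * (c * (l * b)))%C by (unfold D; ring).
  rewrite !Re_minus. set (X := (c * (l * b))%C).
  replace (Re (RtoC h * X)) with (h * Re X) by (unfold Re; simpl; ring).
  field. exact Hh0. }
rewrite E. unfold Rdiv. rewrite Rabs_mult, Rabs_inv.
assert (Hh1 : 0 < Rabs h) by (apply Rabs_pos_lt, Hh0).
apply Rmult_lt_reg_r with (1 := Hh1). rewrite Rmult_assoc, Rinv_l, Rmult_1_r by lra.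
pose proof (re_le_Cmod (c * D)) as HR. rewrite Cmod_mult in HR.
assert (Cmod c * Cmod D <= Cmod c * (eps / (2 * K) * (Rabs h * Cmod b))) by (apply Rmult_le_compat_l; [apply Cmod_ge_0 | exact H1]).
assert (Cmod c * (eps / (2 * K) * (Rabs h * Cmod b)) <= eps / 2 * Rabs h); [|nra].
replace (Cmod c * (eps / (2 * K) * (Rabs h * Cmod b))) with ((Cmod c * Cmod b) * (eps / (2 * K)) * Rabs h) by ring.
apply Rmult_le_compat_r; [lra|].
replace (eps / 2) with (K * (eps / (2 * K))) by (field; lra).
apply Rmult_le_compat_r; [apply Rlt_le, Rdiv_lt_0_compat; lra | unfold K; lra].
Qed.

Lemma Re_conj_mult_self w : Re (Cconj w * w)%C = Cmod w ^ 2.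
Proof. rewrite Cmod2_alt. destruct w; unfold Re, Im; simpl. ring. Qed.

(** The mean value equality fails for complex values, so [f] is projected on the direction of its
    own increment: with [w = f b - f a], the real function [Re (Cconj w * f)] grows by exactly
    [Cmod w ^ 2] along the segment. *)
Lemma cderiv_mean_value f a b M :
  (forall t, 0 <= t <= 1 -> exists l, cderiv f (a + RtoC t * (b - a))%C l /\ Cmod l <= M) ->
  Cmod (f b - f a) <= M * Cmod (b - a).
Proof.
intros H. set (w := (f b - f a)%C).
set (phi := fun s : R => Re (Cconj w * f (a + RtoC s * (b - a))%C)).
assert (Hder : forall t, 0 <= t <= 1 -> exists l, is_derive phi t (Re (Cconj w * (l * (b - a)))%C) /\ Cmod l <= M).
{ intros t Ht. destruct (H t Ht) as [l [Hl Hm]]. exists l. split; [apply cderiv_segment_Re, Hl | exact Hm]. }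
destruct (MVT_gen phi 0 1 (Derive phi)) as [x [Hx E]].
- intros x Hx. rewrite Rmin_left, Rmax_right in Hx by lra.
  apply Derive_correct. destruct (Hder x) as [l [Hl _]]; [lra|]. eexists; exact Hl.
- intros x Hx. rewrite Rmin_left, Rmax_right in Hx by lra.
  apply continuity_pt_filterlim, (ex_derive_continuous (V := R_NormedModule) phi x).
  destruct (Hder x) as [l [Hl _]]; [lra|]. eexists; exact Hl.
- rewrite Rmin_left, Rmax_right in Hx by lra.
  destruct (Hder x Hx) as [l [Hl Hm]]. rewrite (is_derive_unique _ _ _ Hl) in E.
  assert (E1 : phi 1 - phi 0 = Cmod w ^ 2).
  { unfold phi. rewrite <- Re_conj_mult_self, <- Re_minus. f_equal.
    replace (a + RtoC 1 * (b - a))%C with b by ring. replace (a + RtoC 0 * (b - a))%C with a by ring.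
    unfold w. ring. }
  rewrite E1 in E.
  pose proof (re_le_Cmod (Cconj w * (l * (b - a)))) as HR. apply Rabs_le_between in HR.
  rewrite !Cmod_mult, Cmod_conj in HR.
  assert (HM : Cmod l * Cmod (b - a) <= M * Cmod (b - a)) by (apply Rmult_le_compat_r; [apply Cmod_ge_0 | exact Hm]).
  destruct (Req_dec (Cmod w) 0) as [E0 | E0].
  + rewrite E0. apply Rle_trans with (2 := HM). apply Rmult_le_pos; apply Cmod_ge_0.
  + pose proof (Cmod_ge_0 w). apply Rmult_le_reg_l with (Cmod w); [lra|].
    apply Rle_trans with (Cmod w * (Cmod l * Cmod (b - a))); [replace (Cmod w * Cmod w) with (Cmod w ^ 2) by ring; rewrite E; lra|].
    apply Rmult_le_compat_l; lra.
Qed.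

(** * The complex exponential and integrals along segments *)

Definition Cexp (z : C) : C := (exp (Re z) * cos (Im z), exp (Re z) * sin (Im z)).

Lemma Cexp_plus z w : Cexp (z + w)%C = (Cexp z * Cexp w)%C.
Proof.
unfold Cexp. rewrite Re_plus, Im_plus, exp_plus, cos_plus, sin_plus.
apply C_ext; unfold Re, Im; simpl; ring.
Qed.

Lemma Cmod_Cexp z : Cmod (Cexp z) = exp (Re z).
Proof.
unfold Cmod, Cexp; cbn [fst snd].
replace ((exp (Re z) * cos (Im z)) ^ 2 + (exp (Re z) * sin (Im z)) ^ 2) with ((exp (Re z)) ^ 2).
- apply sqrt_pow2, Rlt_le, exp_pos.
- pose proof (sin2_cos2 (Im z)) as H. unfold Rsqr in H.
  replace ((exp (Re z) * cos (Im z)) ^ 2 + (exp (Re z) * sin (Im z)) ^ 2) with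
    (exp (Re z) ^ 2 * (sin (Im z) * sin (Im z) + cos (Im z) * cos (Im z))) by ring.
  rewrite H. ring.
Qed.

Lemma Cexp_neq_0 z : Cexp z <> 0%C.
Proof. apply Cmod_gt_0. rewrite Cmod_Cexp. apply exp_pos. Qed.

Lemma Cexp_0 : Cexp 0 = 1%C.
Proof. unfold Cexp. simpl. rewrite exp_0, cos_0, sin_0. apply C_ext; simpl; ring. Qed.

Lemma derivable_pt_lim_0_small f l : f 0 = 0 -> derivable_pt_lim f 0 l ->
  forall eps, 0 < eps -> exists d, 0 < d /\ forall x, Rabs x < d -> Rabs (f x - l * x) <= eps * Rabs x.
Proof.
intros E H eps He. destruct (H eps He) as [d Hd]. exists d. split; [apply cond_pos|].
intros x Hx. destruct (Req_dec x 0) as [-> | Hx0].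
- rewrite E, Rmult_0_r, Rminus_0_r, Rabs_R0, Rmult_0_r. lra.
- specialize (Hd x Hx0 Hx). rewrite Rplus_0_l, E, Rminus_0_r in Hd.
  replace (f x - l * x) with ((f x / x - l) * x) by (field; exact Hx0).
  rewrite Rabs_mult. apply Rmult_le_compat_r; [apply Rabs_pos | lra].
Qed.

Lemma cderiv_Cexp_0 : cderiv Cexp 0 1.
Proof.
(* The real part of the error will be at most [4 * e * m] and the imaginary part at most
   [5 * e * m], together below [10 * e * m]. *)
intros eps He. set (e := Rmin 1 (eps / 10)).
assert (He1 : 0 < e) by (apply Rmin_pos; lra).
assert (He2 : e <= 1) by apply Rmin_l. assert (He3 : e <= eps / 10) by apply Rmin_r.
assert (D1 : derivable_pt_lim (fun x => exp x - 1) 0 1).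
{ apply is_derive_Reals. auto_derive; [auto|]. rewrite exp_0; ring. }
assert (D2 : derivable_pt_lim sin 0 1).
{ apply is_derive_Reals. auto_derive; [auto|]. rewrite cos_0; ring. }
assert (D3 : derivable_pt_lim (fun x => cos x - 1) 0 0).
{ apply is_derive_Reals. auto_derive; [auto|]. rewrite sin_0; ring. }
destruct (derivable_pt_lim_0_small (fun x => exp x - 1) 1 ltac:(cbv beta; rewrite exp_0; ring) D1 e He1) as [d1 [Hd1 H1]].
destruct (derivable_pt_lim_0_small sin 1 sin_0 D2 e He1) as [d2 [Hd2 H2]].
destruct (derivable_pt_lim_0_small (fun x => cos x - 1) 0 ltac:(cbv beta; rewrite cos_0; ring) D3 e He1) as [d3 [Hd3 H3]].
set (d := Rmin (Rmin d1 d2) (Rmin d3 e)).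
assert (Hd : 0 < d) by (unfold d; repeat apply Rmin_pos; lra).
exists d. split; [exact Hd|]. intros h Hh.
pose proof (Rmin_l (Rmin d1 d2) (Rmin d3 e)). pose proof (Rmin_r (Rmin d1 d2) (Rmin d3 e)).
pose proof (Rmin_l d1 d2). pose proof (Rmin_r d1 d2). pose proof (Rmin_l d3 e). pose proof (Rmin_r d3 e).
fold d in H, H0.
pose proof (re_le_Cmod h) as HR. pose proof (Im_le_Cmod h) as HI.
set (x := Re h) in *. set (y := Im h) in *.
specialize (H1 x ltac:(lra)). specialize (H2 y ltac:(lra)). specialize (H3 y ltac:(lra)).
eapply Rle_trans; [apply Cmod_le_Re_Im|].
replace (0 + h)%C with h by ring. rewrite Cexp_0.
set (m := Cmod h) in *.
assert (Hm : 0 <= m) by apply Cmod_ge_0.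
assert (Hx : Rabs (exp x - 1) <= 2 * Rabs x).
{ replace (exp x - 1) with ((exp x - 1 - 1 * x) + x) by ring. eapply Rle_trans; [apply Rabs_triang|].
  pose proof (Rabs_pos x). nra. }
assert (Hex : Rabs (exp x) <= 3).
{ replace (exp x) with ((exp x - 1) + 1) by ring. eapply Rle_trans; [apply Rabs_triang|]. rewrite Rabs_R1. lra. }
assert (A : Rabs (Re (Cexp h - 1 - 1 * h)%C) <= 4 * e * m).
{ replace (Re (Cexp h - 1 - 1 * h)%C) with (exp x * (cos y - 1 - 0 * y) + (exp x - 1 - 1 * x)) by (unfold x, y, Cexp, Re, Im; simpl; ring).
  eapply Rle_trans; [apply Rabs_triang|]. rewrite Rabs_mult.
  pose proof (Rabs_pos (exp x)). pose proof (Rabs_pos (cos y - 1 - 0 * y)). pose proof (Rabs_pos x). pose proof (Rabs_pos y).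
  assert (Rabs (cos y - 1 - 0 * y) <= e * m) by nra.
  assert (Rabs (exp x - 1 - 1 * x) <= e * m) by nra. nra. }
assert (B : Rabs (Im (Cexp h - 1 - 1 * h)%C) <= 5 * e * m).
{ replace (Im (Cexp h - 1 - 1 * h)%C) with (exp x * (sin y - 1 * y) + (exp x - 1) * y) by (unfold x, y, Cexp, Re, Im; simpl; ring).
  eapply Rle_trans; [apply Rabs_triang|]. rewrite !Rabs_mult.
  pose proof (Rabs_pos (exp x)). pose proof (Rabs_pos (sin y - 1 * y)). pose proof (Rabs_pos x). pose proof (Rabs_pos y).
  assert (Rabs (sin y - 1 * y) <= e * m) by nra.
  assert (Rabs (exp x - 1) * Rabs y <= 2 * e * m).
  { apply Rle_trans with ((2 * e) * Rabs y); [apply Rmult_le_compat_r; lra | apply Rmult_le_compat_l; lra]. }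
  nra. }
nra.
Qed.

Lemma cderiv_Cexp z : cderiv Cexp z (Cexp z).
Proof.
intros eps He. pose proof (Cmod_Cexp z) as E. pose proof (exp_pos (Re z)) as P.
destruct (cderiv_Cexp_0 (eps / exp (Re z))) as [d [Hd H]]; [apply Rdiv_lt_0_compat; lra|].
exists d. split; [exact Hd|]. intros h Hh. specialize (H h Hh).
replace (0 + h)%C with h in H by ring. rewrite Cexp_0 in H.
rewrite Cexp_plus. replace (Cexp z * Cexp h - Cexp z - Cexp z * h)%C with (Cexp z * (Cexp h - 1 - 1 * h))%C by ring.
rewrite Cmod_mult, E.
replace (eps * Cmod h) with (exp (Re z) * (eps / exp (Re z) * Cmod h)) by (field; lra).
apply Rmult_le_compat_l; lra.
Qed.

(** The bound on the argument is what lets [fast_growing] reach any point of a circle by a vertical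
    shift of at most [PI]. *)
Lemma Cexp_arg (w : C) x : Cmod w = exp x -> exists th, - PI <= th <= PI /\ Cexp (x, th) = w.
Proof.
intros H. pose proof (exp_pos x) as P.
set (a := Re w / exp x).
assert (Hw : Re w = exp x * a) by (unfold a; field; lra).
assert (Hn : Re w * Re w + Im w * Im w = exp x * exp x).
{ pose proof (Cmod2_alt w) as E. rewrite H in E. simpl in E. lra. }
assert (Ha : -1 <= a <= 1).
{ assert (exp x * exp x * (a * a) <= exp x * exp x * 1) by (rewrite Hw in Hn; nra).
  assert (a * a <= 1) by (apply Rmult_le_reg_l with (2 := H0); nra). nra. }
pose proof (acos_bound a) as Hb.
assert (Hs : exp x * sqrt (1 - a²) = Rabs (Im w)).
{ rewrite <- sqrt_Rsqr_abs. rewrite <- (sqrt_Rsqr (exp x)) at 1 by lra. rewrite <- sqrt_mult.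
  - f_equal. unfold Rsqr. rewrite Hw in Hn. nra.
  - apply Rle_0_sqr.
  - unfold Rsqr. nra. }
destruct (Rle_dec 0 (Im w)) as [Hi | Hi].
- exists (acos a). split; [lra|]. unfold Cexp; simpl. rewrite cos_acos, sin_acos by lra.
  rewrite Hs, Rabs_pos_eq, <- Hw by lra. destruct w; reflexivity.
- exists (- acos a). split; [lra|]. unfold Cexp; simpl. rewrite cos_neg, sin_neg, cos_acos, sin_acos by lra.
  rewrite Ropp_mult_distr_r_reverse, Hs, Rabs_left, Ropp_involutive, <- Hw by lra. destruct w; reflexivity.
Qed.

Lemma Cexp_surj (w : C) : w <> 0%C -> exists z, Cexp z = w.
Proof.
intros H. apply Cmod_gt_0 in H.
destruct (Cexp_arg w (ln (Cmod w))) as [th [_ E]]; [rewrite exp_ln; auto|].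
eexists; exact E.
Qed.

Lemma Cexp_eq_1 z : Cexp z = 1%C -> exists k : Z, z = (0, 2 * IZR k * PI).
Proof.
intros H. assert (E : Cmod (Cexp z) = 1) by (rewrite H; apply Cmod_1).
rewrite Cmod_Cexp in E. assert (Hx : Re z = 0) by (apply exp_inv; rewrite E, exp_0; reflexivity).
unfold Cexp in H. rewrite E in H. injection H as H1 H2. rewrite Rmult_1_l in H1, H2.
replace (Im z) with (2 * (Im z / 2)) in H1 by field. rewrite cos_2a_sin in H1.
assert (S : sin (Im z / 2) = 0) by nra.
apply sin_eq_0_0 in S. destruct S as [k Hk]. exists k.
apply C_ext; simpl; [exact Hx | lra].
Qed.

Lemma Cexp_2kPI k : Cexp (0, 2 * IZR k * PI) = 1%C.
Proof.
unfold Cexp; simpl. rewrite exp_0, !Rmult_1_l.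
assert (S : sin (IZR k * PI) = 0) by (apply sin_eq_0_1; exists k; reflexivity).
replace (2 * IZR k * PI) with (2 * (IZR k * PI)) by ring.
rewrite cos_2a_sin, sin_2a, S. apply C_ext; simpl; ring.
Qed.

Lemma Cexp_eq z w : Cexp z = Cexp w -> exists k : Z, z = (w + (0%R, (2 * IZR k * PI)%R))%C.
Proof.
intros H. destruct (Cexp_eq_1 (z - w)) as [k Hk].
- assert (E : (Cexp (z - w) * Cexp w)%C = (1 * Cexp w)%C).
  { rewrite <- Cexp_plus. replace (z - w + w)%C with z by ring. rewrite H. ring. }
  pose proof (Cexp_neq_0 w) as N.
  replace (Cexp (z - w)) with (Cexp (z - w) * Cexp w / Cexp w)%C by (field; exact N).
  rewrite E. field. exact N.
- exists k. rewrite <- Hk. ring.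
Qed.

Definition rcont (f : R -> C) (t : R) : Prop :=
  forall eps, 0 < eps -> exists delta, 0 < delta /\
    forall s, Rabs (s - t) < delta -> Cmod (f s - f t) < eps.

Lemma rcont_Re_Im f t : rcont f t ->
  continuous (fun s => Re (f s)) t /\ continuous (fun s => Im (f s)) t.
Proof.
intros H. split; apply continuity_pt_filterlim; intros eps He;
  destruct (H eps He) as [d [Hd H1]]; exists d; (split; [exact Hd|]);
  intros s [_ Hs]; specialize (H1 s Hs); simpl; unfold Rdist.
- rewrite <- Re_minus. eapply Rle_lt_trans; [apply re_le_Cmod | exact H1].
- rewrite <- Im_minus. eapply Rle_lt_trans; [apply Im_le_Cmod | exact H1].
Qed.

Definition CInt (f : R -> C) (a b : R) : C :=
  (RInt (fun t => Re (f t)) a b, RInt (fun t => Im (f t)) a b).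

Definition rcont_on (f : R -> C) (a b : R) : Prop := forall t, a <= t <= b -> rcont f t.

Lemma rcont_on_ex_RInt f a b : a <= b -> rcont_on f a b ->
  ex_RInt (fun t => Re (f t)) a b /\ ex_RInt (fun t => Im (f t)) a b.
Proof.
intros Hab H. split; apply (ex_RInt_continuous (V := R_CompleteNormedModule));
  intros t Ht; rewrite Rmin_left, Rmax_right in Ht by lra; apply (rcont_Re_Im f t (H t Ht)).
Qed.

Lemma rcont_on_sub f a b a' b' : rcont_on f a b -> a <= a' -> b' <= b -> rcont_on f a' b'.
Proof. intros H Ha Hb t Ht. apply H. lra. Qed.

Lemma CInt_Chasles f a b c : a <= b -> b <= c -> rcont_on f a c ->
  CInt f a c = (CInt f a b + CInt f b c)%C.
Proof.
intros Hab Hbc H.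
destruct (rcont_on_ex_RInt f a b Hab) as [A1 A2]; [apply (rcont_on_sub f a c); auto; lra|].
destruct (rcont_on_ex_RInt f b c Hbc) as [B1 B2]; [apply (rcont_on_sub f a c); auto; lra|].
apply C_ext; unfold CInt, Re, Im; simpl; symmetry.
- apply (RInt_Chasles (V := R_CompleteNormedModule)); auto.
- apply (RInt_Chasles (V := R_CompleteNormedModule)); auto.
Qed.

Lemma CInt_minus f g a b : a <= b -> rcont_on f a b -> rcont_on g a b ->
  CInt (fun t => f t - g t)%C a b = (CInt f a b - CInt g a b)%C.
Proof.
intros Hab Hf Hg.
destruct (rcont_on_ex_RInt f a b Hab Hf) as [A1 A2].
destruct (rcont_on_ex_RInt g a b Hab Hg) as [B1 B2].
apply C_ext.
- exact (RInt_minus (V := R_CompleteNormedModule) (fun t => Re (f t)) (fun t => Re (g t)) a b A1 B1).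
- exact (RInt_minus (V := R_CompleteNormedModule) (fun t => Im (f t)) (fun t => Im (g t)) a b A2 B2).
Qed.

Lemma CInt_ext f g a b : a <= b -> (forall t, a <= t <= b -> f t = g t) -> CInt f a b = CInt g a b.
Proof.
intros Hab H. apply C_ext; apply (RInt_ext (V := R_CompleteNormedModule)); intros t Ht;
  rewrite Rmin_left, Rmax_right in Ht by lra; rewrite H; auto; lra.
Qed.

Lemma RInt_affine p q a b : RInt (fun t => p + q * t) a b = p * (b - a) + q * (b * b - a * a) / 2.
Proof.
apply is_RInt_unique.
replace (p * (b - a) + q * (b * b - a * a) / 2) with
  (minus (p * b + q * (b * b) / 2) (p * a + q * (a * a) / 2)) by (unfold minus, plus, opp; simpl; field).
apply (is_RInt_derive (V := R_CompleteNormedModule) (fun t => p * t + q * (t * t) / 2)).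
- intros x _. auto_derive; [auto|]. field.
- intros x _. apply continuity_pt_filterlim. apply continuity_pt_plus; [apply continuity_pt_const; intros ? ?; reflexivity|].
  apply continuity_pt_mult; [apply continuity_pt_const; intros ? ?; reflexivity | apply continuity_pt_id].
Qed.

Lemma CInt_affine (p q : C) a b :
  CInt (fun t => p + q * RtoC t)%C a b = (p * RtoC (b - a) + q * RtoC ((b * b - a * a) / 2))%C.
Proof.
apply C_ext; unfold CInt; cbn [Re Im fst snd].
- rewrite (RInt_ext (V := R_CompleteNormedModule) _ (fun t => Re p + Re q * t)) by (intros; unfold Re, Im; simpl; ring).
  rewrite RInt_affine. unfold Re, Im; simpl. field.
- rewrite (RInt_ext (V := R_CompleteNormedModule) _ (fun t => Im p + Im q * t)) by (intros; unfold Re, Im; simpl; ring).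
  rewrite RInt_affine. unfold Re, Im; simpl. field.
Qed.

(** Tested against its own value: [Cmod w ^ 2] is the integral of [Re (Cconj w * f t)], whose
    integrand is at most [Cmod w * M]. *)
Lemma Cmod_CInt_le f a b M : a <= b -> rcont_on f a b -> (forall t, a <= t <= b -> Cmod (f t) <= M) ->
  Cmod (CInt f a b) <= M * (b - a).
Proof.
intros Hab Hf HM. destruct (rcont_on_ex_RInt f a b Hab Hf) as [A1 A2].
set (w := CInt f a b).
assert (E : Cmod w ^ 2 = RInt (fun t => plus (scal (Re w) (Re (f t))) (scal (Im w) (Im (f t)))) a b).
{ rewrite (RInt_plus (V := R_CompleteNormedModule)); [|apply (ex_RInt_scal (V := R_CompleteNormedModule)); auto ..].
  rewrite !(RInt_scal (V := R_CompleteNormedModule)) by auto.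
  rewrite Cmod2_alt. unfold w, CInt; simpl. unfold plus, scal, mult; simpl. unfold mult; simpl. ring. }
assert (L : RInt (fun t => plus (scal (Re w) (Re (f t))) (scal (Im w) (Im (f t)))) a b <= RInt (fun _ => Cmod w * M) a b).
{ apply RInt_le; auto.
  - apply (ex_RInt_plus (V := R_CompleteNormedModule)); apply (ex_RInt_scal (V := R_CompleteNormedModule)); auto.
  - apply ex_RInt_const.
  - intros t Ht. change (Re w * Re (f t) + Im w * Im (f t) <= Cmod w * M).
    replace (Re w * Re (f t) + Im w * Im (f t)) with (Re (Cconj w * f t)%C) by (unfold Re, Im; simpl; ring).
    pose proof (re_le_Cmod (Cconj w * f t)) as HR. apply Rabs_le_between in HR. rewrite Cmod_mult, Cmod_conj in HR.
    specialize (HM t ltac:(lra)). apply Rle_trans with (1 := proj2 HR).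
    apply Rmult_le_compat_l; [apply Cmod_ge_0 | exact HM]. }
rewrite (RInt_const (V := R_CompleteNormedModule)) in L. rewrite <- E in L.
change (Cmod w ^ 2 <= (b - a) * (Cmod w * M)) in L.
destruct (Req_dec (Cmod w) 0) as [E0 | E0].
- rewrite E0. pose proof (Cmod_ge_0 (f a)). specialize (HM a ltac:(lra)). apply Rmult_le_pos; lra.
- pose proof (Cmod_ge_0 w). apply Rmult_le_reg_l with (Cmod w); [lra|]. nra.
Qed.

(** * Goursat's lemma and Cauchy estimates *)

Definition hline (F : C -> C) y a b : C := CInt (fun t => F (t, y)) a b.
Definition vline (F : C -> C) x c d : C := CInt (fun t => F (x, t)) c d.

(** The integral of [F dz] over the boundary of the rectangle, counterclockwise; the factor [Ci] is
    [dz / dt] on vertical sides. *)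
Definition rectI (F : C -> C) a b c d : C :=
  (hline F c a b + Ci * vline F b c d - hline F d a b - Ci * vline F a c d)%C.

Definition cont_rect (F : C -> C) a b c d : Prop :=
  forall x y, a <= x <= b -> c <= y <= d -> ccont F (x, y).

Lemma rcont_hline F x y : ccont F (x, y) -> rcont (fun t => F (t, y)) x.
Proof.
intros H eps He. destruct (H eps He) as [d [Hd H1]]. exists d. split; [exact Hd|].
intros s Hs. apply H1. replace ((s, y) - (x, y))%C with (RtoC (s - x)).
- rewrite Cmod_R. exact Hs.
- apply C_ext; simpl; ring.
Qed.

Lemma rcont_vline F x y : ccont F (x, y) -> rcont (fun t => F (x, t)) y.
Proof.
intros H eps He. destruct (H eps He) as [d [Hd H1]]. exists d. split; [exact Hd|].
intros s Hs. apply H1. replace ((x, s) - (x, y))%C with (Ci * RtoC (s - y))%C.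
- rewrite Cmod_mult, Cmod_Ci, Cmod_R, Rmult_1_l. exact Hs.
- apply C_ext; simpl; ring.
Qed.

Lemma rcont_on_hline F a b c d y : cont_rect F a b c d -> c <= y <= d -> rcont_on (fun t => F (t, y)) a b.
Proof. intros H Hy t Ht. apply rcont_hline, H; auto. Qed.

Lemma rcont_on_vline F a b c d x : cont_rect F a b c d -> a <= x <= b -> rcont_on (fun t => F (x, t)) c d.
Proof. intros H Hy t Ht. apply rcont_vline, H; auto. Qed.

Lemma rectI_quarters F a b c d m n : a <= m <= b -> c <= n <= d -> cont_rect F a b c d ->
  rectI F a b c d = (rectI F a m c n + rectI F m b c n + rectI F a m n d + rectI F m b n d)%C.
Proof.
intros Hm Hn H. unfold rectI, hline, vline.
rewrite (CInt_Chasles (fun t => F (t, c)) a m b), (CInt_Chasles (fun t => F (t, d)) a m b),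
  (CInt_Chasles (fun t => F (a, t)) c n d), (CInt_Chasles (fun t => F (b, t)) c n d); try lra.
- ring.
- eapply rcont_on_vline; [exact H | lra].
- eapply rcont_on_vline; [exact H | lra].
- eapply rcont_on_hline; [exact H | lra].
- eapply rcont_on_hline; [exact H | lra].
Qed.

Lemma rectI_affine (p q : C) a b c d : rectI (fun z => p + q * z)%C a b c d = 0%C.
Proof.
assert (Hh : forall y, hline (fun z => p + q * z)%C y a b =
   ((p + q * (0, y)) * RtoC (b - a) + q * RtoC ((b * b - a * a) / 2))%C).
{ intros y. rewrite <- CInt_affine. unfold hline. f_equal.
  apply FunctionalExtensionality.functional_extensionality. intros t. apply C_ext; unfold Re, Im; simpl; ring. }
assert (Hv : forall x, vline (fun z => p + q * z)%C x c d =
   ((p + q * RtoC x) * RtoC (d - c) + (q * Ci) * RtoC ((d * d - c * c) / 2))%C).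
{ intros x. rewrite <- CInt_affine. unfold vline. f_equal.
  apply FunctionalExtensionality.functional_extensionality. intros t. apply C_ext; unfold Re, Im; simpl; ring. }
unfold rectI. rewrite !Hh, !Hv. apply C_ext; unfold Re, Im; simpl; field.
Qed.

Lemma rectI_minus F G a b c d : a <= b -> c <= d -> cont_rect F a b c d -> cont_rect G a b c d ->
  rectI (fun z => F z - G z)%C a b c d = (rectI F a b c d - rectI G a b c d)%C.
Proof.
intros Hab Hcd HF HG. unfold rectI, hline, vline.
rewrite (CInt_minus (fun t => F (t, c)) (fun t => G (t, c))), (CInt_minus (fun t => F (t, d)) (fun t => G (t, d))),
  (CInt_minus (fun t => F (a, t)) (fun t => G (a, t))), (CInt_minus (fun t => F (b, t)) (fun t => G (b, t))); auto.
- ring.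
- eapply rcont_on_vline; [exact HF | lra].
- eapply rcont_on_vline; [exact HG | lra].
- eapply rcont_on_vline; [exact HF | lra].
- eapply rcont_on_vline; [exact HG | lra].
- eapply rcont_on_hline; [exact HF | lra].
- eapply rcont_on_hline; [exact HG | lra].
- eapply rcont_on_hline; [exact HF | lra].
- eapply rcont_on_hline; [exact HG | lra].
Qed.

Lemma Cmod_rectI_le F a b c d M : a <= b -> c <= d -> cont_rect F a b c d ->
  (forall x y, a <= x <= b -> c <= y <= d -> Cmod (F (x, y)) <= M) ->
  Cmod (rectI F a b c d) <= M * (2 * (b - a) + 2 * (d - c)).
Proof.
intros Hab Hcd HF HM.
assert (Hh : forall y, c <= y <= d -> Cmod (hline F y a b) <= M * (b - a)).
{ intros y Hy. apply Cmod_CInt_le; auto. eapply rcont_on_hline; eauto. }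
assert (Hv : forall x, a <= x <= b -> Cmod (vline F x c d) <= M * (d - c)).
{ intros x Hx. apply Cmod_CInt_le; auto. eapply rcont_on_vline; eauto. }
pose proof (Hh c ltac:(lra)). pose proof (Hh d ltac:(lra)).
pose proof (Hv a ltac:(lra)). pose proof (Hv b ltac:(lra)).
unfold rectI.
pose proof (Cmod_sub_le (hline F c a b + Ci * vline F b c d - hline F d a b) (Ci * vline F a c d)).
pose proof (Cmod_sub_le (hline F c a b + Ci * vline F b c d) (hline F d a b)).
pose proof (Cmod_triangle (hline F c a b) (Ci * vline F b c d)).
rewrite !Cmod_mult, Cmod_Ci, !Rmult_1_l in *. lra.
Qed.

Lemma pow_2_unbounded M : exists n, M < 2 ^ n.
Proof.
destruct (Pow_x_infinity 2 ltac:(rewrite Rabs_pos_eq; lra) (M + 1)) as [N HN].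
exists N. specialize (HN N (le_n N)). rewrite Rabs_pos_eq in HN; [lra | apply pow_le; lra].
Qed.

Lemma goursat F a b c d : a <= b -> c <= d ->
  (forall x y, a <= x <= b -> c <= y <= d -> exists l, cderiv F (x, y) l) ->
  rectI F a b c d = 0%C.
Proof.
intros Hab Hcd HF.
assert (HC : cont_rect F a b c d).
{ intros x y Hx Hy. destruct (HF x y Hx Hy) as [l Hl]. apply (cderiv_cont _ _ _ Hl). }
apply Cmod_eq_0. apply Rle_antisym; [|apply Cmod_ge_0]. apply Rnot_lt_le. intros Hpos.
set (e := Cmod (rectI F a b c d)) in *.
set (QT := ((R * R) * (R * R))%type).
set (A := fun q : QT => fst (fst q)). set (B := fun q : QT => snd (fst q)).
set (C' := fun q : QT => fst (snd q)). set (D := fun q : QT => snd (snd q)).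
set (val := fun q : QT => a <= A q <= B q /\ B q <= b /\ c <= C' q <= D q /\ D q <= d).
set (I := fun q : QT => Cmod (rectI F (A q) (B q) (C' q) (D q))).
(* Bisection: one quarter carries at least a quarter of the integral. A quadruple that is not a
   rectangle is returned unchanged, so that [choice] applies to all of [QT]. *)
assert (step : forall q : QT, exists q' : QT, val q ->
  (A q <= A q' <= B q' /\ B q' <= B q /\ C' q <= C' q' <= D q' /\ D q' <= D q) /\
  B q' - A q' = (B q - A q) / 2 /\ D q' - C' q' = (D q - C' q) / 2 /\ I q / 4 <= I q').
{ intros q. destruct (classic (val q)) as [V | V]; [|exists q; tauto].
  destruct V as [V1 [V2 [V3 V4]]].
  set (m := (A q + B q) / 2). set (n := (C' q + D q) / 2).
  assert (Hq := rectI_quarters F (A q) (B q) (C' q) (D q) m n ltac:(unfold m; lra) ltac:(unfold n; lra)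
    ltac:(intros x y Hx Hy; apply HC; lra)).
  destruct (Rle_dec (I q / 4) (I ((A q, m), (C' q, n)))) as [L1 | L1].
  { exists ((A q, m), (C' q, n)). intros _. split; [|split; [|split; [|exact L1]]]; unfold A, B, C', D in *; simpl; unfold m, n; lra. }
  destruct (Rle_dec (I q / 4) (I ((m, B q), (C' q, n)))) as [L2 | L2].
  { exists ((m, B q), (C' q, n)). intros _. split; [|split; [|split; [|exact L2]]]; unfold A, B, C', D in *; simpl; unfold m, n; lra. }
  destruct (Rle_dec (I q / 4) (I ((A q, m), (n, D q)))) as [L3 | L3].
  { exists ((A q, m), (n, D q)). intros _. split; [|split; [|split; [|exact L3]]]; unfold A, B, C', D in *; simpl; unfold m, n; lra. }
  destruct (Rle_dec (I q / 4) (I ((m, B q), (n, D q)))) as [L4 | L4].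
  { exists ((m, B q), (n, D q)). intros _. split; [|split; [|split; [|exact L4]]]; unfold A, B, C', D in *; simpl; unfold m, n; lra. }
  exfalso. unfold I in *. cbn [A B C' D fst snd] in *.
  assert (T := Cmod_triangle (rectI F (A q) m (C' q) n + rectI F m (B q) (C' q) n + rectI F (A q) m n (D q)) (rectI F m (B q) n (D q))).
  assert (T2 := Cmod_triangle (rectI F (A q) m (C' q) n + rectI F m (B q) (C' q) n) (rectI F (A q) m n (D q))).
  assert (T3 := Cmod_triangle (rectI F (A q) m (C' q) n) (rectI F m (B q) (C' q) n)).
  rewrite <- Hq in T. unfold A, B, C', D in *; simpl in *. lra. }
apply choice in step. destruct step as [st Hst].
set (Q := fun n => Nat.iter n st ((a, b), (c, d))).
assert (QS : forall n, Q (S n) = st (Q n)) by reflexivity.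
assert (V : forall n, val (Q n)).
{ induction n as [|n IH]; [unfold val, Q, A, B, C', D; simpl; lra|].
  rewrite QS. destruct (Hst _ IH) as [H1 _]. unfold val in *. lra. }
assert (nest : forall n k, A (Q n) <= A (Q (k + n)%nat) /\ B (Q (k + n)%nat) <= B (Q n) /\
   C' (Q n) <= C' (Q (k + n)%nat) /\ D (Q (k + n)%nat) <= D (Q n)).
{ intros n k. induction k as [|k IH]; [simpl; lra|].
  change (S k + n)%nat with (S (k + n)). rewrite QS.
  destruct (Hst _ (V (k + n)%nat)) as [H1 _]. lra. }
assert (size : forall n, B (Q n) - A (Q n) = (b - a) / 2 ^ n /\ D (Q n) - C' (Q n) = (d - c) / 2 ^ n /\ e / (2 ^ n * 2 ^ n) <= I (Q n)).
{ induction n as [|n IH].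
  - unfold Q, A, B, C', D, I; simpl. fold e. split; [field|split; [field|]]. apply Req_le. unfold A, B, C', D; simpl. fold e. field.
  - rewrite QS. destruct (Hst _ (V n)) as [_ [H1 [H2 H3]]]. destruct IH as [I1 [I2 I3]].
    assert (P : 0 < 2 ^ n) by (apply pow_lt; lra).
    rewrite H1, H2, I1, I2. simpl. split; [field; lra|]. split; [field; lra|].
    apply Rle_trans with (2 := H3). apply Rle_trans with (e / (2 ^ n * 2 ^ n) / 4); [|lra].
    apply Req_le. field. lra. }
destruct (bolzano_weierstrass_C (fun n => (A (Q n), C' (Q n))) (a, c) ((b - a) + (d - c))) as [l Hl].
{ intros n. destruct (V n) as [V1 [V2 [V3 V4]]]. eapply Rle_trans; [apply Cmod_le_Re_Im|].
  rewrite Re_minus, Im_minus. simpl. rewrite !Rabs_pos_eq; lra. }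
assert (Hin : forall n, A (Q n) <= Re l <= B (Q n) /\ C' (Q n) <= Im l <= D (Q n)).
{ intros n.
  assert (Happ : forall eps, 0 < eps -> A (Q n) - eps <= Re l <= B (Q n) + eps /\ C' (Q n) - eps <= Im l <= D (Q n) + eps).
  { intros eps He. destruct (Hl eps He n) as [m [Hm1 Hm2]].
    replace m with ((m - n) + n)%nat in Hm2 by lia. set (k := (m - n)%nat) in *.
    destruct (nest n k) as [N1 [N2 [N3 N4]]]. destruct (V (k + n)%nat) as [V1 [V2 [V3 V4]]].
    pose proof (re_le_Cmod ((A (Q (k + n)%nat), C' (Q (k + n)%nat)) - l)) as HR.
    pose proof (Im_le_Cmod ((A (Q (k + n)%nat), C' (Q (k + n)%nat)) - l)) as HI.
    rewrite Re_minus in HR. rewrite Im_minus in HI. simpl in HR, HI.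
    apply Rabs_le_between in HR. apply Rabs_le_between in HI. lra. }
  repeat split; apply le_epsilon; intros eps He; specialize (Happ eps He); lra. }
assert (Hl0 := Hin 0%nat). unfold Q, A, B, C', D in Hl0; simpl in Hl0.
destruct (HF (Re l) (Im l)) as [l' Hd]; try lra.
replace (Re l, Im l) with l in Hd by (destruct l; reflexivity).
(* [w / 2 ^ n] exceeds both the diameter and half the perimeter of the n-th rectangle. With
   derivative error [e / (4 * w * w)] the integral over it is less than half of [e / 4 ^ n], its
   lower bound. *)
set (w := (b - a) + (d - c) + 1). assert (Hw : 0 < w) by (unfold w; lra).
destruct (Hd (e / (4 * w * w))) as [dl [Hdl H1]].
{ apply Rdiv_lt_0_compat; [lra|]. nra. }
destruct (pow_2_unbounded (w / dl)) as [n Hn].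
assert (P : 0 < 2 ^ n) by (apply pow_lt; lra).
assert (Hs : w / 2 ^ n < dl).
{ apply Rmult_lt_reg_r with (2 ^ n); [exact P|]. replace (w / 2 ^ n * 2 ^ n) with w by (field; lra).
  apply Rmult_lt_reg_r with (/ dl); [apply Rinv_0_lt_compat; exact Hdl|].
  replace (dl * 2 ^ n * / dl) with (2 ^ n) by (field; lra). exact Hn. }
destruct (size n) as [S1 [S2 S3]]. destruct (V n) as [V1 [V2 [V3 V4]]]. destruct (Hin n) as [L1 L2].
set (G := fun z : C => ((F l - l' * l) + l' * z)%C).
assert (HG : forall z, exists m, cderiv G z m).
{ intros z. eexists. apply cderiv_plus; [apply cderiv_const | apply cderiv_scal, cderiv_id]. }
assert (HFn : cont_rect F (A (Q n)) (B (Q n)) (C' (Q n)) (D (Q n))) by (intros x y Hx Hy; apply HC; lra).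
assert (HGn : cont_rect G (A (Q n)) (B (Q n)) (C' (Q n)) (D (Q n))).
{ intros x y Hx Hy. destruct (HG (x, y)) as [m Hm]. apply (cderiv_cont _ _ _ Hm). }
assert (E := rectI_minus F G (A (Q n)) (B (Q n)) (C' (Q n)) (D (Q n)) ltac:(lra) ltac:(lra) HFn HGn).
unfold G at 2 in E. rewrite rectI_affine in E.
assert (Bd : Cmod (rectI (fun z => F z - G z)%C (A (Q n)) (B (Q n)) (C' (Q n)) (D (Q n)))
   <= (e / (4 * w * w) * (w / 2 ^ n)) * (2 * (B (Q n) - A (Q n)) + 2 * (D (Q n) - C' (Q n)))).
{ apply Cmod_rectI_le; try lra.
  - intros x y Hx Hy. destruct (HF x y) as [m1 Hm1]; try lra. destruct (HG (x, y)) as [m2 Hm2].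
    apply (cderiv_cont _ _ _ (cderiv_minus _ _ _ _ _ Hm1 Hm2)).
  - intros x y Hx Hy.
    assert (Hdist : Cmod ((x, y) - l) <= w / 2 ^ n).
    { eapply Rle_trans; [apply Cmod_le_Re_Im|]. rewrite Re_minus, Im_minus. cbn [Re Im fst snd].
      apply Rle_trans with ((B (Q n) - A (Q n)) + (D (Q n) - C' (Q n))).
      - apply Rplus_le_compat; apply Rabs_le_between; simpl; unfold Re, Im in *; lra.
      - rewrite S1, S2. unfold w, Rdiv. assert (0 < / 2 ^ n) by (apply Rinv_0_lt_compat; exact P). nra. }
    specialize (H1 ((x, y) - l)%C ltac:(lra)).
    assert (Ez : forall u v : C, (v + (u - v))%C = u) by (intros; ring). rewrite Ez in H1.
    replace (F (x, y) - G (x, y))%C with (F (x, y) - F l - l' * ((x, y) - l))%C by (unfold G; ring).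
    apply Rle_trans with (1 := H1). apply Rmult_le_compat_l; [|exact Hdist].
    apply Rlt_le, Rdiv_lt_0_compat; [lra|nra]. }
rewrite E in Bd. replace (rectI F (A (Q n)) (B (Q n)) (C' (Q n)) (D (Q n)) - 0)%C with (rectI F (A (Q n)) (B (Q n)) (C' (Q n)) (D (Q n))) in Bd by ring.
fold (I (Q n)) in Bd. rewrite S1, S2 in Bd.
assert (Bd2 : e / (4 * w * w) * (w / 2 ^ n) * (2 * ((b - a) / 2 ^ n) + 2 * ((d - c) / 2 ^ n)) = (e / (2 ^ n * 2 ^ n)) * (((b - a) + (d - c)) / (2 * w))) by (field; lra).
rewrite Bd2 in Bd.
assert (0 < e / (2 ^ n * 2 ^ n)) by (apply Rdiv_lt_0_compat; [lra | nra]).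
assert (((b - a) + (d - c)) / (2 * w) < 1).
{ apply Rmult_lt_reg_r with (2 * w); [lra|]. unfold Rdiv. rewrite Rmult_assoc, Rinv_l by lra. unfold w; lra. }
nra.
Qed.

(** On the rectangle [[ln s, ln r] x [0, 2 pi]] the horizontal sides cancel by periodicity of
    [Cexp], so the means over the circles of radius [s] and [r] agree; continuity at [c] identifies
    the limit as [s] tends to 0. Differentiability is asked only off [c], so that difference
    quotients patched at [c] qualify. *)
Lemma circle_mean_bound F c rho r M : 0 < r < rho ->
  (forall z, 0 < Cmod (z - c) < rho -> exists l, cderiv F z l) -> ccont F c ->
  (forall z, Cmod (z - c) = r -> Cmod (F z) <= M) -> Cmod (F c) <= M.
Proof.
intros Hr HF Hc HM. apply le_epsilon. intros eps He.
destruct (Hc eps He) as [d [Hd H1]].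
set (s := Rmin d r / 2).
assert (Hs : 0 < s) by (unfold s; assert (0 < Rmin d r) by (apply Rmin_pos; lra); lra).
assert (Hsd : s < d) by (unfold s in *; pose proof (Rmin_l d r); lra).
assert (Hsr : s < r) by (unfold s in *; pose proof (Rmin_r d r); lra).
set (G := fun w => F (c + Cexp w)%C).
assert (HG : forall w, Re w < ln rho -> exists l, cderiv G w l).
{ intros w Hw. destruct (HF (c + Cexp w)%C) as [l Hl].
  - replace (c + Cexp w - c)%C with (Cexp w) by ring. rewrite Cmod_Cexp. split; [apply exp_pos|].
    rewrite <- (exp_ln rho) by lra. apply exp_increasing, Hw.
  - eexists. apply (cderiv_comp F (fun w => c + Cexp w)%C w l (0 + Cexp w)%C Hl).
    apply cderiv_plus; [apply cderiv_const | apply cderiv_Cexp]. }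
assert (Hln : ln s < ln r) by (apply ln_increasing; lra).
assert (Hln2 : ln r < ln rho) by (apply ln_increasing; lra).
pose proof PI_RGT_0 as HPI.
assert (E := goursat G (ln s) (ln r) 0 (2 * PI) ltac:(lra) ltac:(lra) ltac:(intros x y Hx Hy; apply HG; simpl; lra)).
assert (HGc : forall x, x < ln rho -> rcont_on (fun t => G (x, t)) 0 (2 * PI)).
{ intros x Hx t _. apply rcont_vline. destruct (HG (x, t)) as [l Hl]; [exact Hx|]. apply (cderiv_cont _ _ _ Hl). }
assert (Eh : hline G (2 * PI) (ln s) (ln r) = hline G 0 (ln s) (ln r)).
{ unfold hline. apply CInt_ext; [lra|]. intros t _. unfold G, Cexp. simpl.
  rewrite cos_2PI, sin_2PI, cos_0, sin_0. reflexivity. }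
unfold rectI in E. rewrite Eh in E.
assert (E2 : vline G (ln r) 0 (2 * PI) = vline G (ln s) 0 (2 * PI)).
{ apply Ceq_minus. replace (vline G (ln r) 0 (2 * PI) - vline G (ln s) 0 (2 * PI))%C
   with (- Ci * (hline G 0 (ln s) (ln r) + Ci * vline G (ln r) 0 (2 * PI) - hline G 0 (ln s) (ln r) - Ci * vline G (ln s) 0 (2 * PI)))%C.
  - rewrite E. ring.
  - apply C_ext; unfold Re, Im; simpl; ring. }
assert (B1 : Cmod (vline G (ln r) 0 (2 * PI)) <= M * (2 * PI - 0)).
{ apply Cmod_CInt_le; [lra | apply HGc; lra |]. intros t _. apply HM.
  replace (c + Cexp (ln r, t) - c)%C with (Cexp (ln r, t)) by ring. rewrite Cmod_Cexp. simpl. apply exp_ln; lra. }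
assert (Hk : rcont_on (fun _ => F c) 0 (2 * PI)).
{ intros t _ e' He'. exists 1. split; [lra|]. intros. rewrite Cmod_dist_refl. exact He'. }
assert (B2 : Cmod (CInt (fun t => G (ln s, t) - F c)%C 0 (2 * PI)) <= eps * (2 * PI - 0)).
{ apply Cmod_CInt_le; [lra | |].
  - intros t Ht e' He'. destruct (HGc (ln s) ltac:(lra) t Ht e' He') as [d' [Hd' H2]].
    exists d'. split; [exact Hd'|]. intros u Hu. specialize (H2 u Hu).
    replace (G (ln s, u) - F c - (G (ln s, t) - F c))%C with (G (ln s, u) - G (ln s, t))%C by ring. exact H2.
  - intros t _. apply Rlt_le, H1. replace (c + Cexp (ln s, t) - c)%C with (Cexp (ln s, t)) by ring.
    rewrite Cmod_Cexp. simpl. rewrite exp_ln; lra. }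
rewrite CInt_minus in B2; [| lra | apply HGc; lra | exact Hk].
fold (vline G (ln s) 0 (2 * PI)) in B2. rewrite <- E2 in B2.
assert (Ek : CInt (fun _ => F c) 0 (2 * PI) = (F c * RtoC (2 * PI))%C).
{ rewrite (CInt_ext _ (fun t => F c + 0 * RtoC t)%C) by (try lra; intros; ring). rewrite CInt_affine.
  apply C_ext; unfold Re, Im; simpl; field. }
rewrite Ek in B2.
pose proof (Cmod_le_add_sub (vline G (ln r) 0 (2 * PI)) (F c * RtoC (2 * PI))) as T.
rewrite Cmod_mult, Cmod_R, Rabs_pos_eq in T by lra. nra.
Qed.

(** The quotient [(f z - f c) / (z - c)], given the value [l] at [c], is at most [2 * M / s] on the
    circle of radius [s], hence so is [l]. The hypotheses concern the open disc, so [s < r] and then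
    [s] tends to [r]. *)
Lemma cauchy_estimate f c l r M : 0 < r ->
  (forall z, Cmod (z - c) < r -> exists l, cderiv f z l) ->
  (forall z, Cmod (z - c) < r -> Cmod (f z) <= M) -> cderiv f c l -> Cmod l <= 2 * M / r.
Proof.
intros Hr Hf HM Hl.
set (q := fun z => if Ceq_dec z c then l else ((f z - f c) / (z - c))%C).
assert (Hqc : q c = l) by (unfold q; destruct (Ceq_dec c c); congruence).
assert (Hq : forall z, z <> c -> q z = ((f z - f c) / (z - c))%C) by (intros z Hz; unfold q; destruct (Ceq_dec z c); congruence).
assert (cq : ccont q c).
{ intros eps He. destruct (Hl (eps / 2)) as [d [Hd H1]]; [lra|]. exists d. split; [exact Hd|].
  intros w Hw. rewrite Hqc. destruct (Ceq_dec w c) as [-> | Hwc].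
  - rewrite Hqc, Cmod_dist_refl. exact He.
  - rewrite Hq by exact Hwc. specialize (H1 _ Hw). replace (c + (w - c))%C with w in H1 by ring.
    assert (Hn : (w - c)%C <> 0%C) by (intros E; apply Hwc, Ceq_minus, E).
    replace ((f w - f c) / (w - c) - l)%C with ((f w - f c - l * (w - c)) / (w - c))%C by (field; exact Hn).
    rewrite Cmod_div by exact Hn. apply Cmod_gt_0 in Hn.
    apply Rle_lt_trans with (eps / 2); [|lra]. apply Rmult_le_reg_r with (1 := Hn).
    unfold Rdiv at 1. rewrite Rmult_assoc, Rinv_l, Rmult_1_r by lra. exact H1. }
assert (dq : forall z, 0 < Cmod (z - c) < r -> exists m, cderiv q z m).
{ intros z [Hz1 Hz2]. destruct (Hf z Hz2) as [m Hm].
  assert (Hn : (z - c)%C <> 0%C) by (apply Cmod_gt_0; exact Hz1).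
  eexists. apply (cderiv_ext_loc (fun z => (f z - f c) * / (z - c))%C) with (Cmod (z - c)); [exact Hz1 | |].
  - intros w Hw. rewrite Hq; [reflexivity|]. intros ->. rewrite Cmod_dist_sym in Hw. lra.
  - apply cderiv_mult; [apply cderiv_minus; [exact Hm | apply cderiv_const]|].
    apply cderiv_inv_comp; [|exact Hn]. apply cderiv_minus; [apply cderiv_id | apply cderiv_const]. }
assert (M0 : 0 <= M).
{ apply Rle_trans with (Cmod (f c)); [apply Cmod_ge_0 | apply HM; rewrite Cmod_dist_refl; exact Hr]. }
assert (Hbd : forall s, 0 < s < r -> Cmod l * s <= 2 * M).
{ intros s Hs. rewrite <- Hqc.
  assert (Cmod (q c) <= 2 * M / s).
  { apply (circle_mean_bound q c r s); auto. intros z Hz.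
    assert (Hn : (z - c)%C <> 0%C) by (apply Cmod_gt_0; lra).
    rewrite Hq by (intros E; apply Hn; rewrite E; ring). rewrite Cmod_div, Hz by exact Hn.
    apply Rmult_le_compat_r; [apply Rlt_le, Rinv_0_lt_compat; lra|].
    pose proof (Cmod_sub_le (f z) (f c)). pose proof (HM z ltac:(lra)).
    pose proof (HM c ltac:(rewrite Cmod_dist_refl; lra)). lra. }
  apply Rle_trans with (2 * M / s * s); [apply Rmult_le_compat_r; lra | apply Req_le; field; lra]. }
apply Rmult_le_reg_r with (1 := Hr). replace (2 * M / r * r) with (2 * M) by (field; lra).
apply le_epsilon. intros eps He.
set (t := Rmin (r / 2) (eps / (Cmod l + 1))).
pose proof (Cmod_ge_0 l) as L0.
assert (0 < eps / (Cmod l + 1)) by (apply Rdiv_lt_0_compat; lra).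
assert (Ht : 0 < t) by (apply Rmin_pos; lra).
assert (t <= r / 2) by apply Rmin_l. assert (t <= eps / (Cmod l + 1)) by apply Rmin_r.
specialize (Hbd (r - t) ltac:(lra)).
assert (Cmod l * t <= eps); [|lra].
apply Rle_trans with ((Cmod l + 1) * (eps / (Cmod l + 1))); [apply Rmult_le_compat; lra | apply Req_le; field; lra].
Qed.

(** * Higher derivatives and division of entire functions *)

Definition hol_disc (f : C -> C) (c : C) (r : R) : Prop :=
  forall z, Cmod (z - c) < r -> exists l, cderiv f z l.

Lemma hol_disc_sub f c r c' r' : hol_disc f c r -> Cmod (c' - c) + r' <= r -> hol_disc f c' r'.
Proof. intros H Hr z Hz. apply H. pose proof (Cmod_dist_triangle z c' c). lra. Qed.

Lemma segment_in_disc a b c r t : Cmod (a - c) < r -> Cmod (b - c) < r -> 0 <= t <= 1 ->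
  Cmod (a + RtoC t * (b - a) - c) < r.
Proof.
intros Ha Hb Ht.
replace (a + RtoC t * (b - a) - c)%C with (RtoC (1 - t) * (a - c) + RtoC t * (b - c))%C by (rewrite RtoC_minus; ring).
eapply Rle_lt_trans; [apply Cmod_triangle|]. rewrite !Cmod_mult, !Cmod_R, !Rabs_pos_eq by lra.
destruct (Rle_dec t (1 / 2)); [assert (0 < (1 - t) * (r - Cmod (a - c))) by (apply Rmult_lt_0_compat; lra); assert (0 <= t * (r - Cmod (b - c))) by (apply Rmult_le_pos; lra)
 | assert (0 <= (1 - t) * (r - Cmod (a - c))) by (apply Rmult_le_pos; lra); assert (0 < t * (r - Cmod (b - c))) by (apply Rmult_lt_0_compat; lra)]; lra.
Qed.

Lemma deriv_bound f c r M z l : 0 < r -> hol_disc f c r ->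
  (forall w, Cmod (w - c) < r -> Cmod (f w) <= M) ->
  Cmod (z - c) <= r / 2 -> cderiv f z l -> Cmod l <= 4 * M / r.
Proof.
intros Hr Hf HM Hz Hl. replace (4 * M / r) with (2 * M / (r / 2)) by (field; lra).
apply cauchy_estimate with f z; auto; try lra.
- apply (hol_disc_sub f c r); [exact Hf | lra].
- intros w Hw. apply HM. pose proof (Cmod_dist_triangle w z c). lra.
Qed.

(** A Cauchy estimate for [f (z + k) - f z], which the mean value inequality bounds by [L * Cmod k];
    thus [f'] is Lipschitz before it is known to be differentiable. *)
Lemma deriv_lipschitz f c r L k l0 l1 : 0 < r -> hol_disc f c r ->
  (forall z l, Cmod (z - c) < r -> cderiv f z l -> Cmod l <= L) ->
  Cmod k < r / 2 -> cderiv f c l0 -> cderiv f (c + k)%C l1 ->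
  Cmod (l1 - l0) <= 4 * L * Cmod k / r.
Proof.
intros Hr Hf HL Hk H0 H1.
replace (4 * L * Cmod k / r) with (2 * (L * Cmod k) / (r / 2)) by (field; lra).
assert (Hin : forall z, Cmod (z - c) < r / 2 -> Cmod (z - c) < r /\ Cmod (z + k - c) < r).
{ intros z Hz. split; [lra|]. replace (z + k - c)%C with ((z - c) + k)%C by ring.
  eapply Rle_lt_trans; [apply Cmod_triangle|]. lra. }
assert (Hd : forall z l l', cderiv f (z + k)%C l -> cderiv f z l' -> cderiv (fun z => f (z + k) - f z)%C z (l - l')%C).
{ intros z l l' A B. apply cderiv_minus; [|exact B].
  replace l with (l * (1 + 0))%C by ring. apply (cderiv_comp f (fun z => z + k)%C); [exact A|].
  apply cderiv_plus; [apply cderiv_id | apply cderiv_const]. }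
apply cauchy_estimate with (fun z => f (z + k) - f z)%C c; auto; [lra | |].
- intros z Hz. destruct (Hin z Hz) as [A B]. destruct (Hf _ A) as [l' Hl']. destruct (Hf _ B) as [l Hl].
  eexists. apply (Hd z l l' Hl Hl').
- intros z Hz. destruct (Hin z Hz) as [A B]. replace k with (z + k - z)%C at 2 by ring.
  apply cderiv_mean_value. intros t Ht.
  assert (S := segment_in_disc z (z + k)%C c r t A B Ht).
  destruct (Hf _ S) as [l Hl]. exists l. split; [exact Hl | apply (HL _ _ S Hl)].
Qed.

(** Continuity of the derivative: [f] is bounded near [c], the Cauchy estimate bounds [f'] on half
    that disc, and [deriv_lipschitz] applies on it. *)
Lemma deriv_close f c r l0 eps : 0 < r -> hol_disc f c r -> cderiv f c l0 -> 0 < eps ->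
  exists s, 0 < s <= r /\ forall z l, Cmod (z - c) < s -> cderiv f z l -> Cmod (l - l0) <= eps.
Proof.
intros Hr Hf H0 He.
destruct (cderiv_cont _ _ _ H0 1 Rlt_0_1) as [d [Hd Hc]].
set (r1 := Rmin r d). assert (Hr1 : 0 < r1) by (apply Rmin_pos; lra).
assert (L1 : r1 <= r) by apply Rmin_l. assert (L2 : r1 <= d) by apply Rmin_r.
set (M := Cmod (f c) + 1). assert (HM : 0 < M) by (unfold M; pose proof (Cmod_ge_0 (f c)); lra).
set (L := 4 * M / r1). assert (HL : 0 < L) by (apply Rdiv_lt_0_compat; lra).
assert (Hb : forall z l, Cmod (z - c) < r1 / 2 -> cderiv f z l -> Cmod l <= L).
{ intros z l Hz Hl. apply (deriv_bound f c r1 M z l); auto; try lra.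
  - apply (hol_disc_sub f c r); auto. rewrite Cmod_dist_refl; lra.
  - intros w Hw. specialize (Hc w ltac:(lra)). pose proof (Cmod_le_sub_add (f w) (f c)). unfold M. lra. }
set (s := Rmin (r1 / 4) (eps * r1 / (8 * L))).
assert (Hs : 0 < s) by (apply Rmin_pos; [lra | apply Rdiv_lt_0_compat; nra]).
assert (S1 : s <= r1 / 4) by apply Rmin_l. assert (S2 : s <= eps * r1 / (8 * L)) by apply Rmin_r.
exists s. split; [lra|]. intros z l Hz Hl.
assert (T : Cmod (l - l0) <= 4 * L * Cmod (z - c) / (r1 / 2)).
{ apply (deriv_lipschitz f c (r1 / 2) L (z - c) l0 l); auto; try lra.
  - apply (hol_disc_sub f c r); auto. rewrite Cmod_dist_refl; lra.
  - replace (c + (z - c))%C with z by ring. exact Hl. }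
apply Rle_trans with (1 := T).
apply Rle_trans with (4 * L * (eps * r1 / (8 * L)) / (r1 / 2)); [|apply Req_le; field; lra].
apply Rmult_le_compat_r; [apply Rlt_le, Rinv_0_lt_compat; lra|]. apply Rmult_le_compat_l; lra.
Qed.

Lemma disc_bound f c r : 0 <= r -> (forall z, Cmod (z - c) <= r -> ccont f z) ->
  exists M, forall z, Cmod (z - c) <= r -> Cmod (f z) <= M.
Proof.
intros Hr Hf. destruct (max_on_disc (fun z => Cmod (f z)) c r Hr) as [z [Hz1 Hz2]].
- intros z Hz eps He. destruct (ccont_Cmod f z (Hf z Hz) eps He) as [d [Hd H]].
  exists d. split; [exact Hd|]. intros w _ Hw. apply H, Hw.
- exists (Cmod (f z)). exact Hz2.
Qed.

Lemma entire_hol_disc f c r : entire_fun f -> hol_disc f c r.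
Proof. intros H z _. apply H. Qed.

Lemma entire_deriv_fun f : entire_fun f -> exists f', forall z, cderiv f z (f' z).
Proof. intros H. apply choice in H. exact H. Qed.

Lemma linear_remainder f z k l e : (forall t, 0 <= t <= 1 -> exists l', cderiv f (z + RtoC t * k)%C l' /\ Cmod (l' - l) <= e) ->
  Cmod (f (z + k)%C - f z - l * k) <= e * Cmod k.
Proof.
intros H.
assert (T := cderiv_mean_value (fun w => f w - l * w)%C z (z + k)%C e).
replace (f (z + k)%C - f z - l * k)%C with (f (z + k)%C - l * (z + k) - (f z - l * z))%C by ring.
replace (z + k - z)%C with k in T by ring. apply T. intros t Ht.
destruct (H t Ht) as [l' [H1 H2]]. exists (l' - l)%C. split; [|exact H2].
apply cderiv_minus; [exact H1|]. replace l with (l * 1)%C at 2 by ring. apply cderiv_scal, cderiv_id.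
Qed.

(* The difference quotients of f are uniformly close to f' near c, so by the Cauchy
   estimate their derivatives at c, the difference quotients of f', form a Cauchy net. *)
Lemma entire_second_deriv f f' : (forall z, cderiv f z (f' z)) -> entire_fun f'.
Proof.
intros Hf c.
assert (He : entire_fun f) by (intros z; eexists; apply Hf).
destruct (disc_bound f c 4 ltac:(lra) (fun z _ => entire_cont f z He)) as [M HM].
assert (M0 : 0 <= M) by (apply Rle_trans with (2 := HM c ltac:(rewrite Cmod_dist_refl; lra)); apply Cmod_ge_0).
assert (B1 : forall z, Cmod (z - c) < 2 -> Cmod (f' z) <= M).
{ intros z Hz. replace M with (4 * M / 4) by field. apply (deriv_bound f c 4 M z); auto; try lra.
  - apply entire_hol_disc, He. - intros w Hw. apply HM; lra. }
assert (B2 : forall z k, Cmod (z - c) < 1 -> Cmod k < 1 / 2 -> Cmod (f' (z + k)%C - f' z) <= 4 * M * Cmod k).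
{ intros z k Hz Hk. replace (4 * M * Cmod k) with (4 * M * Cmod k / 1) by field.
  apply (deriv_lipschitz f z 1 M k); auto; try lra.
  - apply entire_hol_disc, He.
  - intros w l Hw Hl. rewrite (cderiv_unique _ _ _ _ Hl (Hf w)). apply B1. pose proof (Cmod_dist_triangle w z c). lra. }
assert (B3 : forall z k, Cmod (z - c) < 1 -> Cmod k < 1 / 2 -> Cmod (f (z + k)%C - f z - f' z * k) <= 4 * M * Cmod k * Cmod k).
{ intros z k Hz Hk. apply linear_remainder. intros t Ht. eexists. split; [apply Hf|].
  assert (Ct : Cmod (RtoC t * k) <= Cmod k).
  { rewrite Cmod_mult, Cmod_R, Rabs_pos_eq by lra. pose proof (Cmod_ge_0 k). nra. }
  eapply Rle_trans; [apply B2; [exact Hz | lra]|]. apply Rmult_le_compat_l; lra. }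
set (Dq := fun k z => ((f (z + k) - f z) / k)%C).
assert (B4 : forall z k : C, k <> 0%C -> Cmod (z - c) < 1 -> Cmod k < 1 / 2 -> Cmod (Dq k z - f' z) <= 4 * M * Cmod k).
{ intros z k Hk0 Hz Hk. unfold Dq.
  replace ((f (z + k) - f z) / k - f' z)%C with ((f (z + k) - f z - f' z * k) / k)%C by (field; exact Hk0).
  rewrite Cmod_div by exact Hk0. specialize (B3 z k Hz Hk). apply Cmod_gt_0 in Hk0.
  apply Rmult_le_reg_r with (1 := Hk0). unfold Rdiv. rewrite Rmult_assoc, Rinv_l, Rmult_1_r by lra. exact B3. }
assert (DD : forall z k, cderiv (Dq k) z ((f' (z + k) - f' z) / k)%C).
{ intros z k. replace ((f' (z + k) - f' z) / k)%C with (/ k * (f' (z + k) * (1 + 0) - f' z))%C by (unfold Cdiv; ring).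
  apply (cderiv_ext (fun z => / k * (f (z + k) - f z))%C); [intros; unfold Dq, Cdiv; ring|].
  apply cderiv_scal, cderiv_minus; [|apply Hf].
  apply (cderiv_comp f (fun z => z + k)%C); [apply Hf|]. apply cderiv_plus; [apply cderiv_id | apply cderiv_const]. }
set (s := fun k => ((f' (c + k) - f' c) / k)%C).
assert (B5 : forall k j : C, k <> 0%C -> j <> 0%C -> Cmod k < 1 / 2 -> Cmod j < 1 / 2 -> Cmod (s k - s j) <= 8 * M * (Cmod k + Cmod j)).
{ intros k j Hk0 Hj0 Hk Hj.
  replace (8 * M * (Cmod k + Cmod j)) with (2 * (4 * M * Cmod k + 4 * M * Cmod j) / 1) by field.
  apply cauchy_estimate with (fun z => Dq k z - Dq j z)%C c; [lra | | | ].
  - intros z _. eexists. apply cderiv_minus; apply DD.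
  - intros z Hz. pose proof (B4 z k Hk0 Hz Hk). pose proof (B4 z j Hj0 Hz Hj).
    pose proof (Cmod_dist_triangle (Dq k z) (f' z) (Dq j z)) as T. rewrite (Cmod_dist_sym (f' z)) in T. lra.
  - apply cderiv_minus; apply DD. }
(* A particular null sequence below [1 / 2]: compactness turns the Cauchy property [B5] into an
   actual limit. *)
set (j := fun n : nat => RtoC (/ (INR n + 3))).
assert (Hj : forall n, 0 < / (INR n + 3) < 1 / 2).
{ intros n. pose proof (pos_INR n). split; [apply Rinv_0_lt_compat; lra|].
  replace (1 / 2) with (/ 2) by field. apply Rinv_lt_contravar; lra. }
assert (Hjm : forall n, Cmod (j n) = / (INR n + 3)) by (intros n; unfold j; rewrite Cmod_R; apply Rabs_pos_eq; specialize (Hj n); lra).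
assert (Hj0 : forall n, j n <> 0%C) by (intros n; apply Cmod_gt_0; rewrite Hjm; apply Hj).
destruct (bolzano_weierstrass_C (fun n => s (j n)) (s (j 0%nat)) (8 * M * 1)) as [l Hl].
{ intros n. eapply Rle_trans; [apply B5; auto; rewrite Hjm; apply Hj|].
  apply Rmult_le_compat_l; [lra|]. rewrite !Hjm. pose proof (Hj n). pose proof (Hj 0%nat). lra. }
assert (B6 : forall k : C, k <> 0%C -> Cmod k < 1 / 2 -> Cmod (s k - l) <= 8 * M * Cmod k).
{ intros k Hk0 Hk. apply le_epsilon. intros eps Heps.
  set (e := eps / (8 * M + 1)). assert (He' : 0 < e) by (apply Rdiv_lt_0_compat; lra).
  assert (Ee : e * (8 * M + 1) = eps) by (unfold e; field; lra).
  destruct (archimed_cor1 e He') as [K [HK HK0]].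
  destruct (Hl e He' K) as [n [Hn1 Hn2]].
  assert (Cmod (j n) <= e).
  { rewrite Hjm. apply Rle_trans with (/ INR K); [|lra]. assert (INR K <= INR n) by (apply le_INR; lia).
    apply Rinv_le_contravar; [apply lt_0_INR; lia | lra]. }
  pose proof (B5 k (j n) Hk0 (Hj0 n) Hk ltac:(rewrite Hjm; apply Hj)).
  pose proof (Cmod_dist_triangle (s k) (s (j n)) l).
  assert (8 * M * Cmod (j n) <= 8 * M * e) by (apply Rmult_le_compat_l; lra). lra. }
exists l. intros eps Heps.
set (d := Rmin (1 / 2) (eps / (8 * M + 1))).
assert (0 < eps / (8 * M + 1)) by (apply Rdiv_lt_0_compat; lra).
exists d. split; [apply Rmin_pos; lra|]. intros h Hh.
assert (h1 : Cmod h < 1 / 2) by (eapply Rlt_le_trans; [exact Hh | apply Rmin_l]).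
assert (h2 : Cmod h < eps / (8 * M + 1)) by (eapply Rlt_le_trans; [exact Hh | apply Rmin_r]).
destruct (Ceq_dec h 0) as [-> | Hh0].
- replace (f' (c + 0)%C - f' c - l * 0)%C with (RtoC 0) by (replace (c + 0)%C with c by ring; ring). rewrite Cmod_0. lra.
- specialize (B6 h Hh0 h1).
  replace (f' (c + h)%C - f' c - l * h)%C with ((s h - l) * h)%C by (unfold s; field; exact Hh0).
  rewrite Cmod_mult. apply Rmult_le_compat_r; [apply Cmod_ge_0|]. apply Rle_trans with (1 := B6).
  apply Rle_trans with (8 * M * (eps / (8 * M + 1))); [apply Rmult_le_compat_l; lra|].
  apply Rmult_le_reg_r with (8 * M + 1); [lra|].
  replace (8 * M * (eps / (8 * M + 1)) * (8 * M + 1)) with (8 * M * eps) by (field; lra). nra.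
Qed.

(** At [c] the quotient has derivative [l / 2], where [l] is the second derivative of [f]. This
    follows from the mean value inequality for [f w - f' c * w - l / 2 * (w - c) ^ 2], whose
    derivative is [o(w - c)]. *)
Lemma entire_divide f c : entire_fun f -> f c = 0%C ->
  exists q, entire_fun q /\ forall z, f z = ((z - c) * q z)%C.
Proof.
intros He H0. destruct (entire_deriv_fun f He) as [f' Hf].
destruct (entire_second_deriv f f' Hf c) as [l Hl].
set (q := fun z => if Ceq_dec z c then f' c else (f z / (z - c))%C).
assert (Hqc : q c = f' c) by (unfold q; destruct (Ceq_dec c c); congruence).
assert (Hq : forall z, z <> c -> q z = (f z / (z - c))%C) by (intros z Hz; unfold q; destruct (Ceq_dec z c); congruence).
assert (Hne : forall z, z <> c -> (z - c)%C <> 0%C) by (intros z Hz E; apply Hz, Ceq_minus, E).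
exists q. split.
- intros z. destruct (Ceq_dec z c) as [-> | Hz].
  + exists (l / 2)%C. intros eps Heps. destruct (Hl eps Heps) as [d [Hd H1]].
    exists d. split; [exact Hd|]. intros h Hh. destruct (Ceq_dec h 0) as [-> | Hh0].
    { replace (c + 0)%C with c by ring. replace (q c - q c - l / 2 * 0)%C with (RtoC 0) by ring. rewrite Cmod_0. lra. }
    assert (Hc : (c + h)%C <> c) by (intros E; apply Hh0; replace h with (c + h - c)%C by ring; rewrite E; ring).
    rewrite Hqc, Hq by exact Hc. replace (c + h - c)%C with h by ring.
    assert (T := cderiv_mean_value (fun w => f w - f' c * w - l / 2 * ((w - c) * (w - c)))%C c (c + h)%C (eps * Cmod h)).
    replace (c + h - c)%C with h in T by ring.
    assert (T' : Cmod (f (c + h)%C - f' c * h - l / 2 * (h * h)) <= eps * Cmod h * Cmod h).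
    { replace (f (c + h)%C - f' c * h - l / 2 * (h * h))%C with
        (f (c + h)%C - f' c * (c + h) - l / 2 * ((c + h - c) * (c + h - c)) - (f c - f' c * c - l / 2 * ((c - c) * (c - c))))%C by (rewrite H0; ring).
      apply T. intros t Ht. exists (f' (c + RtoC t * h) - f' c - l * (RtoC t * h))%C. split.
      - set (w := (c + RtoC t * h)%C).
        replace (l * (RtoC t * h))%C with (l / 2 * ((1 - 0) * (w - c) + (w - c) * (1 - 0)))%C by (unfold w; field; intros E; injection E; lra).
        apply cderiv_minus; [apply cderiv_minus; [apply Hf|]|].
        + replace (f' c) with (f' c * 1)%C at 2 by ring. apply cderiv_scal, cderiv_id.
        + apply cderiv_scal. apply (cderiv_mult (fun w => w - c)%C (fun w => w - c)%C); apply cderiv_minus; (apply cderiv_id || apply cderiv_const).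
      - assert (Ct : Cmod (RtoC t * h) <= Cmod h).
        { rewrite Cmod_mult, Cmod_R, Rabs_pos_eq by lra. pose proof (Cmod_ge_0 h). nra. }
        eapply Rle_trans; [apply H1; lra|]. apply Rmult_le_compat_l; lra. }
    replace (f (c + h)%C / h - f' c - l / 2 * h)%C with ((f (c + h)%C - f' c * h - l / 2 * (h * h)) / h)%C by (field; exact Hh0).
    rewrite Cmod_div by exact Hh0. apply Cmod_gt_0 in Hh0.
    apply Rmult_le_reg_r with (1 := Hh0). unfold Rdiv. rewrite Rmult_assoc, Rinv_l, Rmult_1_r by lra. exact T'.
  + eexists. apply (cderiv_ext_loc (fun z => f z * / (z - c))%C) with (Cmod (z - c)); [apply Cmod_gt_0, Hne, Hz | |].
    * intros w Hw. rewrite Hq; [reflexivity|]. intros ->. rewrite Cmod_dist_sym in Hw. lra.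
    * apply cderiv_mult; [apply Hf|]. apply cderiv_inv_comp; [|apply Hne, Hz].
      apply cderiv_minus; [apply cderiv_id | apply cderiv_const].
- intros z. destruct (Ceq_dec z c) as [-> | Hz].
  + rewrite H0. ring.
  + rewrite Hq by exact Hz. field. apply Hne, Hz.
Qed.

(** * Maximum principle, open mapping, Liouville *)

Lemma entire_comp f g : entire_fun f -> entire_fun g -> entire_fun (fun z => f (g z)).
Proof.
intros Hf Hg z. destruct (Hg z) as [b Hb]. destruct (Hf (g z)) as [a Ha].
eexists. apply (cderiv_comp f g z a b Ha Hb).
Qed.

(* A disc automorphism moves the centre of the disc to [z] and preserves the boundary circle. *)
Lemma max_principle_entire F c r M z : entire_fun F -> Cmod (z - c) < r ->
  (forall w, Cmod (w - c) = r -> Cmod (F w) <= M) -> Cmod (F z) <= M.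
Proof.
intros HF Hz HM. pose proof (Cmod_ge_0 (z - c)) as Hz0. assert (Hr : 0 < r) by lra.
assert (Hrn : RtoC r <> 0%C) by (intros E; apply RtoC_inj in E; lra).
set (a := ((z - c) / RtoC r)%C).
assert (Ha : Cmod a < 1).
{ unfold a. rewrite Cmod_div, Cmod_R, Rabs_pos_eq by (auto; lra).
  apply Rmult_lt_reg_r with r; [lra|]. unfold Rdiv. rewrite Rmult_assoc, Rinv_l by lra. lra. }
pose proof (Cmod_ge_0 a) as Ha0.
(* Chosen with [1 < rho] and [rho * Cmod a < 1], so that the automorphism has no pole in the disc of
   radius [rho], which contains the closed unit disc. *)
set (rho := 2 / (1 + Cmod a)).
assert (Erho : rho * (1 + Cmod a) = 2) by (unfold rho; field; lra).
assert (Hrho : 1 < rho) by nra.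
set (T := fun w => (c + RtoC r * ((w + a) * / (1 + Cconj a * w)))%C).
assert (Hden : forall w, Cmod w < rho -> (1 + Cconj a * w)%C <> 0%C).
{ intros w Hw. apply Cmod_gt_0. pose proof (Cmod_le_sub_add 1 (- (Cconj a * w))) as B.
  rewrite Cmod_1, Cmod_opp, Cmod_mult, Cmod_conj in B. replace (1 - - (Cconj a * w))%C with (1 + Cconj a * w)%C in B by ring.
  pose proof (Cmod_ge_0 w). assert (Cmod a * Cmod w < 1) by nra. lra. }
assert (HT : forall w, Cmod w < rho -> exists l, cderiv (fun w => F (T w)) w l).
{ intros w Hw. destruct (HF (T w)) as [l Hl]. eexists.
  eapply (cderiv_comp F T w l); [exact Hl|]. apply cderiv_plus; [apply cderiv_const|]. apply cderiv_scal.
  apply (cderiv_mult (fun w => w + a)%C (fun w => / (1 + Cconj a * w))%C).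
  - apply cderiv_plus; [apply cderiv_id | apply cderiv_const].
  - apply (cderiv_inv_comp (fun w => 1 + Cconj a * w)%C); [|apply Hden, Hw].
    apply cderiv_plus; [apply cderiv_const | apply cderiv_scal, cderiv_id]. }
assert (E0 : T 0%C = z).
{ unfold T, a. replace (1 + Cconj ((z - c) / r) * 0)%C with (RtoC 1) by ring.
  field. exact Hrn. }
rewrite <- E0. destruct (HT 0%C) as [l0 Hl0]; [rewrite Cmod_0; lra|].
apply (circle_mean_bound (fun w => F (T w)) 0 rho 1 M); [lra | | apply (cderiv_cont _ _ _ Hl0) |].
- intros w [_ Hw]. apply HT. replace (w - 0)%C with w in Hw by ring. exact Hw.
- intros w Hw. replace (w - 0)%C with w in Hw by ring. apply HM. unfold T.
  assert (Hd := Hden w ltac:(lra)).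
  replace (c + RtoC r * ((w + a) * / (1 + Cconj a * w)) - c)%C with (RtoC r * ((w + a) / (1 + Cconj a * w)))%C by (field; exact Hd).
  rewrite Cmod_mult, Cmod_R, Rabs_pos_eq, Cmod_div by (auto; lra).
  assert (Ew : (1 + Cconj a * w)%C = (w * Cconj (w + a))%C).
  { replace (w * Cconj (w + a))%C with (w * Cconj w + Cconj a * w)%C by (apply C_ext; unfold Re, Im; simpl; ring).
    f_equal. rewrite <- Cmod2_conj, Hw. apply C_ext; simpl; ring. }
  assert (En : Cmod (1 + Cconj a * w) = Cmod (w + a)) by (rewrite Ew, Cmod_mult, Cmod_conj, Hw; ring).
  rewrite En. apply Cmod_gt_0 in Hd. rewrite En in Hd. field. lra.
Qed.

Lemma entire_minus_const f a : entire_fun f -> entire_fun (fun z => f z - a)%C.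
Proof. intros Hf z. destruct (Hf z) as [l Hl]. eexists. apply cderiv_minus; [exact Hl | apply cderiv_const]. Qed.

(** If zeros accumulate at [c], each quotient by a power of [z - c] vanishes at [c] again, so [f] is
    divisible by all powers. The maximum principle for the quotients on a circle of radius
    [r > 2 * Cmod (z0 - c)] gives [Cmod (f z0) <= M / 2 ^ p] for every [p]. *)
Lemma isolated_zeros f c : entire_fun f -> (exists z, f z <> 0%C) ->
  exists r, 0 < r /\ forall z, 0 < Cmod (z - c) < r -> f z <> 0%C.
Proof.
intros Hf [z0 Hz0]. apply NNPP. intros Hn. apply Hz0.
assert (Hacc : forall r, 0 < r -> exists z, 0 < Cmod (z - c) < r /\ f z = 0%C).
{ intros r Hr. apply NNPP. intros H. apply Hn. exists r. split; [exact Hr|]. intros z Hz E. apply H. exists z. auto. }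
assert (Hdiv : forall p, exists q, entire_fun q /\ forall z, f z = (Cpow (z - c) p * q z)%C).
{ induction p as [|p [q [Hq Eq]]].
  - exists f. split; [exact Hf|]. intros z. simpl. ring.
  - assert (Hqc : q c = 0%C).
    { apply NNPP. intros Hne. apply Cmod_gt_0 in Hne.
      destruct (entire_cont q c Hq (Cmod (q c)) Hne) as [d [Hd H]].
      destruct (Hacc d Hd) as [z [Hz1 Hz2]]. specialize (H z ltac:(lra)).
      rewrite Eq in Hz2.
      assert (Hzc : (z - c)%C <> 0%C) by (apply Cmod_gt_0; lra).
      assert (Eqz : q z = 0%C).
      { apply NNPP. intros Hnz. apply (Cmult_neq_0 _ _ (Cpow_nz (z - c) p Hzc) Hnz). exact Hz2. }
      rewrite Eqz in H. replace (0 - q c)%C with (- q c)%C in H by ring. rewrite Cmod_opp in H. lra. }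
    destruct (entire_divide q c Hq Hqc) as [q' [Hq' Eq']]. exists q'. split; [exact Hq'|].
    intros z. rewrite Eq, Eq'. simpl. ring. }
set (r := 2 * Cmod (z0 - c) + 1). pose proof (Cmod_ge_0 (z0 - c)) as P0.
destruct (disc_bound f c r ltac:(unfold r; lra) (fun z _ => entire_cont f z Hf)) as [M HM].
assert (M0 : 0 <= M) by (apply Rle_trans with (2 := HM c ltac:(rewrite Cmod_dist_refl; unfold r; lra)); apply Cmod_ge_0).
assert (Hp : forall p, Cmod (f z0) * 2 ^ p <= M).
{ intros p. destruct (Hdiv p) as [q [Hq Eq]].
  assert (Hrp : 0 < r ^ p) by (apply pow_lt; unfold r; lra).
  assert (Hqz : Cmod (q z0) <= M / r ^ p).
  { apply max_principle_entire with c r; auto; [unfold r; lra|]. intros w Hw.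
    specialize (HM w ltac:(lra)). rewrite Eq, Cmod_mult, Cmod_pow, Hw in HM.
    apply Rmult_le_reg_l with (1 := Hrp). replace (r ^ p * (M / r ^ p)) with M by (field; lra). exact HM. }
  rewrite Eq, Cmod_mult, Cmod_pow.
  assert (Hpow : Cmod (z0 - c) ^ p * 2 ^ p <= r ^ p).
  { rewrite <- Rpow_mult_distr. apply pow_incr. unfold r. lra. }
  assert (0 <= Cmod (z0 - c) ^ p * 2 ^ p) by (apply Rmult_le_pos; apply pow_le; lra).
  replace (Cmod (z0 - c) ^ p * Cmod (q z0) * 2 ^ p) with ((Cmod (z0 - c) ^ p * 2 ^ p) * Cmod (q z0)) by ring.
  apply Rle_trans with (r ^ p * (M / r ^ p)); [|apply Req_le; field; lra].
  apply Rmult_le_compat; auto. apply Cmod_ge_0. }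
apply NNPP. intros Hne. apply Cmod_gt_0 in Hne.
destruct (pow_2_unbounded (M / Cmod (f z0))) as [n Hn2]. specialize (Hp n).
assert (M / Cmod (f z0) * Cmod (f z0) < 2 ^ n * Cmod (f z0)) by (apply Rmult_lt_compat_r; lra).
replace (M / Cmod (f z0) * Cmod (f z0)) with M in H by (field; lra). lra.
Qed.

(** If [w] were omitted, [/ (F z - w)] would be larger than [2 / m] at the centre and at most
    [2 / m] on the circle. *)
Lemma cover_from_circle F a r s m w : 0 < s < r -> hol_disc F a r ->
  (forall z, Cmod (z - a) = s -> m <= Cmod (F z - F a)) -> Cmod (w - F a) < m / 2 ->
  exists z, Cmod (z - a) < r /\ F z = w.
Proof.
intros Hs HF Hm Hw. apply NNPP. intros Hn.
assert (Hne : forall z, Cmod (z - a) < r -> (F z - w)%C <> 0%C).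
{ intros z Hz E. apply Hn. exists z. split; [exact Hz | apply Ceq_minus, E]. }
assert (Hm0 : 0 < m) by (pose proof (Cmod_ge_0 (w - F a)); lra).
assert (Ha := Hne a ltac:(rewrite Cmod_dist_refl; lra)).
assert (Hd : forall z, Cmod (z - a) < r -> exists l, cderiv (fun z => / (F z - w))%C z l).
{ intros z Hz. destruct (HF z Hz) as [l Hl]. eexists. apply (cderiv_inv_comp (fun z => F z - w)%C); [|apply Hne, Hz].
  apply cderiv_minus; [exact Hl | apply cderiv_const]. }
assert (B : Cmod (/ (F a - w)) <= 2 / m).
{ apply (circle_mean_bound (fun z => / (F z - w))%C a r s); auto.
  - intros z Hz. apply Hd; lra.
  - destruct (Hd a) as [l Hl]; [rewrite Cmod_dist_refl; lra|]. apply (cderiv_cont _ _ _ Hl).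
  - intros z Hz. assert (Hz' := Hne z ltac:(lra)). rewrite Cmod_inv by exact Hz'.
    specialize (Hm z Hz). pose proof (Cmod_dist_triangle (F z) w (F a)).
    replace (2 / m) with (/ (m / 2)) by (field; lra). apply Rinv_le_contravar; lra. }
rewrite Cmod_inv in B by exact Ha. apply Cmod_gt_0 in Ha. rewrite (Cmod_dist_sym w) in Hw.
assert (/ (m / 2) < / Cmod (F a - w)) by (apply Rinv_lt_contravar; [apply Rmult_lt_0_compat|]; lra).
replace (/ (m / 2)) with (2 / m) in H by (field; lra). lra.
Qed.

Lemma min_on_circle F c s : 0 < s -> (forall z, ccont F z) -> (forall z, Cmod (z - c) = s -> F z <> 0%C) ->
  exists m, 0 < m /\ forall z, Cmod (z - c) = s -> m <= Cmod (F z).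
Proof.
intros Hs HF Hne. apply NNPP. intros Hn.
assert (Hseq : forall n : nat, exists z, Cmod (z - c) = s /\ Cmod (F z) < / (INR n + 1)).
{ intros n. apply NNPP. intros H. apply Hn. exists (/ (INR n + 1)). split.
  - apply Rinv_0_lt_compat. pose proof (pos_INR n). lra.
  - intros z Hz. apply Rnot_lt_le. intros Hl. apply H. exists z. auto. }
apply choice in Hseq. destruct Hseq as [u Hu].
destruct (bolzano_weierstrass_C u c s) as [l Hl]; [intros n; rewrite (proj1 (Hu n)); lra|].
assert (Hlc : Cmod (l - c) = s).
{ apply Rle_antisym; apply le_epsilon; intros eps He; destruct (Hl eps He 0%nat) as [n [_ Hn2]];
  pose proof (proj1 (Hu n)) as E.
  - pose proof (Cmod_dist_triangle l (u n) c). rewrite (Cmod_dist_sym l (u n)) in H. lra.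
  - pose proof (Cmod_dist_triangle (u n) l c). lra. }
assert (P := proj1 (Cmod_gt_0 _) (Hne l Hlc)).
destruct (HF l (Cmod (F l) / 2) ltac:(lra)) as [d [Hd H1]].
destruct (archimed_cor1 (Cmod (F l) / 2) ltac:(lra)) as [K [HK HK0]].
destruct (Hl d Hd K) as [n [Hn1 Hn2]]. specialize (H1 _ Hn2). destruct (Hu n) as [_ Hu2].
assert (INR K <= INR n) by (apply le_INR; lia). assert (0 < INR K) by (apply lt_0_INR; lia).
assert (/ (INR n + 1) <= / INR K) by (apply Rinv_le_contravar; lra).
pose proof (Cmod_le_add_sub (F (u n)) (F l)). lra.
Qed.

Lemma open_mapping f c eps : entire_fun f -> (exists a b, f a <> f b) -> 0 < eps ->
  exists delta, 0 < delta /\ forall w, Cmod (w - f c) < delta -> exists z, Cmod (z - c) < eps /\ f z = w.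
Proof.
intros Hf [a [b Hab]] He.
assert (Hg := entire_minus_const f (f c) Hf).
destruct (isolated_zeros _ c Hg) as [r [Hr H]].
{ destruct (classic (f a = f c)) as [E | E].
  - exists b. intros E'. apply Hab. rewrite E. symmetry. apply Ceq_minus, E'.
  - exists a. intros E'. apply E, Ceq_minus, E'. }
set (s := Rmin r eps / 2). assert (0 < Rmin r eps) by (apply Rmin_pos; lra).
pose proof (Rmin_l r eps). pose proof (Rmin_r r eps).
destruct (min_on_circle (fun z => f z - f c)%C c s) as [m [Hm1 Hm2]].
- unfold s; lra.
- intros z. apply entire_cont, Hg.
- intros z Hz. apply H. unfold s in Hz. lra.
- exists (m / 2). split; [lra|]. intros w Hw.
  apply (cover_from_circle f c eps s m w); auto; [unfold s; lra | apply entire_hol_disc, Hf].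
Qed.

(** [F] differs from its linear part by at most half of it, which gives the lower bound on
    distances. The radius of the covered disc comes from the circle of radius [r / 2]: there [F z]
    is at distance at least [Cmod lam * r / 4] from [F a], and [cover_from_circle] halves this. *)
Lemma cover_from_derivative F a r lam : 0 < r -> hol_disc F a r ->
  (forall z l, Cmod (z - a) < r -> cderiv F z l -> Cmod (l - lam) <= Cmod lam / 2) ->
  (forall z w, Cmod (z - a) < r -> Cmod (w - a) < r -> Cmod lam / 2 * Cmod (z - w) <= Cmod (F z - F w)) /\
  (forall w, Cmod (w - F a) < Cmod lam * r / 8 -> exists z, Cmod (z - a) < r /\ F z = w).
Proof.
intros Hr HF Hl.
assert (Hinj : forall z w, Cmod (z - a) < r -> Cmod (w - a) < r -> Cmod lam / 2 * Cmod (z - w) <= Cmod (F z - F w)).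
{ intros z w Hz Hw.
  assert (T : Cmod (F z - F w - lam * (z - w)) <= Cmod lam / 2 * Cmod (z - w)).
  { replace (F z) with (F (w + (z - w))%C) by (f_equal; ring). apply linear_remainder. intros t Ht.
    assert (S := segment_in_disc w z a r t Hw Hz Ht). destruct (HF _ S) as [l Hd]. exists l. split; [exact Hd | apply (Hl _ _ S Hd)]. }
  pose proof (Cmod_le_add_sub (F z - F w) (lam * (z - w))). rewrite Cmod_mult in H. lra. }
split; [exact Hinj|]. intros w Hw.
apply (cover_from_circle F a r (r / 2) (Cmod lam * r / 4) w); auto; [lra | | lra].
intros z Hz. specialize (Hinj z a ltac:(lra) ltac:(rewrite Cmod_dist_refl; lra)). rewrite Hz in Hinj. lra.
Qed.

(** The covering statement is kept for every smaller radius [s'], so that preimages can be confined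
    to a prescribed neighbourhood. *)
Lemma local_inverse F a r lam : 0 < r -> hol_disc F a r -> cderiv F a lam -> lam <> 0%C ->
  exists s, 0 < s <= r /\
  (forall z w, Cmod (z - a) < s -> Cmod (w - a) < s -> Cmod lam / 2 * Cmod (z - w) <= Cmod (F z - F w)) /\
  (forall s', 0 < s' <= s -> forall w, Cmod (w - F a) < Cmod lam * s' / 8 -> exists z, Cmod (z - a) < s' /\ F z = w).
Proof.
intros Hr HF Hd Hn. apply Cmod_gt_0 in Hn.
destruct (deriv_close F a r lam (Cmod lam / 2) Hr HF Hd ltac:(lra)) as [s [Hs H]].
exists s. split; [exact Hs|].
assert (Hsub : forall s', 0 < s' <= s -> hol_disc F a s').
{ intros s' Hs'. apply (hol_disc_sub F a r); [exact HF | rewrite Cmod_dist_refl; lra]. }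
split.
- apply (cover_from_derivative F a s lam); [lra | apply Hsub; lra | exact H].
- intros s' Hs'. apply (cover_from_derivative F a s' lam); [lra | apply Hsub; lra |].
  intros z l Hz. apply H. lra.
Qed.

Lemma entire_deriv_zero_const f : entire_fun f -> (forall z l, cderiv f z l -> l = 0%C) -> forall z, f z = f 0%C.
Proof.
intros Hf H z. apply Cmod_sub_eq_0. apply Rle_antisym; [|apply Cmod_ge_0].
apply Rle_trans with (0 * Cmod (z - 0)); [|lra]. apply cderiv_mean_value. intros t _.
destruct (Hf (0 + RtoC t * (z - 0))%C) as [l Hl]. exists l. split; [exact Hl|]. rewrite (H _ _ Hl), Cmod_0. lra.
Qed.

Lemma poly_eval_cons a l (z : C) : Defs.poly_eval (a :: l) z = (a + z * Defs.poly_eval l z)%C.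
Proof.
unfold Defs.poly_eval.
(* The offset [k] of the exponents is needed because removing the head shifts the start of [seq]. *)
set (P := fun k l => fold_right Defs.Cadd Defs.C0 (map (fun p => Defs.Cmul (fst p) (Defs.Cpow z (snd p))) (combine l (seq k (length l)))) : C).
assert (H : forall l k, @eq C (P (S k) l) (z * P k l)%C).
{ clear. induction l as [|a l IH]; intros k.
  - unfold P; simpl. change (@eq C (RtoC 0) (z * RtoC 0)%C). ring.
  - change (P (S k) (a :: l)) with (a * (z * Defs.Cpow z k) + P (S (S k)) l)%C.
    change (P k (a :: l)) with (a * Defs.Cpow z k + P (S k) l)%C.
    rewrite IH. set (x := Defs.Cpow z k : C). set (y := P (S k) l : C).
    change (@eq C (a * (z * x) + z * y)%C (z * (a * x + y))%C). ring. }
change (@eq C (a * RtoC 1 + P 1%nat l)%C (a + z * P 0%nat l)%C). rewrite H.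
change (@eq C ((a : C) * RtoC 1 + z * P 0%nat l)%C ((a : C) + z * P 0%nat l)%C). ring.
Qed.

(** Growth is required only on arbitrarily large circles, since denying [fast_growing] provides no
    more. Passing from [f] to [(f - f 0) / z] lowers the exponent by one, and [1 <= r] lets [K]
    absorb the constant [f 0]. *)
Lemma liouville_polynomial N : forall f K, entire_fun f ->
  (forall r0, exists r, r0 <= r /\ 1 <= r /\ forall z, Cmod z = r -> Cmod (f z) <= K * r ^ N) ->
  Defs.is_polynomial f.
Proof.
induction N as [|N IH]; intros f K Hf H.
- assert (HB : forall z, Cmod (f z) <= K).
  { intros z. destruct (H (Cmod z + 1)) as [r [Hr1 [Hr2 Hr3]]].
    apply max_principle_entire with (RtoC 0) r; auto.
    - replace (z - 0)%C with z by ring. lra.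
    - intros w Hw. replace (w - 0)%C with w in Hw by ring. specialize (Hr3 w Hw). simpl in Hr3. lra. }
  exists (f 0%C :: nil). intros z.
  assert (E0 : @eq C (Defs.poly_eval (f 0%C :: nil) z) (f 0%C)).
  { rewrite poly_eval_cons. change (@eq C (f 0%C + z * RtoC 0)%C (f 0%C)). ring. }
  rewrite E0. clear E0. revert z. apply (entire_deriv_zero_const f); auto. intros z l Hl.
  apply Cmod_eq_0. apply Rle_antisym; [|apply Cmod_ge_0]. apply Rnot_lt_le. intros Hp.
  assert (K0 : 0 <= K) by (apply Rle_trans with (2 := HB z); apply Cmod_ge_0).
  set (r := 2 * (K + 1) / Cmod l * 2). assert (Hr : 0 < r) by (apply Rmult_lt_0_compat; [apply Rdiv_lt_0_compat|]; lra).
  assert (T := cauchy_estimate f z l r K Hr (fun w _ => Hf w) (fun w _ => HB w) Hl).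
  assert (E : r * Cmod l = 4 * (K + 1)) by (unfold r; field; lra).
  assert (Cmod l * r <= 2 * K / r * r) by (apply Rmult_le_compat_r; lra).
  replace (2 * K / r * r) with (2 * K) in H0 by (field; lra). lra.
- assert (E0 : (f 0%C - f 0%C)%C = 0%C) by ring.
  destruct (entire_divide _ 0%C (entire_minus_const f (f 0%C) Hf) E0) as [q [Hq Eq]].
  assert (Eq' : forall z, f z = (f 0%C + z * q z)%C).
  { intros z. specialize (Eq z). replace (f z) with ((f z - f 0%C) + f 0%C)%C by ring. rewrite Eq. ring. }
  destruct (IH q (K + Cmod (f 0%C)) Hq) as [l Hl].
  + intros r0. destruct (H r0) as [r [Hr1 [Hr2 Hr3]]]. exists r. split; [exact Hr1|]. split; [exact Hr2|].
    intros z Hz. specialize (Hr3 z Hz).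
    pose proof (Cmod_sub_le (f z) (f 0%C)) as T. rewrite Eq in T.
    replace (z - 0)%C with z in T by ring. rewrite Cmod_mult, Hz in T.
    assert (HP : 1 <= r ^ N) by (apply pow_R1_Rle; lra).
    apply Rmult_le_reg_l with r; [lra|].
    pose proof (Cmod_ge_0 (f 0%C)). simpl in Hr3.
    apply Rle_trans with (K * (r * r ^ N) + Cmod (f 0%C) * 1); [lra|].
    assert (Cmod (f 0%C) * 1 <= Cmod (f 0%C) * (r * r ^ N)) by (apply Rmult_le_compat_l; nra). lra.
  + exists (f 0%C :: l). intros z. rewrite poly_eval_cons, <- Hl. apply Eq'.
Qed.

(** * Lifting the exponential through [h o exp] *)

(** The continuity method on [[0,1]], used for uniqueness of lifts, for their continuation and for
    lifting a segment through [psi]. *)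
Lemma interval_induction (P : R -> Prop) :
  P 0 ->
  (forall t, 0 <= t < 1 -> P t -> exists e, 0 < e /\ forall u, t < u < t + e -> u <= 1 -> P u) ->
  (forall t, 0 < t <= 1 -> (forall u, 0 <= u < t -> P u) -> P t) ->
  forall t, 0 <= t <= 1 -> P t.
Proof.
intros H0 Hopen Hlim t Ht. apply NNPP. intros Hn.
(* Negation turns the infimum of the failures into the supremum supplied by [completeness]. *)
set (E := fun x => exists y, x = - y /\ 0 <= y <= 1 /\ ~ P y).
destruct (completeness E) as [S [HS1 HS2]].
- exists 0. intros x [y [-> [Hy _]]]. lra.
- exists (- t), t. auto.
- set (T := - S).
  assert (HT0 : 0 <= T <= 1).
  { split.
    - assert (S <= 0); [|unfold T; lra]. apply HS2. intros x [y [-> [Hy _]]]. lra.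
    - assert (- t <= S) by (apply HS1; exists t; auto). unfold T. lra. }
  assert (Hbelow : forall u, 0 <= u < T -> P u).
  { intros u Hu. apply NNPP. intros Hnu. assert (- u <= S) by (apply HS1; exists u; repeat split; auto; lra). unfold T in Hu. lra. }
  assert (PT : P T) by (destruct (Req_dec T 0) as [-> | HT]; [exact H0 | apply Hlim; [lra | exact Hbelow]]).
  destruct (Req_dec T 1) as [E1 | E1].
  + assert (- t <= S) by (apply HS1; exists t; auto). unfold T in *.
    destruct (Req_dec t 1) as [-> | Ht1]; [apply Hn; rewrite <- E1; exact PT | lra].
  + destruct (Hopen T ltac:(lra) PT) as [e [He H]].
    assert (S <= - (T + e)); [|unfold T in *; lra]. apply HS2. intros x [y [-> [Hy Hny]]].
    apply Ropp_le_contravar. apply Rnot_lt_le. intros Hlt. apply Hny.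
    destruct (Rlt_dec y T); [apply Hbelow; lra|]. destruct (Req_dec y T) as [-> | ]; [exact PT|].
    apply H; lra.
Qed.

(* [exp L] bounds the singular values of [h] and the modulus of [h 0]. *)
Definition no_singular_beyond (h : C -> C) (L : R) : Prop :=
  entire_fun h /\ Cmod (h 0%C) < exp L /\
  (forall z, exp L < Cmod (h z) -> ~ cderiv h z 0%C) /\
  (forall a (T : R) (z : R -> C), exp L < Cmod a -> 0 < T ->
     (forall t, 0 <= t < T -> forall eps, 0 < eps -> exists delta, 0 < delta /\
        forall s, 0 <= s < T -> Rabs (s - t) < delta -> Cmod (z s - z t) < eps) ->
     (forall M, exists t0, 0 <= t0 < T /\ forall t, t0 <= t < T -> M < Cmod (z t)) ->
     (forall eps, 0 < eps -> exists t0, 0 <= t0 < T /\ forall t, t0 <= t < T -> Cmod (h (z t) - a) < eps) ->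
     False).

(** A continuous lift of [exp] through [h o exp]. Continuity at a point of [A] is meant in the whole
    plane, so the sets [A] in use are open. *)
Definition branch (h : C -> C) (A : C -> Prop) (s : C -> C) : Prop :=
  forall zt, A zt -> ccont s zt /\ h (Cexp (s zt)) = Cexp zt.

Lemma branch_sub h (A B : C -> Prop) s : branch h A s -> (forall z, B z -> A z) -> branch h B s.
Proof. intros H HB z Hz. apply H, HB, Hz. Qed.

Lemma comp_exp_entire h : entire_fun h -> entire_fun (fun z => h (Cexp z)).
Proof. intros H. apply (entire_comp h Cexp H). intros z. eexists. apply cderiv_Cexp. Qed.

Lemma comp_exp_deriv_neq_0 h L et zt : no_singular_beyond h L -> L < Re zt -> h (Cexp et) = Cexp zt ->
  exists lam : C, lam <> 0%C /\ cderiv (fun z => h (Cexp z)) et lam.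
Proof.
intros [Hh [_ [Hc _]]] HL E. destruct (Hh (Cexp et)) as [l Hl].
exists (l * Cexp et)%C. split.
- apply Cmult_neq_0; [|apply Cexp_neq_0]. intros ->. apply (Hc (Cexp et)); [|exact Hl].
  rewrite E, Cmod_Cexp. apply exp_increasing, HL.
- apply (cderiv_comp h Cexp); [exact Hl | apply cderiv_Cexp].
Qed.

(** The last clause, local uniqueness of the solution near [et], is what identifies other lifts with
    [s]. *)
Lemma local_branch h L zt et : no_singular_beyond h L -> L < Re zt -> h (Cexp et) = Cexp zt ->
  exists eps delta s, 0 < eps /\ 0 < delta /\ branch h (fun z => Cmod (z - zt) < eps) s /\ s zt = et /\
   (forall z, Cmod (z - zt) < eps -> L < Re z) /\
   (forall z e, Cmod (z - zt) < eps -> Cmod (e - et) < delta -> h (Cexp e) = Cexp z -> e = s z).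
Proof.
intros Hg HL E. destruct (comp_exp_deriv_neq_0 h L et zt Hg HL E) as [lam [Hlam Hd]].
set (G := fun z => h (Cexp z)) in *.
assert (HG : entire_fun G) by apply comp_exp_entire, Hg.
destruct (local_inverse G et 1 lam ltac:(lra) (entire_hol_disc G et 1 HG) Hd Hlam) as [r [Hr [Hinj Hcov]]].
assert (Hl0 := proj1 (Cmod_gt_0 lam) Hlam).
destruct (cderiv_cont _ _ _ (cderiv_Cexp zt) (Cmod lam * r / 8)) as [d [Hd1 Hd2]]; [nra|].
set (eps := Rmin d (Re zt - L)).
assert (He : 0 < eps) by (apply Rmin_pos; lra).
assert (Hed : eps <= d) by apply Rmin_l. assert (HeL : eps <= Re zt - L) by apply Rmin_r.
assert (Hch : forall z, exists e, Cmod (z - zt) < eps -> Cmod (e - et) < r /\ G e = Cexp z).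
{ intros z. destruct (classic (Cmod (z - zt) < eps)) as [Hz | Hz]; [|exists 0%C; tauto].
  destruct (Hcov r ltac:(lra) (Cexp z)) as [e He'].
  - replace (G et) with (Cexp zt) by (symmetry; exact E). apply Hd2. lra.
  - exists e. auto. }
apply choice in Hch. destruct Hch as [s Hs].
assert (Huniq : forall z e, Cmod (z - zt) < eps -> Cmod (e - et) < r -> h (Cexp e) = Cexp z -> e = s z).
{ intros z e Hz He' Ee. destruct (Hs z Hz) as [S1 S2]. specialize (Hinj e (s z) He' S1).
  assert (G e - G (s z) = 0)%C as E0 by (rewrite S2; unfold G; rewrite Ee; ring). rewrite E0, Cmod_0 in Hinj.
  apply Cmod_sub_eq_0. pose proof (Cmod_ge_0 (e - s z)). nra. }
exists eps, r, s. split; [exact He|]. split; [lra|]. split; [|split; [|split]].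
- intros z Hz. split; [|apply (Hs z Hz)]. intros e0 He0.
  destruct (cderiv_cont _ _ _ (cderiv_Cexp z) (Cmod lam / 2 * e0)) as [d' [Hd' H']]; [nra|].
  exists (Rmin d' (eps - Cmod (z - zt))). split; [apply Rmin_pos; lra|]. intros w Hw.
  assert (W1 : Cmod (w - z) < d') by (eapply Rlt_le_trans; [exact Hw | apply Rmin_l]).
  assert (W2 : Cmod (w - z) < eps - Cmod (z - zt)) by (eapply Rlt_le_trans; [exact Hw | apply Rmin_r]).
  assert (Hwz : Cmod (w - zt) < eps) by (pose proof (Cmod_dist_triangle w z zt); lra).
  destruct (Hs z Hz) as [A1 A2]. destruct (Hs w Hwz) as [B1 B2].
  specialize (Hinj (s w) (s z) B1 A1). rewrite A2, B2 in Hinj. specialize (H' w W1).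
  apply Rmult_lt_reg_l with (Cmod lam / 2); lra.
- symmetry. apply Huniq; [rewrite Cmod_dist_refl; lra | rewrite Cmod_dist_refl; lra | exact E].
- intros z Hz. pose proof (re_le_Cmod (z - zt)) as T. rewrite Re_minus in T. apply Rabs_le_between in T. lra.
- exact Huniq.
Qed.

Lemma Cmod_segment_dist a v t u : Cmod (a + RtoC t * v - (a + RtoC u * v)) = Rabs (t - u) * Cmod v.
Proof.
replace (a + RtoC t * v - (a + RtoC u * v))%C with (RtoC (t - u) * v)%C by (rewrite RtoC_minus; ring).
rewrite Cmod_mult, Cmod_R. reflexivity.
Qed.

Lemma segment_close (a v : C) t d : 0 < d -> exists e, 0 < e /\ forall u, Rabs (u - t) < e -> Cmod (a + RtoC u * v - (a + RtoC t * v)) < d.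
Proof.
intros Hd. pose proof (Cmod_ge_0 v). exists (d / (Cmod v + 1)). split; [apply Rdiv_lt_0_compat; lra|].
intros u Hu. rewrite Cmod_segment_dist.
apply Rle_lt_trans with (Rabs (u - t) * (Cmod v + 1)); [apply Rmult_le_compat_l; [apply Rabs_pos | lra]|].
replace d with (d / (Cmod v + 1) * (Cmod v + 1)) by (field; lra). apply Rmult_lt_compat_r; lra.
Qed.

(** Along the segment the set of agreement is open by the uniqueness clause of [local_branch] and
    closed by continuity. [A] may be any set containing the segment, hence intersections of tubes
    and discs. *)
Lemma branch_unique h L A s1 s2 a b : no_singular_beyond h L -> branch h A s1 -> branch h A s2 ->
  (forall z, A z -> L < Re z) ->
  (forall t, 0 <= t <= 1 -> A (a + RtoC t * (b - a))%C) -> s1 a = s2 a -> s1 b = s2 b.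
Proof.
intros Hg H1 H2 HL Hseg E.
assert (T : forall t, 0 <= t <= 1 -> s1 (a + RtoC t * (b - a))%C = s2 (a + RtoC t * (b - a))%C).
{ apply interval_induction.
  - replace (a + RtoC 0 * (b - a))%C with a by ring. exact E.
  - intros t Ht Et. set (z := (a + RtoC t * (b - a))%C) in *.
    assert (Hz : A z) by (apply Hseg; lra).
    destruct (H1 z Hz) as [C1 G1]. destruct (H2 z Hz) as [C2 G2].
    destruct (local_branch h L z (s1 z) Hg (HL z Hz) G1) as [eps [delta [s [He [Hd [Hb [Hsz [_ Hu]]]]]]]].
    destruct (C1 delta Hd) as [d1 [Hd1 K1]]. destruct (C2 delta Hd) as [d2 [Hd2 K2]].
    destruct (segment_close a (b - a)%C t (Rmin eps (Rmin d1 d2))) as [e [He' K]]; [repeat apply Rmin_pos; lra|].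
    exists e. split; [exact He'|]. intros u Hu1 Hu2. specialize (K u ltac:(apply Rabs_def1; lra)). fold z in K.
    set (w := (a + RtoC u * (b - a))%C) in *.
    assert (W0 : Cmod (w - z) < eps) by (eapply Rlt_le_trans; [exact K | apply Rmin_l]).
    assert (W1 : Cmod (w - z) < d1) by (eapply Rlt_le_trans; [exact K | eapply Rle_trans; [apply Rmin_r | apply Rmin_l]]).
    assert (W2 : Cmod (w - z) < d2) by (eapply Rlt_le_trans; [exact K | eapply Rle_trans; [apply Rmin_r | apply Rmin_r]]).
    assert (Hw : A w) by (apply Hseg; lra).
    rewrite (Hu w (s1 w) W0 (K1 w W1) (proj2 (H1 w Hw))).
    symmetry. apply (Hu w (s2 w) W0); [rewrite Et; apply (K2 w W2) | apply (H2 w Hw)].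
  - intros t Ht Hb. set (z := (a + RtoC t * (b - a))%C) in *.
    apply Cmod_sub_eq_0. apply Rle_antisym; [|apply Cmod_ge_0]. apply Rnot_lt_le. intros Hp.
    assert (Hz : A z) by (apply Hseg; lra).
    destruct (H1 z Hz) as [C1 _]. destruct (H2 z Hz) as [C2 _].
    destruct (C1 (Cmod (s1 z - s2 z) / 2)) as [d1 [Hd1 K1]]; [lra|]. destruct (C2 (Cmod (s1 z - s2 z) / 2)) as [d2 [Hd2 K2]]; [lra|].
    destruct (segment_close a (b - a)%C t (Rmin d1 d2)) as [e [He' K]]; [repeat apply Rmin_pos; lra|].
    set (u := Rmax 0 (t - e / 2)).
    assert (Hu : 0 <= u < t /\ Rabs (u - t) < e).
    { unfold u. pose proof (Rmax_l 0 (t - e / 2)). pose proof (Rmax_r 0 (t - e / 2)).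
      assert (Rmax 0 (t - e / 2) < t) by (apply Rmax_lub_lt; lra). split; [lra|]. apply Rabs_def1; lra. }
    destruct Hu as [Hu1 Hu2]. specialize (K u Hu2). fold z in K. specialize (Hb u Hu1).
    set (w := (a + RtoC u * (b - a))%C) in *.
    assert (W1 : Cmod (w - z) < d1) by (eapply Rlt_le_trans; [exact K | apply Rmin_l]).
    assert (W2 : Cmod (w - z) < d2) by (eapply Rlt_le_trans; [exact K | apply Rmin_r]).
    specialize (K1 w W1). specialize (K2 w W2). rewrite <- Hb in K2.
    pose proof (Cmod_dist_triangle (s1 z) (s1 w) (s2 z)). rewrite (Cmod_dist_sym (s1 z) (s1 w)) in H. lra. }
specialize (T 1 ltac:(lra)). replace (a + RtoC 1 * (b - a))%C with b in T by ring. exact T.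
Qed.

(** An open tube around the part of a segment reached at time [tau]; it contains the segment from
    any of its points to any point of the axis, as [branch_unique] requires. *)
Definition seg_nbhd (a v : C) (tau d : R) (z : C) : Prop :=
  exists u, 0 <= u <= tau /\ Cmod (z - (a + RtoC u * v)) < d.

Lemma seg_nbhd_convex a v tau d u z t : 0 < d -> 0 <= u <= tau -> seg_nbhd a v tau d z -> 0 <= t <= 1 ->
  seg_nbhd a v tau d (a + RtoC u * v + RtoC t * (z - (a + RtoC u * v)))%C.
Proof.
intros Hd Hu [w [Hw1 Hw2]] Ht. exists (u + t * (w - u)). split.
- split.
  + assert (0 <= (1 - t) * u) by (apply Rmult_le_pos; lra). assert (0 <= t * w) by (apply Rmult_le_pos; lra). lra.
  + assert (0 <= (1 - t) * (tau - u)) by (apply Rmult_le_pos; lra). assert (0 <= t * (tau - w)) by (apply Rmult_le_pos; lra). lra.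
- rewrite RtoC_plus, RtoC_mult, RtoC_minus.
  replace (a + RtoC u * v + RtoC t * (z - (a + RtoC u * v)) - (a + (RtoC u + RtoC t * (RtoC w - RtoC u)) * v))%C
   with (RtoC t * (z - (a + RtoC w * v)))%C by ring.
  rewrite Cmod_mult, Cmod_R, Rabs_pos_eq by lra. pose proof (Cmod_ge_0 (z - (a + RtoC w * v))). nra.
Qed.

Lemma branch_glue h (A B : C -> Prop) s1 s2 :
  branch h A s1 -> branch h B s2 ->
  (forall z, A z -> exists d, 0 < d /\ forall w, Cmod (w - z) < d -> A w) ->
  (forall z, B z -> exists d, 0 < d /\ forall w, Cmod (w - z) < d -> B w) ->
  (forall z, A z -> B z -> s1 z = s2 z) ->
  exists s, branch h (fun z => A z \/ B z) s /\ forall z, A z -> s z = s1 z.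
Proof.
intros H1 H2 OA OB E.
set (s := fun z => if excluded_middle_informative (A z) then s1 z else s2 z).
assert (SA : forall z, A z -> s z = s1 z) by (intros z Hz; unfold s; destruct (excluded_middle_informative (A z)); tauto).
assert (SB : forall z, B z -> s z = s2 z) by (intros z Hz; unfold s; destruct (excluded_middle_informative (A z)); auto).
assert (loc : forall (D : C -> Prop) s' z, (forall z, D z -> s z = s' z) ->
  (forall z, D z -> exists d, 0 < d /\ forall w, Cmod (w - z) < d -> D w) -> D z -> ccont s' z -> ccont s z).
{ intros D s' z ES OD Hz Hc eps He. destruct (Hc eps He) as [d [Hd K]]. destruct (OD z Hz) as [d' [Hd' K']].
  exists (Rmin d d'). split; [apply Rmin_pos; lra|]. intros w Hw.
  assert (W1 : Cmod (w - z) < d) by (eapply Rlt_le_trans; [exact Hw | apply Rmin_l]).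
  assert (W2 : Cmod (w - z) < d') by (eapply Rlt_le_trans; [exact Hw | apply Rmin_r]).
  rewrite !ES; auto. }
exists s. split; [|exact SA]. intros z [Hz | Hz].
- split; [apply (loc A s1); auto; apply H1, Hz | rewrite SA; auto; apply H1, Hz].
- split; [apply (loc B s2); auto; apply H2, Hz | rewrite SB; auto; apply H2, Hz].
Qed.

Lemma disc_open (c : C) r z : Cmod (z - c) < r -> exists d, 0 < d /\ forall w, Cmod (w - z) < d -> Cmod (w - c) < r.
Proof.
intros H. exists (r - Cmod (z - c)). split; [lra|]. intros w Hw. pose proof (Cmod_dist_triangle w z c). lra.
Qed.

Lemma seg_nbhd_open a v tau d z : seg_nbhd a v tau d z -> exists e, 0 < e /\ forall w, Cmod (w - z) < e -> seg_nbhd a v tau d w.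
Proof.
intros [u [Hu1 Hu2]]. destruct (disc_open _ _ _ Hu2) as [e [He H]]. exists e. split; [exact He|].
intros w Hw. exists u. auto.
Qed.

(* If a lift of a segment cannot be continued to the endpoint, then either it escapes and
   the endpoint is an asymptotic value, or it accumulates at a point where [h o exp] is a
   local homeomorphism, up to a translation by a period of [exp]. *)
Lemma lift_limit h L a v T (et : R -> C) : no_singular_beyond h L -> 0 < T ->
  L < Re (a + RtoC T * v)%C ->
  (forall t, 0 <= t < T -> h (Cexp (et t)) = Cexp (a + RtoC t * v)%C) ->
  (forall t, 0 <= t < T -> forall eps, 0 < eps -> exists delta, 0 < delta /\
        forall s, 0 <= s < T -> Rabs (s - t) < delta -> Cmod (et s - et t) < eps) ->
  exists eps s t, 0 < eps /\ 0 <= t < T /\ branch h (fun z => Cmod (z - (a + RtoC T * v)) < eps) s /\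
    (forall z, Cmod (z - (a + RtoC T * v)) < eps -> L < Re z) /\
    Cmod (a + RtoC t * v - (a + RtoC T * v)) < eps / 2 /\ s (a + RtoC t * v)%C = et t.
Proof.
intros Hg HT HL Hlift Hcont. set (zT := (a + RtoC T * v)%C) in *.
assert (Hg' := Hg). destruct Hg' as [Hh [Hh0 [_ Hasym]]].
set (z := fun t => Cexp (et t)).
assert (Hconv : forall eps, 0 < eps -> exists t0, 0 <= t0 < T /\ forall t, t0 <= t < T -> Cmod (h (z t) - Cexp zT) < eps).
{ intros eps He. destruct (cderiv_cont _ _ _ (cderiv_Cexp zT) eps He) as [d [Hd K]].
  destruct (segment_close a v T d Hd) as [e [He' K']].
  exists (Rmax 0 (T - e / 2)). assert (Rmax 0 (T - e / 2) < T) by (apply Rmax_lub_lt; lra).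
  pose proof (Rmax_l 0 (T - e / 2)). pose proof (Rmax_r 0 (T - e / 2)).
  split; [lra|]. intros t Ht. unfold z. rewrite Hlift by lra. apply K, K'. apply Rabs_def1; lra. }
assert (Hbdd : exists M, forall t0, 0 <= t0 < T -> exists t, t0 <= t < T /\ Cmod (z t) <= M).
{ apply NNPP. intros Hn. apply (Hasym (Cexp zT) T z); auto.
  - rewrite Cmod_Cexp. apply exp_increasing, HL.
  - intros t Ht eps He. destruct (cderiv_cont _ _ _ (cderiv_Cexp (et t)) eps He) as [d [Hd K]].
    destruct (Hcont t Ht d Hd) as [d' [Hd' K']]. exists d'. split; [exact Hd'|].
    intros s Hs Hst. apply K, K'; auto.
  - intros M. apply NNPP. intros HM. apply Hn. exists M. intros t0 Ht0. apply NNPP. intros Ht.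
    apply HM. exists t0. split; [exact Ht0|]. intros t Htt. apply Rnot_le_lt. intros Hle. apply Ht. exists t. auto. }
destruct Hbdd as [M HM].
(* Since the path does not escape, there are times tending to [T] at which it stays bounded. *)
assert (Hseq : forall n : nat, exists t, T - T / (INR n + 1) <= t < T /\ Cmod (z t) <= M).
{ intros n. apply HM. pose proof (pos_INR n).
  assert (0 < T / (INR n + 1)) by (apply Rdiv_lt_0_compat; lra).
  assert (T / (INR n + 1) <= T / 1) by (apply Rmult_le_compat_l; [lra | apply Rinv_le_contravar; lra]).
  lra. }
apply choice in Hseq. destruct Hseq as [tn Htn].
assert (Htn0 : forall n, 0 <= tn n < T).
{ intros n. destruct (Htn n) as [H1 _]. pose proof (pos_INR n).
  assert (T / (INR n + 1) <= T / 1) by (apply Rmult_le_compat_l; [lra | apply Rinv_le_contravar; lra]). lra. }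
assert (Hlate : forall t0, t0 < T -> exists N, forall n, (N <= n)%nat -> t0 <= tn n).
{ intros t0 Ht0. destruct (archimed_cor1 ((T - t0) / T)) as [N [HN HN0]]; [apply Rdiv_lt_0_compat; lra|].
  exists N. intros n Hn. destruct (Htn n) as [[H1 _] _].
  assert (INR N <= INR n) by (apply le_INR; lia). assert (0 < INR N) by (apply lt_0_INR; lia).
  assert (/ (INR n + 1) <= / INR N) by (apply Rinv_le_contravar; lra).
  assert (T / (INR n + 1) <= T - t0).
  { unfold Rdiv. apply Rle_trans with (T * ((T - t0) / T)); [apply Rmult_le_compat_l; lra | apply Req_le; field; lra]. }
  lra. }
destruct (bolzano_weierstrass_C (fun n => z (tn n)) 0%C M) as [zs Hzs].
{ intros n. replace (z (tn n) - 0)%C with (z (tn n)) by ring. apply (Htn n). }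
assert (Ezs : h zs = Cexp zT).
{ apply Cmod_sub_eq_0. apply Rle_antisym; [|apply Cmod_ge_0]. apply le_epsilon. intros eps He. rewrite Rplus_0_l.
  destruct (Hconv (eps / 2) ltac:(lra)) as [t0 [Ht0 K0]]. destruct (Hlate t0 ltac:(lra)) as [N HN].
  destruct (entire_cont h zs Hh (eps / 2) ltac:(lra)) as [d [Hd K]].
  destruct (Hzs d Hd N) as [n [Hn1 Hn2]].
  specialize (K _ Hn2). specialize (K0 (tn n)). specialize (HN n Hn1). specialize (Htn0 n). specialize (K0 ltac:(lra)).
  pose proof (Cmod_dist_triangle (h zs) (h (z (tn n))) (Cexp zT)). rewrite (Cmod_dist_sym (h zs) (h (z (tn n)))) in H. lra. }
(* The clause [Cmod (h 0) < exp L] keeps the accumulation point off 0, so that it has a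
   logarithm. *)
assert (Hzs0 : zs <> 0%C).
{ intros E0. rewrite E0 in Ezs. rewrite Ezs, Cmod_Cexp in Hh0. apply exp_lt_inv in Hh0. lra. }
destruct (Cexp_surj zs Hzs0) as [es Hes].
destruct (local_branch h L zT es Hg HL ltac:(rewrite Hes; exact Ezs)) as [eps [delta [s [He [Hd [Hb [Hs0 [HLe Hu]]]]]]]].
destruct (local_inverse Cexp es delta (Cexp es)) as [r [Hr [_ Hcov]]]; auto.
{ intros w _. eexists. apply cderiv_Cexp. } { apply cderiv_Cexp. } { apply Cexp_neq_0. }
assert (Hpos : 0 < Cmod (Cexp es) * r / 8) by (rewrite Cmod_Cexp; pose proof (exp_pos (Re es)); nra).
destruct (segment_close a v T (eps / 2) ltac:(lra)) as [e1 [He1 K1]].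
destruct (Hlate (T - e1 / 2) ltac:(lra)) as [N HN].
destruct (Hzs _ Hpos N) as [n [Hn1 Hn2]].
specialize (HN n Hn1). assert (Hn0 := Htn0 n).
assert (Hclose : Cmod (a + RtoC (tn n) * v - zT) < eps / 2) by (apply K1, Rabs_def1; lra).
destruct (Hcov r ltac:(lra) (z (tn n))) as [e [He2 He3]]; [rewrite Hes; rewrite Hes in Hn2; exact Hn2|].
assert (Ee : e = s (a + RtoC (tn n) * v)%C).
{ apply Hu; [lra | lra |]. rewrite He3. apply Hlift, Hn0. }
destruct (Cexp_eq _ _ He3) as [k Hk].
set (p := (0, 2 * IZR k * PI) : C) in *.
exists eps, (fun w => s w - p)%C, (tn n). split; [exact He|]. split; [exact Hn0|]. split; [|split; [exact HLe | split; [exact Hclose|]]].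
- intros w Hw. destruct (Hb w Hw) as [B1 B2]. split.
  + intros e0 He0. destruct (B1 e0 He0) as [d [Hd0 K]]. exists d. split; [exact Hd0|]. intros x Hx.
    replace (s x - p - (s w - p))%C with (s x - s w)%C by ring. apply K, Hx.
  + rewrite <- B2. f_equal.
    assert (E : (Cexp (s w) = Cexp (s w - p) * Cexp p)%C) by (rewrite <- Cexp_plus; f_equal; ring).
    rewrite E. unfold p. rewrite Cexp_2kPI. ring.
- rewrite <- Ee, Hk. unfold p. ring.
Qed.

Lemma Re_segment_gt L a b t : L < Re a -> L < Re b -> 0 <= t <= 1 -> L < Re (a + RtoC t * (b - a))%C.
Proof.
intros Ha Hb Ht. replace (Re (a + RtoC t * (b - a))%C) with ((1 - t) * Re a + t * Re b) by (unfold Re; simpl; ring).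
destruct (Rle_dec t (1 / 2)); [assert (0 < (1 - t) * (Re a - L)) by (apply Rmult_lt_0_compat; lra); assert (0 <= t * (Re b - L)) by (apply Rmult_le_pos; lra)
 | assert (0 <= (1 - t) * (Re a - L)) by (apply Rmult_le_pos; lra); assert (0 < t * (Re b - L)) by (apply Rmult_lt_0_compat; lra)]; lra.
Qed.

(** Continuation by [interval_induction]. At a limit time the earlier lifts agree and form one path,
    [lift_limit] provides a lift on a disc around the endpoint, and this disc is glued to an earlier
    tube. *)
Lemma branch_along_segment h L a et b : no_singular_beyond h L -> L < Re a -> L < Re b -> h (Cexp et) = Cexp a ->
  exists d s, 0 < d /\ branch h (seg_nbhd a (b - a) 1 d) s /\ s a = et /\
    (forall z, seg_nbhd a (b - a) 1 d z -> L < Re z).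
Proof.
intros Hg Ha Hb E. set (v := (b - a)%C).
set (P := fun tau => exists d s, 0 < d /\ branch h (seg_nbhd a v tau d) s /\ s a = et /\
    (forall z, seg_nbhd a v tau d z -> L < Re z)).
assert (H : forall tau, 0 <= tau <= 1 -> P tau); [|apply (H 1); lra].
assert (E0 : (a + RtoC 0 * v)%C = a) by ring.
apply interval_induction.
- destruct (local_branch h L a et Hg Ha E) as [eps [delta [s [He [Hd [Hbr [Hs [HL _]]]]]]]].
  assert (Hsub : forall z, seg_nbhd a v 0 eps z -> Cmod (z - a) < eps).
  { intros z [u [Hu1 Hu2]]. replace u with 0 in Hu2 by lra. rewrite E0 in Hu2. exact Hu2. }
  exists eps, s. split; [exact He|]. split; [|split; [exact Hs | intros z Hz; apply HL, Hsub, Hz]].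
  intros z Hz. apply Hbr, Hsub, Hz.
- intros t Ht [d [s [Hd [Hbr [Hs HL]]]]].
  destruct (segment_close a v t (d / 2) ltac:(lra)) as [e [He K]].
  exists e. split; [exact He|]. intros u Hu1 Hu2. exists (d / 2), s.
  assert (Hsub : forall z, seg_nbhd a v u (d / 2) z -> seg_nbhd a v t d z).
  { intros z [w [Hw1 Hw2]]. destruct (Rle_dec w t) as [Hwt | Hwt].
    - exists w. split; lra.
    - exists t. split; [lra|]. pose proof (Cmod_dist_triangle z (a + RtoC w * v) (a + RtoC t * v)).
      specialize (K w ltac:(apply Rabs_def1; lra)). lra. }
  split; [lra|]. split; [|split; [exact Hs | intros z Hz; apply HL, Hsub, Hz]]. intros z Hz. apply Hbr, Hsub, Hz.
- intros T HT IH.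
  assert (IH' : forall u, exists ds : R * (C -> C), 0 <= u < T -> 0 < fst ds /\ branch h (seg_nbhd a v u (fst ds)) (snd ds) /\ snd ds a = et /\
    (forall z, seg_nbhd a v u (fst ds) z -> L < Re z)).
  { intros u. destruct (classic (0 <= u < T)) as [Hu | Hu]; [|exists (0, fun x => x); tauto].
    destruct (IH u Hu) as [d [s Hds]]. exists (d, s). intros _. exact Hds. }
  apply choice in IH'. destruct IH' as [ds Hds].
  (* The endpoint values of the tubes. [Hagree] shows that any longer tube gives the same values,
     hence the path is continuous. *)
  set (et' := fun u => snd (ds u) (a + RtoC u * v)%C).
  assert (Hagree : forall u w, 0 <= u <= w -> w < T -> snd (ds w) (a + RtoC u * v)%C = et' u).
  { intros u w Hu Hw. destruct (Hds u ltac:(lra)) as [D1 [B1 [S1 L1]]]. destruct (Hds w ltac:(lra)) as [D2 [B2 [S2 L2]]].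
    unfold et'.
    assert (Hin : forall x, 0 <= x <= u -> seg_nbhd a v u (fst (ds u)) (a + RtoC x * v)%C /\ seg_nbhd a v w (fst (ds w)) (a + RtoC x * v)%C).
    { intros x Hx. split; exists x; (split; [lra | rewrite Cmod_dist_refl; lra]). }
    apply (branch_unique h L (fun z => seg_nbhd a v u (fst (ds u)) z /\ seg_nbhd a v w (fst (ds w)) z) (snd (ds w)) (snd (ds u)) a); auto.
    - apply (branch_sub _ _ _ _ B2). tauto.
    - apply (branch_sub _ _ _ _ B1). tauto.
    - intros z [Hz _]. apply L1, Hz.
    - intros t Ht. replace (a + RtoC t * (a + RtoC u * v - a))%C with (a + RtoC (t * u) * v)%C by (rewrite RtoC_mult; ring).
      apply Hin. split; [apply Rmult_le_pos; lra|]. assert (0 <= (1 - t) * u) by (apply Rmult_le_pos; lra). lra.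
    - rewrite S1, S2. reflexivity. }
  destruct (lift_limit h L a v T et') as [eps [s [t [He [Ht [Hbr [HL [Hcl Hst]]]]]]]]; auto; try lra.
  { apply (Re_segment_gt L a b T); auto; lra. }
  { intros t Ht. destruct (Hds t Ht) as [D1 [B1 _]]. apply B1. exists t. split; [lra | rewrite Cmod_dist_refl; lra]. }
  { intros t Ht eps He. set (w := (t + T) / 2). assert (Hw : t < w < T) by (unfold w; lra).
    destruct (Hds w ltac:(lra)) as [D1 [B1 _]].
    destruct (B1 (a + RtoC t * v)%C) as [Hc _]; [exists t; split; [lra | rewrite Cmod_dist_refl; lra]|].
    destruct (Hc eps He) as [d [Hd K]]. destruct (segment_close a v t d Hd) as [e [He' K']].
    exists (Rmin e (w - t)). split; [apply Rmin_pos; lra|]. intros x Hx Hxt.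
    assert (X1 : Rabs (x - t) < e) by (eapply Rlt_le_trans; [exact Hxt | apply Rmin_l]).
    assert (X2 : Rabs (x - t) < w - t) by (eapply Rlt_le_trans; [exact Hxt | apply Rmin_r]).
    apply Rabs_def2 in X2. rewrite <- (Hagree x w), <- (Hagree t w) by lra. apply K, K', X1. }
  destruct (Hds t Ht) as [D1 [B1 [S1 L1]]].
  set (zT := (a + RtoC T * v)%C) in *.
  destruct (branch_glue h (seg_nbhd a v t (fst (ds t))) (fun z => Cmod (z - zT) < eps) (snd (ds t)) s B1 Hbr) as [s' [Hs' Es']].
  { intros z Hz. apply seg_nbhd_open, Hz. }
  { intros z Hz. apply disc_open, Hz. }
  { intros z Hz1 Hz2.
    apply (branch_unique h L (fun z => seg_nbhd a v t (fst (ds t)) z /\ Cmod (z - zT) < eps) (snd (ds t)) s (a + RtoC t * v)%C); auto.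
    - apply (branch_sub _ _ _ _ B1). tauto.
    - apply (branch_sub _ _ _ _ Hbr). tauto.
    - intros w [_ Hw]. apply HL, Hw.
    - intros x Hx. split; [apply seg_nbhd_convex; auto; lra | apply segment_in_disc; auto; lra]. }
  (* Points of the axis after time [t] lie within [eps / 2] of [zT], so a tube of radius at most
     [eps / 2] around them stays in the disc. *)
  set (d' := Rmin (fst (ds t)) (eps / 2)).
  assert (Hd' : 0 < d') by (apply Rmin_pos; lra).
  assert (Hsub : forall z, seg_nbhd a v T d' z -> seg_nbhd a v t (fst (ds t)) z \/ Cmod (z - zT) < eps).
  { intros z [u [Hu1 Hu2]].
    assert (U1 : d' <= fst (ds t)) by apply Rmin_l. assert (U2 : d' <= eps / 2) by apply Rmin_r.
    destruct (Rle_dec u t) as [Hut | Hut].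
    - left. exists u. split; lra.
    - right. pose proof (Cmod_dist_triangle z (a + RtoC u * v) zT).
      assert (Cmod (a + RtoC u * v - zT) <= Cmod (a + RtoC t * v - zT)).
      { unfold zT. rewrite !Cmod_segment_dist. apply Rmult_le_compat_r; [apply Cmod_ge_0|].
        rewrite !Rabs_left1 by lra. lra. }
      lra. }
  exists d', s'. split; [exact Hd'|]. split; [|split].
  + apply (branch_sub _ _ _ _ Hs'). exact Hsub.
  + rewrite Es'; [exact S1|]. exists 0. split; [lra|]. rewrite E0, Cmod_dist_refl. exact D1.
  + intros z Hz. destruct (Hsub z Hz) as [Hz' | Hz']; auto.
Qed.

(** The half-plane is star-shaped about [a]: [psi b] is the end value of the lift along the segment
    from [a] to [b]. *)
Lemma global_branch h L a et : no_singular_beyond h L -> L < Re a -> h (Cexp et) = Cexp a ->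
  exists psi, branch h (fun z => L < Re z) psi /\ psi a = et.
Proof.
intros Hg Ha E.
assert (H : forall b, exists ds : R * (C -> C), L < Re b -> 0 < fst ds /\ branch h (seg_nbhd a (b - a) 1 (fst ds)) (snd ds) /\ snd ds a = et /\
    (forall z, seg_nbhd a (b - a) 1 (fst ds) z -> L < Re z)).
{ intros b. destruct (classic (L < Re b)) as [Hb | Hb]; [|exists (0, fun x => x); tauto].
  destruct (branch_along_segment h L a et b Hg Ha Hb E) as [d [s Hds]]. exists (d, s). intros _. exact Hds. }
apply choice in H. destruct H as [ds Hds].
set (psi := fun b => snd (ds b) b).
assert (Hend : forall b d, 0 < d -> seg_nbhd a (b - a) 1 d b).
{ intros b d Hd. exists 1. split; [lra|]. replace (a + RtoC 1 * (b - a))%C with b by ring. rewrite Cmod_dist_refl. exact Hd. }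
(* For [c] near [b] the segment from [a] to [c] stays in the tube of [b], because corresponding
   points differ by [t * (c - b)]; uniqueness along it makes [psi] locally a single lift. *)
assert (Hloc : forall b c, L < Re b -> L < Re c -> Cmod (c - b) < fst (ds b) -> psi c = snd (ds b) c).
{ intros b c Hb Hc Hbc. destruct (Hds b Hb) as [D1 [B1 [S1 L1]]]. destruct (Hds c Hc) as [D2 [B2 [S2 L2]]].
  unfold psi.
  apply (branch_unique h L (fun z => seg_nbhd a (b - a) 1 (fst (ds b)) z /\ seg_nbhd a (c - a) 1 (fst (ds c)) z) (snd (ds c)) (snd (ds b)) a c); auto.
  - apply (branch_sub _ _ _ _ B2). tauto.
  - apply (branch_sub _ _ _ _ B1). tauto.
  - intros z [Hz _]. apply L1, Hz.
  - intros t Ht. split; exists t; (split; [lra|]).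
    + replace (a + RtoC t * (c - a) - (a + RtoC t * (b - a)))%C with (RtoC t * (c - b))%C by ring.
      rewrite Cmod_mult, Cmod_R, Rabs_pos_eq by lra. pose proof (Cmod_ge_0 (c - b)). nra.
    + rewrite Cmod_dist_refl. exact D2.
  - rewrite S1, S2. reflexivity. }
exists psi. split.
- intros b Hb. destruct (Hds b Hb) as [D1 [B1 [S1 L1]]].
  destruct (B1 b (Hend b _ D1)) as [Hc Hf]. split; [|exact Hf].
  intros eps He. destruct (Hc eps He) as [d [Hd K]].
  set (d' := Rmin d (Rmin (fst (ds b)) (Re b - L))).
  exists d'. split; [repeat apply Rmin_pos; lra|]. intros w Hw.
  assert (W1 : Cmod (w - b) < d) by (eapply Rlt_le_trans; [exact Hw | apply Rmin_l]).
  assert (W2 : Cmod (w - b) < fst (ds b)) by (eapply Rlt_le_trans; [exact Hw | eapply Rle_trans; [apply Rmin_r | apply Rmin_l]]).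
  assert (W3 : Cmod (w - b) < Re b - L) by (eapply Rlt_le_trans; [exact Hw | eapply Rle_trans; [apply Rmin_r | apply Rmin_r]]).
  pose proof (re_le_Cmod (w - b)) as T. rewrite Re_minus in T. apply Rabs_le_between in T.
  rewrite (Hloc b w), (Hloc b b); auto; try lra. rewrite Cmod_dist_refl; lra.
- destruct (Hds a Ha) as [_ [_ [S1 _]]]. exact S1.
Qed.

(** Implicit differentiation of [h (Cexp (psi z)) = Cexp z]. The lower bound from [local_inverse]
    first shows that the increment of [psi] is [O(k)]; this turns the error of [h o exp] into
    [o(k)]. *)
Lemma branch_deriv h L psi z : no_singular_beyond h L -> branch h (fun z => L < Re z) psi -> L < Re z ->
  exists l : C, l <> 0%C /\ cderiv psi z l.
Proof.
intros Hg Hb Hz. destruct (Hb z Hz) as [Hc Hf].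
destruct (comp_exp_deriv_neq_0 h L (psi z) z Hg Hz Hf) as [lam [Hlam Hd]].
set (G := fun z => h (Cexp z)) in *.
assert (HG : entire_fun G) by apply comp_exp_entire, Hg.
destruct (local_inverse G (psi z) 1 lam ltac:(lra) (entire_hol_disc G (psi z) 1 HG) Hd Hlam) as [r [Hr [Hinj _]]].
assert (Hl0 := proj1 (Cmod_gt_0 lam) Hlam).
exists (Cexp z / lam)%C. split.
{ intros E0. apply (Cexp_neq_0 z). replace (Cexp z) with (Cexp z / lam * lam)%C by (field; exact Hlam). rewrite E0. ring. }
intros eps He.
set (E := exp (Re z) + 1). assert (HE : 0 < E) by (unfold E; pose proof (exp_pos (Re z)); lra).
destruct (cderiv_Cexp z (Rmin 1 (eps * Cmod lam / 2))) as [d1 [Hd1 K1]]; [apply Rmin_pos; nra|].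
set (e2 := eps * Cmod lam * Cmod lam / (4 * E)).
assert (He2 : 0 < e2) by (apply Rdiv_lt_0_compat; [repeat apply Rmult_lt_0_compat; lra | lra]).
destruct (Hd e2 He2) as [d2 [Hd2 K2]].
destruct (Hc (Rmin r d2)) as [d3 [Hd3 K3]]; [apply Rmin_pos; lra|].
set (d := Rmin d1 (Rmin d3 (Re z - L))).
exists d. split; [repeat apply Rmin_pos; lra|]. intros k Hk.
assert (W1 : Cmod k < d1) by (eapply Rlt_le_trans; [exact Hk | apply Rmin_l]).
assert (W2 : Cmod k < d3) by (eapply Rlt_le_trans; [exact Hk | eapply Rle_trans; [apply Rmin_r | apply Rmin_l]]).
assert (W3 : Cmod k < Re z - L) by (eapply Rlt_le_trans; [exact Hk | eapply Rle_trans; [apply Rmin_r | apply Rmin_r]]).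
assert (Hzk : L < Re (z + k)%C).
{ rewrite Re_plus. pose proof (re_le_Cmod k) as T. apply Rabs_le_between in T. lra. }
destruct (Hb (z + k)%C Hzk) as [_ Hfk].
specialize (K3 (z + k)%C). replace (z + k - z)%C with k in K3 by ring. specialize (K3 W2).
set (D := (psi (z + k) - psi z)%C) in *.
assert (D1 : Cmod D < r) by (eapply Rlt_le_trans; [exact K3 | apply Rmin_l]).
assert (D2 : Cmod D < d2) by (eapply Rlt_le_trans; [exact K3 | apply Rmin_r]).
specialize (K1 k W1). specialize (K2 D D2). replace (psi z + D)%C with (psi (z + k)%C) in K2 by (unfold D; ring).
specialize (Hinj (psi (z + k)%C) (psi z) D1 ltac:(rewrite Cmod_dist_refl; lra)). fold D in Hinj.
unfold G in Hinj, K2. rewrite Hf, Hfk in Hinj, K2.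
pose proof (Cmod_ge_0 k) as Hk0.
assert (M1 : Cmod (Cexp (z + k) - Cexp z - Cexp z * k) <= 1 * Cmod k).
{ apply Rle_trans with (1 := K1). apply Rmult_le_compat_r; [exact Hk0 | apply Rmin_l]. }
assert (M2 : Cmod (Cexp (z + k) - Cexp z - Cexp z * k) <= eps * Cmod lam / 2 * Cmod k).
{ apply Rle_trans with (1 := K1). apply Rmult_le_compat_r; [exact Hk0 | apply Rmin_r]. }
assert (HD : Cmod lam / 2 * Cmod D <= E * Cmod k).
{ apply Rle_trans with (1 := Hinj). pose proof (Cmod_le_sub_add (Cexp (z + k) - Cexp z) (Cexp z * k)) as T.
  rewrite Cmod_mult, Cmod_Cexp in T. unfold E. lra. }
replace (D - Cexp z / lam * k)%C with (/ lam * ((Cexp (z + k) - Cexp z - Cexp z * k) - (Cexp (z + k) - Cexp z - lam * D)))%C by (field; exact Hlam).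
rewrite Cmod_mult, Cmod_inv by exact Hlam.
apply Rmult_le_reg_l with (1 := Hl0). rewrite <- Rmult_assoc, Rinv_r, Rmult_1_l by lra.
eapply Rle_trans; [apply Cmod_sub_le|].
assert (M3 : e2 * Cmod D <= eps * Cmod lam / 2 * Cmod k).
{ apply Rle_trans with ((eps * Cmod lam / (2 * E)) * (Cmod lam / 2 * Cmod D)).
  - apply Req_le. unfold e2. field. lra.
  - apply Rle_trans with ((eps * Cmod lam / (2 * E)) * (E * Cmod k)).
    + apply Rmult_le_compat_l; [apply Rlt_le, Rdiv_lt_0_compat; nra | exact HD].
    + apply Req_le. field. lra. }
lra.
Qed.

(** * Contraction in logarithmic coordinates *)

(* The Cayley transform [(A - A c) / (A + conj (A c))] is bounded by 1. *)
Lemma harnack_deriv A c rho l : 0 < rho -> hol_disc A c rho ->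
  (forall z, Cmod (z - c) < rho -> 0 < Re (A z)) -> cderiv A c l -> Cmod l <= 4 * Re (A c) / rho.
Proof.
intros Hr HA Hpos Hl.
assert (Hc : Cmod (c - c) < rho) by (rewrite Cmod_dist_refl; exact Hr).
assert (P0 := Hpos c Hc).
set (den := fun z => (A z + Cconj (A c))%C). set (num := fun z => (A z - A c)%C).
assert (Hden : forall z, Cmod (z - c) < rho -> den z <> 0%C).
{ intros z Hz E. assert (Re (den z) = 0) by (rewrite E; reflexivity).
  unfold den in H. rewrite Re_plus in H. change (Re (Cconj (A c))) with (Re (A c)) in H. specialize (Hpos z Hz). lra. }
assert (Dn : forall z m, cderiv A z m -> cderiv num z m /\ cderiv den z m).
{ intros z m Hm. split.
  - replace m with (m - 0)%C by ring. apply cderiv_minus; [exact Hm | apply cderiv_const].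
  - replace m with (m + 0)%C by ring. apply cderiv_plus; [exact Hm | apply cderiv_const]. }
assert (Dq : forall z m, Cmod (z - c) < rho -> cderiv A z m ->
   cderiv (fun z => num z * / den z)%C z (m * / den z + num z * (- m / (den z * den z)))%C).
{ intros z m Hz Hm. destruct (Dn z m Hm) as [D1 D2]. apply (cderiv_mult num (fun z => / den z)%C); [exact D1 | apply (cderiv_inv_comp den); [exact D2 | apply Hden, Hz]]. }
assert (B : Cmod (l * / den c + num c * (- l / (den c * den c))) <= 2 * 1 / rho).
{ apply cauchy_estimate with (fun z => num z * / den z)%C c; auto.
  - intros z Hz. destruct (HA z Hz) as [m Hm]. eexists. apply (Dq z m Hz Hm).
  - intros z Hz. assert (Hd := Hden z Hz). rewrite Cmod_mult, Cmod_inv by exact Hd. apply Cmod_gt_0 in Hd.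
    apply Rmult_le_reg_r with (1 := Hd). rewrite Rmult_assoc, Rinv_l, Rmult_1_r, Rmult_1_l by lra.
    apply Rsqr_incr_0_var; [|lra]. unfold Rsqr.
    assert (E1 : Cmod (num z) ^ 2 = (Re (A z) - Re (A c)) ^ 2 + (Im (A z) - Im (A c)) ^ 2) by apply Cmod2_alt.
    assert (E2 : Cmod (den z) ^ 2 = (Re (A z) + Re (A c)) ^ 2 + (Im (A z) + - Im (A c)) ^ 2) by apply Cmod2_alt.
    replace (Cmod (num z) * Cmod (num z)) with (Cmod (num z) ^ 2) by ring.
    replace (Cmod (den z) * Cmod (den z)) with (Cmod (den z) ^ 2) by ring. rewrite E1, E2.
    specialize (Hpos z Hz). nra. }
assert (E : den c = RtoC (2 * Re (A c))).
{ unfold den. apply C_ext; unfold Re, Im; simpl; ring. }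
assert (En : num c = 0%C) by (unfold num; ring).
rewrite En in B. replace (l * / den c + 0 * (- l / (den c * den c)))%C with (l * / den c)%C in B by ring.
rewrite Cmod_mult, Cmod_inv in B by apply Hden, Hc. rewrite E, Cmod_R, Rabs_pos_eq in B by lra.
apply Rmult_le_reg_r with (/ (2 * Re (A c))); [apply Rinv_0_lt_compat; lra|].
apply Rle_trans with (1 := B). apply Req_le. field. lra.
Qed.

Lemma half_plane_disc L z w : L < Re z -> Cmod (w - z) < Re z - L -> L < Re w.
Proof.
intros Hz Hw. pose proof (re_le_Cmod (w - z)) as T. rewrite Re_minus in T. apply Rabs_le_between in T. lra.
Qed.

Lemma branch_hol_disc h L psi z r : no_singular_beyond h L -> branch h (fun z => L < Re z) psi ->
  r <= Re z - L -> hol_disc psi z r.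
Proof.
intros Hg Hb Hr w Hw.
assert (HL : L < Re w).
{ pose proof (re_le_Cmod (w - z)) as T. rewrite Re_minus in T. apply Rabs_le_between in T. lra. }
destruct (branch_deriv h L psi w Hg Hb HL) as [l [_ Hl]]. exists l. exact Hl.
Qed.

Lemma Cexp_shift z k : Cexp (z + (0%R, (2 * IZR k * PI)%R))%C = Cexp z.
Proof. rewrite Cexp_plus, Cexp_2kPI. ring. Qed.

Lemma window_shift (P x : R) : P <> 0 -> exists j : Z, Rabs (x + IZR j * P) <= Rabs P.
Proof.
intros HP. set (y := x / P). destruct (archimed y) as [A1 A2].
exists (- up y)%Z. rewrite opp_IZR.
replace (x + - IZR (up y) * P) with ((y - IZR (up y)) * P) by (unfold y; field; exact HP).
rewrite Rabs_mult. rewrite <- (Rmult_1_l (Rabs P)) at 2. apply Rmult_le_compat_r; [apply Rabs_pos|].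
apply Rabs_le_between. lra.
Qed.

Definition per (x : R) : C := (0, x).

Lemma per_plus x y : per (x + y) = (per x + per y)%C.
Proof. unfold per. apply C_ext; simpl; ring. Qed.

Lemma Cmod_per x : Cmod (per x) = Rabs x.
Proof.
replace (per x) with (Ci * RtoC x)%C by (unfold per; apply C_ext; simpl; ring).
rewrite Cmod_mult, Cmod_Ci, Cmod_R. ring.
Qed.

Lemma Re_plus_per z x : Re (z + per x)%C = Re z.
Proof. rewrite Re_plus. simpl. ring. Qed.

Lemma Im_plus_per z x : Im (z + per x)%C = Im z + x.
Proof. reflexivity. Qed.

Lemma period_iterate (psi : C -> C) L p q : (forall z, L < Re z -> psi (z + per p)%C = (psi z + per q)%C) ->
  forall (j : Z) z, L < Re z -> psi (z + per (IZR j * p))%C = (psi z + per (IZR j * q))%C.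
Proof.
intros H.
assert (Hn : forall (n : nat) z, L < Re z -> psi (z + per (INR n * p))%C = (psi z + per (INR n * q))%C).
{ induction n as [|n IH]; intros z Hz.
  - simpl. rewrite !Rmult_0_l. change (per 0) with (RtoC 0). replace (z + 0)%C with z by ring. ring.
  - rewrite S_INR. replace ((INR n + 1) * p) with (INR n * p + p) by ring. replace ((INR n + 1) * q) with (INR n * q + q) by ring.
    rewrite !per_plus. replace (z + (per (INR n * p) + per p))%C with (z + per (INR n * p) + per p)%C by ring.
    rewrite H by (rewrite Re_plus_per; exact Hz). rewrite IH by exact Hz. ring. }
intros j z Hz. destruct (Z.le_gt_cases 0 j) as [Hj | Hj].
- rewrite <- (Z2Nat.id j Hj), <- INR_IZR_INZ. apply Hn, Hz.
- set (n := Z.to_nat (- j)).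
  assert (En : IZR j = - INR n) by (unfold n; rewrite INR_IZR_INZ, Z2Nat.id by lia; rewrite opp_IZR; ring).
  rewrite En. specialize (Hn n (z + per (- INR n * p))%C).
  rewrite Re_plus_per in Hn. specialize (Hn Hz).
  replace (z + per (- INR n * p) + per (INR n * p))%C with z in Hn by (unfold per; apply C_ext; unfold Re, Im; simpl; ring).
  rewrite Hn. unfold per. apply C_ext; unfold Re, Im; simpl; ring.
Qed.

(** Harnack for [psi - m + 1]; the summand 1 makes the real part strictly positive. *)
Lemma half_plane_deriv_bound h L psi m z l : no_singular_beyond h L -> branch h (fun z => L < Re z) psi ->
  (forall z, L < Re z -> m <= Re (psi z)) -> L < Re z -> cderiv psi z l ->
  Cmod l <= 4 * (Re (psi z) - m + 1) / (Re z - L).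
Proof.
intros Hg Hb Hm Hz Hl.
set (A := fun w => (psi w + RtoC (1 - m))%C).
assert (HA : forall w, Re (A w) = Re (psi w) - m + 1) by (intros w; unfold A; rewrite Re_plus; simpl; ring).
rewrite <- HA. apply harnack_deriv; [lra | | |].
- intros w Hw. destruct (branch_hol_disc h L psi z (Re z - L) Hg Hb ltac:(lra) w Hw) as [l' Hl'].
  eexists. apply cderiv_plus; [exact Hl' | apply cderiv_const].
- intros w Hw. rewrite HA. specialize (Hm w (half_plane_disc L z w Hz Hw)). lra.
- replace l with (l + 0)%C by ring. apply cderiv_plus; [exact Hl | apply cderiv_const].
Qed.

(* On the line [Re = sigma] the function [u = Re psi - m + 1] is periodic, its maximum [S] controls
   [psi'] by Harnack, and [psi] has to grow by [2 pi i] over a period; hence [S] is at least of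
   order [sigma - L], and [u] is comparable to [S] on the whole line. *)
Lemma periodic_branch_growth h L psi m p : no_singular_beyond h L -> branch h (fun z => L < Re z) psi ->
  (forall z, L < Re z -> m <= Re (psi z)) -> p <> 0 ->
  (forall z, L < Re z -> psi (z + per p)%C = (psi z + per (2 * PI))%C) ->
  forall z, L + 8 * Rabs p <= Re z -> PI / (4 * Rabs p) * (Re z - L) <= Re (psi z) - m + 1.
Proof.
intros Hg Hb Hm Hp Hper z Hz.
assert (HP : 0 < Rabs p) by (apply Rabs_pos_lt, Hp). set (P := Rabs p) in *.
set (sg := Re z) in *. assert (Hsg : L < sg) by lra.
set (u := fun y => Re (psi (sg, y)) - m + 1).
assert (Hline : forall y, L < Re (sg, y)) by (intros; exact Hsg).
assert (cu : forall y, continuity_pt u y).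
{ intros y eps He. destruct (Hb (sg, y) (Hline y)) as [Hc _]. destruct (Hc eps He) as [d [Hd K]].
  exists d. split; [exact Hd|]. intros x [_ Hx]. change R in x. simpl in Hx |- *. unfold Rdist in *. specialize (K (sg, x)).
  replace (u x - u y) with (Re (psi (sg, x) - psi (sg, y))%C) by (unfold u; rewrite Re_minus; ring).
  eapply Rle_lt_trans; [apply re_le_Cmod|]. apply K.
  replace ((sg, x) - (sg, y))%C with (per (x - y)) by (unfold per; apply C_ext; simpl; ring). rewrite Cmod_per. exact Hx. }
destruct (continuity_ab_maj u (- P) P ltac:(lra) (fun y _ => cu y)) as [yM [HM1 HM2]].
assert (Hupar : forall y (j : Z), u (y + IZR j * p) = u y).
{ intros y j. unfold u. replace ((sg, y + IZR j * p) : C) with ((sg, y) + per (IZR j * p))%C by (unfold per; apply C_ext; simpl; ring).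
  rewrite (period_iterate psi L p (2 * PI) Hper j (sg, y) (Hline y)), Re_plus_per. reflexivity. }
set (S := u yM) in *.
assert (HS : forall y, u y <= S).
{ intros y. destruct (window_shift p y Hp) as [j Hj]. rewrite <- (Hupar y j). apply HM1. apply Rabs_le_between, Hj. }
assert (S1 : 1 <= S) by (unfold S, u; specialize (Hm (sg, yM) (Hline yM)); lra).
assert (Hmv : forall y y', Cmod (psi (sg, y) - psi (sg, y')) <= 4 * S / (sg - L) * Rabs (y - y')).
{ intros y y'. assert (T := cderiv_mean_value psi (sg, y') (sg, y) (4 * S / (sg - L))).
  replace ((sg, y) - (sg, y'))%C with (per (y - y')) in T by (unfold per; apply C_ext; simpl; ring).
  rewrite Cmod_per in T. apply T. intros t Ht.
  replace ((sg, y') + RtoC t * per (y - y'))%C with ((sg, y' + t * (y - y')) : C) by (unfold per; apply C_ext; simpl; ring).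
  set (x := y' + t * (y - y')). destruct (branch_deriv h L psi (sg, x) Hg Hb (Hline x)) as [l [_ Hl]].
  exists l. split; [exact Hl|]. eapply Rle_trans; [apply (half_plane_deriv_bound h L psi m (sg, x) l Hg Hb Hm (Hline x) Hl)|].
  simpl. apply Rmult_le_compat_r; [apply Rlt_le, Rinv_0_lt_compat; lra|].
  change (Re (psi (sg, x)) - m + 1) with (u x). specialize (HS x). lra. }
assert (HSlow : PI * (sg - L) / (2 * P) <= S).
{ specialize (Hmv (0 + p) 0). replace ((sg, 0 + p) : C) with ((sg, 0) + per p)%C in Hmv by (unfold per; apply C_ext; simpl; ring).
  rewrite Hper in Hmv by apply Hline.
  replace (psi (sg, 0) + per (2 * PI) - psi (sg, 0))%C with (per (2 * PI)) in Hmv by ring.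
  pose proof PI_RGT_0. rewrite Cmod_per, Rabs_pos_eq in Hmv by lra. replace (0 + p - 0) with p in Hmv by ring. fold P in Hmv.
  apply Rmult_le_reg_r with (4 * P / (sg - L)); [apply Rdiv_lt_0_compat; lra|].
  apply Rle_trans with (2 * PI); [apply Req_le; field; lra|].
  apply Rle_trans with (1 := Hmv). apply Req_le. field. lra. }
set (y := Im z). assert (Ez : z = (sg, y)) by (apply C_ext; reflexivity).
replace (Re (psi z) - m + 1) with (u y) by (unfold u; rewrite <- Ez; reflexivity).
destruct (window_shift p (y - yM) Hp) as [j Hj]. fold P in Hj.
set (y' := y + IZR j * p). specialize (Hmv y' yM).
assert (T : u y' - S >= - Cmod (psi (sg, y') - psi (sg, yM))).
{ replace (u y' - S) with (Re (psi (sg, y') - psi (sg, yM))%C) by (unfold S, u; rewrite Re_minus; ring).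
  pose proof (re_le_Cmod (psi (sg, y') - psi (sg, yM))) as T. apply Rabs_le_between in T. lra. }
assert (Ey : u y' = u y) by apply Hupar. rewrite Ey in T.
replace (y' - yM) with (y - yM + IZR j * p) in Hmv by (unfold y'; ring).
(* Here the distance [8 * Rabs p] enters: it makes [4 * P / (sg - L)] at most [1 / 2]. *)
assert (B : 4 * S / (sg - L) * Rabs (y - yM + IZR j * p) <= S / 2).
{ apply Rle_trans with (4 * S / (sg - L) * P); [apply Rmult_le_compat_l; [apply Rlt_le, Rdiv_lt_0_compat; lra | exact Hj]|].
  apply Rmult_le_reg_r with (sg - L); [lra|]. replace (4 * S / (sg - L) * P * (sg - L)) with (4 * S * P) by (field; lra). nra. }
apply Rle_trans with (S / 2); [|lra].
apply Rle_trans with ((PI * (sg - L) / (2 * P)) / 2); [apply Req_le; field; lra | lra].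
Qed.

Lemma disc_bound_half_plane h L psi c r : branch h (fun z => L < Re z) psi -> 0 <= r -> r < Re c - L ->
  exists M, forall z, Cmod (z - c) <= r -> Cmod (psi z) <= M.
Proof.
intros Hb Hr HL. apply disc_bound; [exact Hr|]. intros z Hz. apply Hb.
pose proof (re_le_Cmod (z - c)) as T. rewrite Re_minus in T. apply Rabs_le_between in T. lra.
Qed.

(* Otherwise the image of [psi] is a neighbourhood of [+oo] in the logarithmic plane, so that
   [h] has polynomial growth. *)
Lemma branch_no_period h L psi z1 z2 : no_singular_beyond h L -> ~ Defs.is_polynomial h ->
  branch h (fun z => L < Re z) psi -> L < Re z1 -> L < Re z2 -> psi z2 <> (psi z1 + per (2 * PI))%C.
Proof.
intros Hg Hpol Hb Hz1 Hz2 E. apply Hpol.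
pose proof PI_RGT_0 as HPI.
assert (Eper : per (2 * PI) = (0%R, (2 * IZR 1 * PI)%R)) by (unfold per; f_equal; ring).
assert (E12 : Cexp z2 = Cexp z1).
{ rewrite <- (proj2 (Hb z2 Hz2)), <- (proj2 (Hb z1 Hz1)), E, Eper, Cexp_shift. reflexivity. }
destruct (Cexp_eq _ _ E12) as [k Hk]. set (p := 2 * IZR k * PI). change (z2 = (z1 + per p)%C) in Hk.
assert (Hp : p <> 0).
{ intros Hp0. rewrite Hp0 in Hk. change (per 0) with (RtoC 0) in Hk. replace (z1 + 0)%C with z1 in Hk by ring.
  rewrite Hk in E. assert (per (2 * PI) = 0%C) by (replace (per (2 * PI)) with (psi z1 + per (2 * PI) - psi z1)%C by ring; rewrite <- E; ring).
  injection H. lra. }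
(* Both sides are lifts of [exp] on the half-plane and agree at [z1], so the single coincidence
   propagates. *)
assert (Hper : forall z, L < Re z -> psi (z + per p)%C = (psi z + per (2 * PI))%C).
{ intros z Hz.
  apply (branch_unique h L (fun z => L < Re z) (fun z => psi (z + per p)%C) (fun z => psi z + per (2 * PI))%C z1 z); auto.
  - intros w Hw. assert (Hw' : L < Re (w + per p)%C) by (rewrite Re_plus_per; exact Hw). destruct (Hb _ Hw') as [C1 F1]. split.
    + intros eps He. destruct (C1 eps He) as [d [Hd K]]. exists d. split; [exact Hd|]. intros x Hx. apply K.
      replace (x + per p - (w + per p))%C with (x - w)%C by ring. exact Hx.
    + rewrite F1. apply Cexp_shift.
  - intros w Hw. destruct (Hb _ Hw) as [C1 F1]. split.
    + intros eps He. destruct (C1 eps He) as [d [Hd K]]. exists d. split; [exact Hd|]. intros x Hx.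
      replace (psi x + per (2 * PI) - (psi w + per (2 * PI)))%C with (psi x - psi w)%C by ring. apply K, Hx.
    + rewrite Eper, Cexp_shift. exact F1.
  - intros t Ht. apply Re_segment_gt; auto.
  - rewrite <- Hk. exact E. }
assert (Hit := period_iterate psi L p (2 * PI) Hper).
assert (Hh : entire_fun h) by apply Hg.
(* Near 0 the modulus of [h] is below [exp L], so [Cexp (psi z)] stays away from 0. *)
assert (Hm : exists m, forall z, L < Re z -> m <= Re (psi z)).
{ destruct Hg as [_ [H0 _]].
  destruct (entire_cont h 0%C Hh (exp L - Cmod (h 0%C)) ltac:(lra)) as [d [Hd K]].
  exists (ln d). intros z Hz. apply Rnot_lt_le. intros Hlt.
  specialize (K (Cexp (psi z))). replace (Cexp (psi z) - 0)%C with (Cexp (psi z)) in K by ring.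
  rewrite Cmod_Cexp in K. assert (exp (Re (psi z)) < d) by (rewrite <- (exp_ln d Hd); apply exp_increasing, Hlt).
  specialize (K H). rewrite (proj2 (Hb z Hz)) in K.
  pose proof (Cmod_le_sub_add (Cexp z) (h 0%C)) as T. rewrite Cmod_Cexp in T.
  assert (exp L < exp (Re z)) by (apply exp_increasing, Hz). lra. }
destruct Hm as [m Hm].
assert (Hgrow := periodic_branch_growth h L psi m p Hg Hb Hm Hp Hper).
assert (HP : 0 < Rabs p) by (apply Rabs_pos_lt, Hp). set (P := Rabs p) in *.
set (c := PI / (4 * P)) in *. assert (Hc : 0 < c) by (apply Rdiv_lt_0_compat; lra).
set (s1 := L + 8 * P) in *.
(* Modulo [p], the strip from [L + 4 * P] to [s1] fits into this disc: at most [2 * P] horizontally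
   and [P] vertically. Beyond the bound [X], preimages that are not left of the strip must lie to
   the right of [s1]. *)
destruct (disc_bound_half_plane h L psi (L + 6 * P, 0) (3 * P) Hb) as [X HX]; [lra | simpl; lra |].
assert (HXs : forall z, L + 4 * P <= Re z <= s1 -> Re (psi z) <= X).
{ intros z Hz. destruct (window_shift p (Im z) Hp) as [j Hj]. fold P in Hj.
  specialize (Hit j z ltac:(lra)). specialize (HX (z + per (IZR j * p))%C).
  apply Rle_trans with (Re (psi (z + per (IZR j * p))%C)); [rewrite Hit, Re_plus_per; lra|].
  eapply Rle_trans; [apply Rle_abs|]. eapply Rle_trans; [apply re_le_Cmod|]. apply HX.
  eapply Rle_trans; [apply Cmod_le_Re_Im|]. rewrite Re_minus, Im_minus, Re_plus_per, Im_plus_per.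
  change (Rabs (Re z - (L + 6 * P)) + Rabs (Im z + IZR j * p - 0) <= 3 * P).
  replace (Im z + IZR j * p - 0) with (Im z + IZR j * p) by ring.
  assert (Rabs (Re z - (L + 6 * P)) <= 2 * P) by (apply Rabs_le_between; unfold s1 in Hz; lra). lra. }
(* A segment from a known value [ea] to [e] is lifted through [psi] by the continuity method; the
   lift stays in [Re > s1] because [Re psi <= X] on the strip. *)
assert (Hcover : forall e, X < Re e -> exists z, s1 < Re z /\ psi z = e).
{ intros e He.
  set (sa := s1 + 1 + (Rabs X + Rabs m + 2) / c).
  assert (Hsa : s1 + 1 <= sa).
  { unfold sa. assert (0 <= (Rabs X + Rabs m + 2) / c); [|lra]. apply Rlt_le, Rdiv_lt_0_compat; [|exact Hc]. pose proof (Rabs_pos X). pose proof (Rabs_pos m). lra. }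
  assert (Hea : X < Re (psi (sa, 0))).
  { specialize (Hgrow (sa, 0) ltac:(simpl; lra)). change (c * (sa - L) <= Re (psi (sa, 0)) - m + 1) in Hgrow.
    assert (Rabs X + Rabs m + 2 <= c * (sa - L)).
    { apply Rle_trans with (c * ((Rabs X + Rabs m + 2) / c)); [apply Req_le; field; lra|].
      apply Rmult_le_compat_l; [lra|]. unfold sa. unfold s1. lra. }
    pose proof (Rle_abs X). assert (- m <= Rabs m) by (rewrite <- Rabs_Ropp; apply Rle_abs). lra. }
  set (ea := psi (sa, 0)) in *.
  assert (HT : forall t, 0 <= t <= 1 -> exists z, s1 < Re z /\ psi z = (ea + RtoC t * (e - ea))%C).
  { apply interval_induction.
    - exists (sa, 0). split; [simpl; lra|]. fold ea. ring.
    - intros t Ht [z [Hz1' Hz2']].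
      assert (HzL : L < Re z) by (unfold s1 in *; lra).
      destruct (branch_deriv h L psi z Hg Hb HzL) as [l [Hl0 Hl]].
      destruct (local_inverse psi z (Re z - L) l ltac:(lra) (branch_hol_disc h L psi z (Re z - L) Hg Hb ltac:(lra)) Hl Hl0) as [s [Hs [_ Hcov]]].
      set (s' := Rmin s (Re z - s1)). assert (Hs' : 0 < s') by (apply Rmin_pos; lra).
      assert (S1 : s' <= s) by apply Rmin_l. assert (S2 : s' <= Re z - s1) by apply Rmin_r.
      apply Cmod_gt_0 in Hl0.
      destruct (segment_close ea (e - ea)%C t (Cmod l * s' / 8)) as [e1 [He1 K]]; [nra|].
      exists e1. split; [exact He1|]. intros u Hu1 Hu2.
      destruct (Hcov s' ltac:(lra) (ea + RtoC u * (e - ea))%C) as [w [Hw1 Hw2]].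
      + rewrite Hz2'. apply K, Rabs_def1; lra.
      + exists w. split; [|exact Hw2]. apply (half_plane_disc s1 z w); [exact Hz1' | lra].
    - intros t Ht IH.
      assert (Het : X < Re (ea + RtoC t * (e - ea))%C) by (apply Re_segment_gt; auto; lra).
      set (et := (ea + RtoC t * (e - ea))%C) in *.
      set (un := fun n : nat => t - t / (INR n + 1)).
      assert (Hun : forall n, 0 <= un n < t).
      { intros n. unfold un. pose proof (pos_INR n).
        assert (0 < t / (INR n + 1)) by (apply Rdiv_lt_0_compat; lra).
        assert (t / (INR n + 1) <= t / 1) by (apply Rmult_le_compat_l; [lra | apply Rinv_le_contravar; lra]). lra. }
      (* Translation by multiples of [p] brings the preimages into a horizontal band, and linear
         growth bounds their real parts, so they have a cluster point. The resulting shift of the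
         values by multiples of [2 pi i] is undone after the local inversion there. *)
      assert (Hseq : forall n, exists zj : C * Z, s1 < Re (fst zj) /\ Rabs (Im (fst zj)) <= P /\
          psi (fst zj) = (ea + RtoC (un n) * (e - ea) + per (IZR (snd zj) * (2 * PI)))%C).
      { intros n. destruct (IH (un n) (Hun n)) as [z [A1 A2]].
        destruct (window_shift p (Im z) Hp) as [j Hj]. exists ((z + per (IZR j * p))%C, j). cbn [fst snd].
        rewrite Re_plus_per, Im_plus_per. split; [exact A1|]. split; [exact Hj|]. rewrite Hit, A2; [reflexivity | unfold s1 in *; lra]. }
      apply choice in Hseq. destruct Hseq as [zj Hzj].
      set (B := Rabs (Re ea) + Rabs (Re e) + Rabs m + 1).
      assert (HB : forall n, Re (fst (zj n)) <= L + B / c).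
      { intros n. destruct (Hzj n) as [A1 [A2 A3]]. specialize (Hgrow (fst (zj n)) ltac:(lra)).
        rewrite A3, Re_plus_per in Hgrow.
        replace (Re (ea + RtoC (un n) * (e - ea))%C) with ((1 - un n) * Re ea + un n * Re e) in Hgrow by (unfold Re; simpl; ring).
        specialize (Hun n). pose proof (Rle_abs (Re ea)). pose proof (Rle_abs (Re e)). pose proof (Rabs_pos (Re ea)). pose proof (Rabs_pos (Re e)).
        assert (- m <= Rabs m) by (rewrite <- Rabs_Ropp; apply Rle_abs).
        assert ((1 - un n) * Re ea <= Rabs (Re ea)) by nra. assert (un n * Re e <= Rabs (Re e)) by nra.
        assert (c * (Re (fst (zj n)) - L) <= B) by (unfold B; lra).
        assert (Re (fst (zj n)) - L <= B / c); [|lra]. apply Rmult_le_reg_l with (1 := Hc).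
        replace (c * (B / c)) with B by (field; lra). exact H6. }
      destruct (bolzano_weierstrass_C (fun n => fst (zj n)) (s1, 0) (L + B / c - s1 + P)) as [zs Hzs].
      { intros n. destruct (Hzj n) as [A1 [A2 A3]]. specialize (HB n). eapply Rle_trans; [apply Cmod_le_Re_Im|].
        rewrite Re_minus, Im_minus. replace (Im (s1, 0)) with 0 by reflexivity. replace (Re (s1, 0)) with s1 by reflexivity.
        rewrite Rminus_0_r, (Rabs_pos_eq (Re (fst (zj n)) - s1)) by lra. lra. }
      assert (Hzs1 : s1 <= Re zs).
      { apply le_epsilon. intros eps Heps. destruct (Hzs eps Heps 0%nat) as [n [_ Hn]]. destruct (Hzj n) as [A1 _].
        pose proof (re_le_Cmod (fst (zj n) - zs)) as T. rewrite Re_minus in T. apply Rabs_le_between in T. lra. }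
      assert (HzsL : L < Re zs) by (unfold s1 in *; lra).
      destruct (branch_deriv h L psi zs Hg Hb HzsL) as [l [Hl0 Hl]].
      destruct (local_inverse psi zs (4 * P) l ltac:(lra) (branch_hol_disc h L psi zs (4 * P) Hg Hb ltac:(unfold s1 in *; lra)) Hl Hl0) as [s [Hs [_ Hcov]]].
      apply Cmod_gt_0 in Hl0. set (r0 := Cmod l * s / 8) in *. assert (Hr0 : 0 < r0) by (unfold r0; nra).
      destruct (cderiv_cont _ _ _ Hl (r0 / 2) ltac:(lra)) as [d [Hd K]].
      destruct (segment_close ea (e - ea)%C t (r0 / 2) ltac:(lra)) as [e1 [He1 K1]].
      destruct (archimed_cor1 (e1 / t)) as [N [HN HN0]]; [apply Rdiv_lt_0_compat; lra|].
      destruct (Hzs d Hd N) as [n [Hn1 Hn2]].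
      specialize (K _ Hn2). destruct (Hzj n) as [A1 [A2 A3]].
      assert (Hclose : Cmod (ea + RtoC (un n) * (e - ea) - et) < r0 / 2).
      { apply K1. unfold un. replace (t - t / (INR n + 1) - t) with (- (t / (INR n + 1))) by ring. rewrite Rabs_Ropp.
        pose proof (pos_INR n). assert (0 < t / (INR n + 1)) by (apply Rdiv_lt_0_compat; lra). rewrite Rabs_pos_eq by lra.
        assert (INR N <= INR n) by (apply le_INR; lia). assert (0 < INR N) by (apply lt_0_INR; lia).
        assert (/ (INR n + 1) <= / INR N) by (apply Rinv_le_contravar; lra).
        apply Rle_lt_trans with (t * / INR N); [apply Rmult_le_compat_l; lra|].
        apply Rlt_le_trans with (t * (e1 / t)); [apply Rmult_lt_compat_l; lra | apply Req_le; field; lra]. }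
      set (j := snd (zj n)) in *. rewrite A3 in K.
      destruct (Hcov s ltac:(lra) (et + per (IZR j * (2 * PI)))%C) as [w [Hw1 Hw2]].
      { pose proof (Cmod_dist_triangle (et + per (IZR j * (2 * PI))) (ea + RtoC (un n) * (e - ea) + per (IZR j * (2 * PI))) (psi zs)) as T.
        replace (et + per (IZR j * (2 * PI)) - (ea + RtoC (un n) * (e - ea) + per (IZR j * (2 * PI))))%C with (et - (ea + RtoC (un n) * (e - ea)))%C in T by ring.
        rewrite (Cmod_dist_sym et) in T. fold r0. lra. }
      assert (HwR : s1 - 4 * P < Re w).
      { pose proof (re_le_Cmod (w - zs)) as T. rewrite Re_minus in T. apply Rabs_le_between in T. lra. }
      exists (w + per (IZR (- j) * p))%C. rewrite Re_plus_per. split.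
      + apply Rnot_le_lt. intros Hle. specialize (HXs w ltac:(unfold s1 in *; lra)).
        rewrite Hw2, Re_plus_per in HXs. lra.
      + rewrite Hit by (unfold s1 in *; lra). rewrite Hw2, opp_IZR. unfold per. apply C_ext; unfold Re, Im; simpl; ring. }
  destruct (HT 1 ltac:(lra)) as [z [A1 A2]]. exists z. split; [exact A1|]. rewrite A2. ring. }
(* If [psi w] is a logarithm of [z], then [Re w] is at most a constant plus [ln r / c], so
   [|h z| = exp (Re w)] is at most a constant times [r ^ N]. *)
destruct (INR_unbounded (/ c)) as [N HN].
apply (liouville_polynomial N h (exp (L + (1 + Rabs m) / c)) Hh).
intros r0. set (r := Rmax r0 (exp X + 1)).
assert (R1 : r0 <= r) by apply Rmax_l. assert (R2 : exp X + 1 <= r) by apply Rmax_r.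
pose proof (exp_pos X) as PX.
exists r. split; [exact R1|]. split; [lra|]. intros z Hz.
assert (Hz0 : z <> 0%C) by (apply Cmod_gt_0; lra).
destruct (Cexp_surj z Hz0) as [e He].
assert (Hre : Re e = ln r) by (rewrite <- Hz, <- He, Cmod_Cexp, ln_exp; reflexivity).
assert (HXr : X < ln r) by (rewrite <- (ln_exp X); apply ln_increasing; lra).
destruct (Hcover e ltac:(lra)) as [w [Hw1 Hw2]].
assert (HwL : L < Re w) by (unfold s1 in *; lra).
assert (Ehz : Cmod (h z) = exp (Re w)) by (rewrite <- He, <- Hw2, (proj2 (Hb w HwL)), Cmod_Cexp; reflexivity).
rewrite Ehz.
specialize (Hgrow w ltac:(lra)). rewrite Hw2, Hre in Hgrow.
assert (Hlr : 0 <= ln r) by (rewrite <- ln_1; apply Rlt_le, ln_increasing; lra).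
assert (- m <= Rabs m) by (rewrite <- Rabs_Ropp; apply Rle_abs).
assert (Hw : Re w <= L + (1 + Rabs m) / c + INR N * ln r).
{ apply Rle_trans with (L + (1 + Rabs m) / c + / c * ln r).
  - assert (Re w - L <= (1 + Rabs m) / c + / c * ln r); [|lra].
    apply Rmult_le_reg_l with (1 := Hc). replace (c * ((1 + Rabs m) / c + / c * ln r)) with (1 + Rabs m + ln r) by (field; lra). lra.
  - apply Rplus_le_compat_l, Rmult_le_compat_r; lra. }
apply Rle_trans with (exp (L + (1 + Rabs m) / c + INR N * ln r)).
- destruct Hw as [Hw | Hw]; [apply Rlt_le, exp_increasing, Hw | rewrite Hw; lra].
- rewrite exp_plus. apply Req_le. f_equal. rewrite <- Rpower_pow by lra. reflexivity.
Qed.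

(* Bloch's argument: at a maximum of [|psi'| (rho - |w - z|)] the map [psi] covers a disc of
   radius comparable to [rho |psi' z|], which has to be too small to contain a period. *)
Lemma branch_deriv_bound h L psi z l : no_singular_beyond h L -> ~ Defs.is_polynomial h ->
  branch h (fun z => L < Re z) psi -> L < Re z -> cderiv psi z l -> Cmod l * (Re z - L) <= 1024 * PI.
Proof.
intros Hg Hpol Hb Hz Hl. apply Rnot_lt_le. intros Hbig. pose proof PI_RGT_0 as HPI.
assert (Hd : forall w, exists m : C, L < Re w -> m <> 0%C /\ cderiv psi w m).
{ intros w. destruct (classic (L < Re w)) as [Hw | Hw]; [|exists 0%C; tauto].
  destruct (branch_deriv h L psi w Hg Hb Hw) as [m Hm]. exists m. auto. }
apply choice in Hd. destruct Hd as [psid Hpsid].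
set (rho := (Re z - L) / 2). assert (Hrho : 0 < rho) by (unfold rho; lra).
assert (Hin : forall w, Cmod (w - z) <= rho -> L < Re w) by (intros w Hw; apply (half_plane_disc L z); [exact Hz | unfold rho in *; lra]).
set (V := fun w => Cmod (psid w) * (rho - Cmod (w - z))).
destruct (max_on_disc V z rho ltac:(lra)) as [w [Hw1 Hw2]].
{ intros w Hw eps He.
  assert (HwL := Hin w Hw). destruct (Hpsid w HwL) as [_ Hdw].
  set (K := Cmod (psid w)). assert (HK : 0 <= K) by apply Cmod_ge_0.
  set (e1 := eps / (2 * (rho + 1))). assert (He1 : 0 < e1) by (apply Rdiv_lt_0_compat; lra).
  destruct (deriv_close psi w (Re w - L) (psid w) e1 ltac:(lra) (branch_hol_disc h L psi w (Re w - L) Hg Hb ltac:(lra)) Hdw He1) as [s [Hs HKs]].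
  set (e2 := eps / (2 * (K + 1))). assert (He2 : 0 < e2) by (apply Rdiv_lt_0_compat; lra).
  exists (Rmin s e2). split; [apply Rmin_pos; lra|]. intros x Hx Hxw.
  assert (X1 : Cmod (x - w) < s) by (eapply Rlt_le_trans; [exact Hxw | apply Rmin_l]).
  assert (X2 : Cmod (x - w) < e2) by (eapply Rlt_le_trans; [exact Hxw | apply Rmin_r]).
  specialize (HKs x (psid x) X1 (proj2 (Hpsid x (Hin x Hx)))).
  assert (D1 : Rabs (Cmod (psid x) - K) <= e1).
  { unfold K. pose proof (Cmod_le_sub_add (psid x) (psid w)). pose proof (Cmod_le_add_sub (psid x) (psid w)). apply Rabs_le_between; lra. }
  assert (D2 : Rabs (Cmod (w - z) - Cmod (x - z)) <= Cmod (x - w)).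
  { pose proof (Cmod_dist_triangle x w z). pose proof (Cmod_dist_triangle w x z). rewrite (Cmod_dist_sym w x) in H0. apply Rabs_le_between; lra. }
  replace (V x - V w) with ((Cmod (psid x) - K) * (rho - Cmod (x - z)) + K * (Cmod (w - z) - Cmod (x - z))) by (unfold V, K; ring).
  eapply Rle_lt_trans; [apply Rabs_triang|]. rewrite !Rabs_mult.
  pose proof (Cmod_ge_0 (x - z)). rewrite (Rabs_pos_eq K), (Rabs_pos_eq (rho - Cmod (x - z))) by lra.
  assert (T1 : Rabs (Cmod (psid x) - K) * (rho - Cmod (x - z)) <= e1 * (rho + 1)).
  { apply Rmult_le_compat; try lra. apply Rabs_pos. }
  assert (T2 : K * Rabs (Cmod (w - z) - Cmod (x - z)) <= K * e2) by (apply Rmult_le_compat_l; lra).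
  assert (T3 : K * e2 < (K + 1) * e2) by nra.
  replace (e1 * (rho + 1)) with (eps / 2) in T1 by (unfold e1; field; lra).
  replace ((K + 1) * e2) with (eps / 2) in T3 by (unfold e2; field; lra). lra. }
(* Within [t] of [w] the weight is at least [t], half of its value at [w]; maximality then gives
   [|psi'| <= 2 * M] there. *)
set (M := Cmod (psid w)). set (t := (rho - Cmod (w - z)) / 2).
assert (HV : Cmod l * rho <= 2 * (M * t)).
{ specialize (Hw2 z ltac:(rewrite Cmod_dist_refl; lra)). unfold V in Hw2. rewrite Cmod_dist_refl, Rminus_0_r in Hw2.
  rewrite (cderiv_unique _ _ _ _ Hl (proj2 (Hpsid z Hz))). unfold M, t. lra. }
assert (HMt : 256 * PI < M * t) by (unfold rho in HV; lra).
assert (HM0 : 0 <= M) by apply Cmod_ge_0. assert (Ht0 : 0 <= t) by (unfold t; lra).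
assert (Ht : 0 < t) by (destruct Ht0 as [Ht0 | Ht0]; [exact Ht0 | rewrite <- Ht0 in HMt; lra]).
assert (HM : 0 < M) by (destruct HM0 as [HM0 | HM0]; [exact HM0 | rewrite <- HM0 in HMt; lra]).
assert (Hint : forall x, Cmod (x - w) < t -> Cmod (x - z) <= rho - t).
{ intros x Hx. pose proof (Cmod_dist_triangle x w z). unfold t in *. lra. }
assert (HwL := Hin w Hw1).
assert (Hhol : hol_disc psi w t).
{ intros x Hx. exists (psid x). apply Hpsid, Hin. specialize (Hint x Hx). lra. }
assert (Hbd : forall x m, Cmod (x - w) < t -> cderiv psi x m -> Cmod m <= 2 * M).
{ intros x m Hx Hm. specialize (Hint x Hx). assert (HxL : L < Re x) by (apply Hin; lra).
  rewrite (cderiv_unique _ _ _ _ Hm (proj2 (Hpsid x HxL))).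
  specialize (Hw2 x ltac:(lra)). unfold V in Hw2. fold M in Hw2. replace (rho - Cmod (w - z)) with (2 * t) in Hw2 by (unfold t; field).
  apply Rmult_le_reg_r with (1 := Ht). apply Rle_trans with (Cmod (psid x) * (rho - Cmod (x - z))); [apply Rmult_le_compat_l; [apply Cmod_ge_0 | lra] | lra]. }
(* On radius [t / 16] the Lipschitz bound keeps [psi'] within [M / 2] of its value at [w], so a disc
   of radius [M * t / 128 > 2 * PI] is covered. This needs [M * t > 256 * PI]; the two halvings, in
   [rho] and in [t], account for the remaining factor 4 in [1024 * PI]. *)
destruct (cover_from_derivative psi w (t / 16) (psid w)) as [_ Hcov]; [lra | | |].
- apply (hol_disc_sub psi w t); [exact Hhol | rewrite Cmod_dist_refl; lra].
- intros x m Hx Hm.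
  assert (T := deriv_lipschitz psi w t (2 * M) (x - w) (psid w) m Ht Hhol Hbd ltac:(lra) (proj2 (Hpsid w HwL))).
  replace (w + (x - w))%C with x in T by ring. specialize (T Hm). apply Rle_trans with (1 := T). fold M.
  apply Rle_trans with (4 * (2 * M) * (t / 16) / t); [|apply Req_le; field; lra].
  apply Rmult_le_compat_r; [apply Rlt_le, Rinv_0_lt_compat; lra|]. apply Rmult_le_compat_l; lra.
- destruct (Hcov (psi w + per (2 * PI))%C) as [x [Hx1 Hx2]].
  + replace (psi w + per (2 * PI) - psi w)%C with (per (2 * PI)) by ring. rewrite Cmod_per, Rabs_pos_eq by lra. fold M. lra.
  + apply (branch_no_period h L psi w x Hg Hpol Hb HwL); [|exact Hx2]. apply Hin. specialize (Hint x ltac:(lra)). lra.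
Qed.

(** The point [et] is a value of the inverse branch through [et0]. On the disc of half the distance
    to the boundary line, the distance is at least halved, which doubles [1024 * PI]. *)
Lemma log_expansion h L et0 zt0 zt : no_singular_beyond h L -> ~ Defs.is_polynomial h ->
  L < Re zt0 -> h (Cexp et0) = Cexp zt0 -> Cmod (zt - zt0) <= (Re zt0 - L) / 2 ->
  exists et, Cmod (et - et0) <= 2048 * PI / (Re zt0 - L) * Cmod (zt - zt0) /\ h (Cexp et) = Cexp zt.
Proof.
intros Hg Hpol HL E Hd. destruct (global_branch h L zt0 et0 Hg HL E) as [psi [Hb Hp]].
assert (Hin : forall w, Cmod (w - zt0) <= (Re zt0 - L) / 2 -> (Re zt0 - L) / 2 <= Re w - L).
{ intros w Hw. pose proof (re_le_Cmod (w - zt0)) as T. rewrite Re_minus in T. apply Rabs_le_between in T. lra. }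
exists (psi zt). split.
- rewrite <- Hp. apply cderiv_mean_value. intros t Ht.
  assert (Hw : Cmod (zt0 + RtoC t * (zt - zt0) - zt0) <= (Re zt0 - L) / 2).
  { replace (zt0 + RtoC t * (zt - zt0) - zt0)%C with (RtoC t * (zt - zt0))%C by ring.
    rewrite Cmod_mult, Cmod_R, Rabs_pos_eq by lra. pose proof (Cmod_ge_0 (zt - zt0)). nra. }
  set (w := (zt0 + RtoC t * (zt - zt0))%C) in *. specialize (Hin w Hw).
  destruct (branch_deriv h L psi w Hg Hb ltac:(lra)) as [l [_ Hl]]. exists l. split; [exact Hl|].
  assert (B := branch_deriv_bound h L psi w l Hg Hpol Hb ltac:(lra) Hl).
  apply Rmult_le_reg_r with ((Re zt0 - L) / 2); [lra|].
  replace (2048 * PI / (Re zt0 - L) * ((Re zt0 - L) / 2)) with (1024 * PI) by (field; lra).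
  apply Rle_trans with (2 := B). apply Rmult_le_compat_l; [apply Cmod_ge_0 | exact Hin].
- apply Hb. specialize (Hin zt Hd). lra.
Qed.

(** * Dynamics of escaping points *)

Definition expansion_const : R := 2048 * PI.

Lemma expansion_const_gt_1 : 1 < expansion_const.
Proof. unfold expansion_const. pose proof PI2_3_2. lra. Qed.

Definition log_expanding (f : C -> C) (L : R) : Prop :=
  forall et0 zt0 zt, L < Re zt0 -> f (Cexp et0) = Cexp zt0 -> Cmod (zt - zt0) <= (Re zt0 - L) / 2 ->
  exists et, Cmod (et - et0) <= expansion_const / (Re zt0 - L) * Cmod (zt - zt0) /\ f (Cexp et) = Cexp zt.

(** In logarithmic coordinates: on each large circle of radius [r], [|f|] reaches [r ^ 2]. *)
Definition fast_growing (f : C -> C) (X : R) : Prop :=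
  forall zt, X <= Re zt -> exists th, - PI <= th <= PI /\ exp (2 * Re zt) <= Cmod (f (Cexp (zt + per th)%C)).

(** All that the dynamics uses of a single map; [L] and [X] can be enlarged, so [f] and [g] may
    share them. *)
Definition tract_map (f : C -> C) (L X : R) : Prop :=
  entire_fun f /\ (exists a b, f a <> f b) /\ log_expanding f L /\ fast_growing f X.

Lemma tract_map_weaken f L X L' X' : tract_map f L X -> L <= L' -> X <= X' -> tract_map f L' X'.
Proof.
intros [He [Hn [Hexp Hf]]] HL HX. split; [exact He|]. split; [exact Hn|]. split.
- intros et0 zt0 zt H1 H2 H3. destruct (Hexp et0 zt0 zt ltac:(lra) H2 ltac:(lra)) as [et [H4 H5]].
  exists et. split; [|exact H5]. apply Rle_trans with (1 := H4). apply Rmult_le_compat_r; [apply Cmod_ge_0|].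
  pose proof expansion_const_gt_1. apply Rmult_le_compat_l; [lra|]. apply Rinv_le_contravar; lra.
- intros zt Hz. apply Hf. lra.
Qed.

(** Otherwise [|f| < r ^ 2] on circles of arbitrarily large radius, and [liouville_polynomial]
    applies with exponent 2. *)
Lemma transcendental_fast_growing f : entire_fun f -> ~ Defs.is_polynomial f -> exists X, fast_growing f X.
Proof.
intros Hf Hp. apply NNPP. intros Hn. apply Hp. apply (liouville_polynomial 2 f 1 Hf).
intros r0. set (X := Rmax 0 (ln (Rmax r0 1))).
assert (HX : ~ fast_growing f X) by (intros H; apply Hn; exists X; exact H).
apply not_all_ex_not in HX. destruct HX as [zt Hzt]. apply imply_to_and in Hzt. destruct Hzt as [HXz Hth].
assert (X0 : 0 <= X) by apply Rmax_l. assert (X1 : ln (Rmax r0 1) <= X) by apply Rmax_r.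
assert (Hm1 : r0 <= Rmax r0 1) by apply Rmax_l. assert (Hm2 : 1 <= Rmax r0 1) by apply Rmax_r.
assert (Hexp : Rmax r0 1 <= exp (Re zt)).
{ rewrite <- (exp_ln (Rmax r0 1)) by lra. destruct (Rle_lt_or_eq_dec (ln (Rmax r0 1)) (Re zt) ltac:(lra)) as [H | H].
  - apply Rlt_le, exp_increasing, H.
  - rewrite H. lra. }
exists (exp (Re zt)). split; [lra|]. split; [lra|]. intros z Hz.
apply Rnot_lt_le. intros Hlt. apply Hth.
assert (Hmod : Cmod (z / Cexp zt) = exp 0).
{ rewrite Cmod_div by apply Cexp_neq_0. rewrite Cmod_Cexp, Hz, exp_0. field. pose proof (exp_pos (Re zt)). lra. }
destruct (Cexp_arg _ _ Hmod) as [th [Hth1 Hth2]]. exists th. split; [exact Hth1|].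
rewrite Cexp_plus. change (Cexp (per th)) with (Cexp (0, th)). rewrite Hth2.
replace (Cexp zt * (z / Cexp zt))%C with z by (field; apply Cexp_neq_0).
replace (2 * Re zt) with (Re zt + Re zt) by ring. rewrite exp_plus. simpl in Hlt. lra.
Qed.

(** * Orbits under a sequence of maps *)

Fixpoint seq_iter (s : nat -> C -> C) (n : nat) (z : C) : C :=
  match n with O => z | S k => s k (seq_iter s k z) end.

Definition escapes (s : nat -> C -> C) (z : C) : Prop :=
  forall M, exists N : nat, forall n, (N <= n)%nat -> M < Cmod (seq_iter s n z).

Lemma seq_iter_add s n k z : seq_iter s (n + k) z = seq_iter (fun i => s (n + i)%nat) k (seq_iter s n z).
Proof.
induction k as [|k IH]; [rewrite Nat.add_0_r; reflexivity|].
rewrite Nat.add_succ_r. simpl. rewrite IH. reflexivity.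
Qed.

Lemma seq_iter_entire s n : (forall k, entire_fun (s k)) -> entire_fun (seq_iter s n).
Proof.
intros H. induction n as [|n IH].
- intros z. exists 1%C. apply cderiv_id.
- apply (entire_comp (s n) (seq_iter s n)); auto.
Qed.

Lemma seq_iter_open s n z eps : (forall k, entire_fun (s k) /\ exists a b, s k a <> s k b) -> 0 < eps ->
  exists delta, 0 < delta /\ forall w, Cmod (w - seq_iter s n z) < delta -> exists u, Cmod (u - z) < eps /\ seq_iter s n u = w.
Proof.
intros Hs He. induction n as [|n [d [Hd IH]]].
- exists eps. split; [exact He|]. intros w Hw. exists w. auto.
- destruct (open_mapping (s n) (seq_iter s n z) d (proj1 (Hs n)) (proj2 (Hs n)) Hd) as [d' [Hd' H]].
  exists d'. split; [exact Hd'|]. intros w Hw. destruct (H w Hw) as [v [Hv1 Hv2]].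
  destruct (IH v Hv1) as [u [Hu1 Hu2]]. exists u. split; [exact Hu1|]. simpl. rewrite Hu2. exact Hv2.
Qed.

Lemma exp_le_reg x y : exp x <= exp y -> x <= y.
Proof. intros H. apply Rnot_lt_le. intros Hlt. apply exp_increasing in Hlt. lra. Qed.

Lemma exp_le x y : x <= y -> exp x <= exp y.
Proof. intros [H | H]; [apply Rlt_le, exp_increasing, H | rewrite H; lra]. Qed.

(* Pulling back the disc of radius [expansion_const] about the logarithm of the n-th orbit point
   contracts it by a factor 1/2 at each step. *)
Lemma escaping_blow_up s L X z0 eps Y : (forall k, tract_map (s k) L X) -> escapes s z0 -> 0 < eps ->
  exists n zt, Y <= Re zt /\ forall w, Cmod (w - zt) <= (Re zt - L) / 2 ->
    exists u, Cmod (u - z0) < eps /\ seq_iter s n u = Cexp w.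
Proof.
intros Hs Hz He. set (K := expansion_const). assert (HK : 1 < K) by apply expansion_const_gt_1.
(* [b - L >= 2 * K] makes the contraction factor [K / (b - L)] at most [1 / 2], and [b >= Y] serves
   the conclusion. *)
set (b := Rabs L + Rabs Y + 2 * K).
assert (HbL : L + 2 * K <= b) by (unfold b; pose proof (Rle_abs L); pose proof (Rabs_pos Y); lra).
assert (HbY : Y <= b) by (unfold b; pose proof (Rle_abs Y); pose proof (Rabs_pos L); lra).
destruct (Hz (exp b)) as [N HN].
assert (Hlog : forall n, exists e, (N <= n)%nat -> Cexp e = seq_iter s n z0 /\ b <= Re e).
{ intros n. destruct (le_lt_dec N n) as [Hn | Hn]; [|exists 0%C; lia].
  specialize (HN n Hn). pose proof (exp_pos b). destruct (Cexp_surj (seq_iter s n z0)) as [e Hee]; [apply Cmod_gt_0; lra|].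
  exists e. intros _. split; [exact Hee|]. apply exp_le_reg. rewrite <- Cmod_Cexp, Hee. lra. }
apply choice in Hlog. destruct Hlog as [zt Hzt].
assert (Hstep : forall n w, (N <= n)%nat -> Cmod (w - zt (S n)) <= (Re (zt (S n)) - L) / 2 ->
  exists e, Cmod (e - zt n) <= K / (Re (zt (S n)) - L) * Cmod (w - zt (S n)) /\ s n (Cexp e) = Cexp w).
{ intros n w Hn Hw. destruct (Hzt n Hn) as [E1 B1]. destruct (Hzt (S n) ltac:(lia)) as [E2 B2].
  apply (proj1 (proj2 (proj2 (Hs n)))); auto; [lra|]. rewrite E1, E2. reflexivity. }
assert (Hpull : forall j w, Cmod (w - zt (N + j)%nat) <= K ->
  exists e, Cmod (e - zt N) <= (1 / 2) ^ j * Cmod (w - zt (N + j)%nat) /\ seq_iter (fun i => s (N + i)%nat) j (Cexp e) = Cexp w).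
{ induction j as [|j IH]; intros w Hw.
  - rewrite Nat.add_0_r in *. exists w. split; [simpl; lra | reflexivity].
  - rewrite Nat.add_succ_r in *. destruct (Hzt (S (N + j)) ltac:(lia)) as [E2 B2].
    destruct (Hstep (N + j)%nat w ltac:(lia) ltac:(lra)) as [e [He1 He2]].
    assert (Hc : K / (Re (zt (S (N + j))) - L) <= 1 / 2).
    { apply Rmult_le_reg_r with (Re (zt (S (N + j))) - L); [lra|].
      unfold Rdiv at 1. rewrite Rmult_assoc, Rinv_l by lra. lra. }
    pose proof (Cmod_ge_0 (w - zt (S (N + j)))).
    assert (He3 : Cmod (e - zt (N + j)%nat) <= 1 / 2 * Cmod (w - zt (S (N + j)))) by (apply Rle_trans with (1 := He1); apply Rmult_le_compat_r; lra).
    destruct (IH e ltac:(lra)) as [e' [H1 H2]]. exists e'. split.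
    + apply Rle_trans with (1 := H1). simpl.
      apply Rle_trans with ((1 / 2) ^ j * (1 / 2 * Cmod (w - zt (S (N + j))))); [apply Rmult_le_compat_l; [apply pow_le; lra | exact He3] | apply Req_le; ring].
    + simpl. rewrite H2. exact He2. }
(* The first [N] steps, before the orbit is large, are handled by open mapping; [N] is fixed, so [d]
   is fixed before the number [j] of contracting steps is chosen. *)
destruct (seq_iter_open s N z0 eps (fun k => conj (proj1 (Hs k)) (proj1 (proj2 (Hs k)))) He) as [d [Hd Hopen]].
destruct (Hzt N (le_n N)) as [EN BN].
destruct (cderiv_cont _ _ _ (cderiv_Cexp (zt N)) d Hd) as [d' [Hd' Hcont]].
destruct (pow_2_unbounded (K / d')) as [j Hj].
assert (P2 : 0 < 2 ^ j) by (apply pow_lt; lra).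
assert (Hsmall : (1 / 2) ^ j * K < d').
{ replace ((1 / 2) ^ j) with (/ 2 ^ j) by (rewrite <- pow_inv; f_equal; field).
  apply Rmult_lt_reg_l with (1 := P2). rewrite <- Rmult_assoc, Rinv_r, Rmult_1_l by lra.
  apply Rmult_lt_reg_r with (/ d'); [apply Rinv_0_lt_compat; lra|].
  replace (2 ^ j * d' * / d') with (2 ^ j) by (field; lra). exact Hj. }
set (n := (N + j)%nat). destruct (Hzt (S n) ltac:(unfold n; lia)) as [E2 B2].
exists (S n), (zt (S n)). split; [lra|]. intros w Hw.
destruct (Hstep n w ltac:(unfold n; lia) Hw) as [e [He1 He2]].
(* A single inverse step brings the large final disc down to the fixed size [K / 2], from where
   [Hpull] takes over. *)
assert (He3 : Cmod (e - zt n) <= K / 2).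
{ apply Rle_trans with (1 := He1). apply Rle_trans with (K / (Re (zt (S n)) - L) * ((Re (zt (S n)) - L) / 2)).
  - apply Rmult_le_compat_l; [apply Rlt_le, Rdiv_lt_0_compat; lra | exact Hw].
  - apply Req_le. field. lra. }
destruct (Hpull j e) as [e' [H1 H2]]; [unfold n in *; lra|].
assert (H3 : Cmod (e' - zt N) < d').
{ apply Rle_lt_trans with (1 := H1). apply Rle_lt_trans with (2 := Hsmall).
  apply Rmult_le_compat_l; [apply pow_le; lra | unfold n in *; lra]. }
specialize (Hcont _ H3). rewrite EN in Hcont. destruct (Hopen _ Hcont) as [u [Hu1 Hu2]].
exists u. split; [exact Hu1|]. simpl. unfold n. rewrite seq_iter_add, Hu2, H2. exact He2.
Qed.

(** A pseudo-orbit that jumps to points of maximum modulus is shadowed by a true orbit: discs of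
    radius 5 around its points are pulled back step by step, and each pullback lies within [1 + 4]
    of the preceding point. *)
Lemma escaping_point_near s L X : (forall k, tract_map (s k) L X) ->
  exists Y, forall zt, Y <= Re zt -> exists et, Cmod (et - zt) <= 5 /\ escapes s (Cexp et).
Proof.
intros Hs. set (K := expansion_const). assert (HK : 1 < K) by apply expansion_const_gt_1.
pose proof PI_4 as HPI4. pose proof PI_RGT_0 as HPI.
(* [5 * K] contracts radius 5 to radius 1, and 10 makes half the distance to [L] at least 5, as
   [log_expanding] demands. *)
set (Y := Rabs X + Rabs L + 5 * K + 10).
assert (HYX : X <= Y) by (unfold Y; pose proof (Rle_abs X); pose proof (Rabs_pos L); lra).
assert (HYL : L + 5 * K + 10 <= Y) by (unfold Y; pose proof (Rle_abs L); pose proof (Rabs_pos X); lra).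
assert (HY10 : 10 <= Y) by (unfold Y; pose proof (Rabs_pos L); pose proof (Rabs_pos X); lra).
exists Y. intros zt Hzt.
assert (Hstep : forall nz : nat * C, exists cz : C * C, Y <= Re (snd nz) ->
   Cmod (fst cz - snd nz) <= 4 /\ s (fst nz) (Cexp (fst cz)) = Cexp (snd cz) /\ 2 * Re (snd nz) <= Re (snd cz)).
{ intros [n z]. cbn [fst snd]. destruct (classic (Y <= Re z)) as [Hz | Hz]; [|exists (z, z); tauto].
  destruct (proj2 (proj2 (proj2 (Hs n))) z ltac:(lra)) as [th [Hth1 Hth2]].
  destruct (Cexp_surj (s n (Cexp (z + per th)%C))) as [z' Hz'].
  { apply Cmod_gt_0. pose proof (exp_pos (2 * Re z)). lra. }
  exists ((z + per th)%C, z'). intros _. cbn [fst snd]. split; [|split].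
  - replace (z + per th - z)%C with (per th) by ring. rewrite Cmod_per. apply Rabs_le_between. lra.
  - symmetry. exact Hz'.
  - apply exp_le_reg. rewrite <- (Cmod_Cexp z'), Hz'. exact Hth2. }
apply choice in Hstep. destruct Hstep as [st Hst].
(* The true step starts at [c n], within 4 of [Z n], and lands exactly on [Z (S n)], whose real part
   is at least doubled. *)
set (Z := fix Z n := match n with O => zt | S k => snd (st (k, Z k)) end).
set (c := fun n => fst (st (n, Z n))).
assert (HZ : forall n, Y + INR n <= Re (Z n)).
{ induction n as [|n IH]; [simpl; lra|]. rewrite S_INR. pose proof (pos_INR n).
  destruct (Hst (n, Z n)) as [_ [_ H3]]; [simpl; lra|]. cbn [fst snd] in H3.
  change (Z (S n)) with (snd (st (n, Z n))). lra. }
assert (HZY : forall n, Y <= Re (Z n)) by (intros n; pose proof (pos_INR n); specialize (HZ n); lra).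
assert (Hpull : forall n w, Cmod (w - Z n) <= 5 -> exists e, Cmod (e - zt) <= 5 /\ seq_iter s n (Cexp e) = Cexp w /\
   forall j, (j <= n)%nat -> exp (Re (Z j) - 5) <= Cmod (seq_iter s j (Cexp e))).
{ assert (Hmod : forall n w, Cmod (w - Z n) <= 5 -> exp (Re (Z n) - 5) <= Cmod (Cexp w)).
  { intros n w Hw. rewrite Cmod_Cexp. apply exp_le. pose proof (re_le_Cmod (w - Z n)) as T. rewrite Re_minus in T. apply Rabs_le_between in T. lra. }
  induction n as [|n IH]; intros w Hw.
  - exists w. split; [exact Hw|]. split; [reflexivity|]. intros j Hj. replace j with 0%nat by lia. apply (Hmod 0%nat w Hw).
  - destruct (Hst (n, Z n) (HZY n)) as [H1 [H2 H3]]. cbn [fst snd] in H1, H2, H3. fold (c n) in H1, H2.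
    change (snd (st (n, Z n))) with (Z (S n)) in H2, H3.
    pose proof (HZY (S n)) as HS.
    destruct (proj1 (proj2 (proj2 (Hs n))) (c n) (Z (S n)) w ltac:(lra) H2 ltac:(lra)) as [e [He1 He2]].
    assert (He3 : Cmod (e - c n) <= 1).
    { apply Rle_trans with (1 := He1). fold K.
      apply Rle_trans with (K / (Re (Z (S n)) - L) * 5); [apply Rmult_le_compat_l; [apply Rlt_le, Rdiv_lt_0_compat; lra | exact Hw]|].
      apply Rmult_le_reg_r with (Re (Z (S n)) - L); [lra|].
      replace (K / (Re (Z (S n)) - L) * 5 * (Re (Z (S n)) - L)) with (5 * K) by (field; lra). lra. }
    destruct (IH e) as [e' [A1 [A2 A3]]]; [pose proof (Cmod_dist_triangle e (c n) (Z n)); lra|].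
    exists e'. split; [exact A1|]. assert (A4 : seq_iter s (S n) (Cexp e') = Cexp w) by (simpl; rewrite A2; exact He2).
    split; [exact A4|]. intros j Hj. destruct (Nat.eq_dec j (S n)) as [-> | Hne]; [rewrite A4; apply (Hmod (S n) w Hw) | apply A3; lia]. }
assert (Hseq : forall n, exists e, Cmod (e - zt) <= 5 /\ forall j, (j <= n)%nat -> exp (Re (Z j) - 5) <= Cmod (seq_iter s j (Cexp e))).
{ intros n. destruct (Hpull n (Z n)) as [e [A1 [_ A3]]]; [rewrite Cmod_dist_refl; lra|]. exists e. auto. }
apply choice in Hseq. destruct Hseq as [en Hen].
(* [en n] controls only the first [n] iterates; the lower bounds are closed conditions and pass to a
   cluster point for all iterates. *)
destruct (bolzano_weierstrass_C en zt 5 (fun n => proj1 (Hen n))) as [e He].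
exists e. split.
- apply le_epsilon. intros eps Heps. destruct (He eps Heps 0%nat) as [n [_ Hn]].
  pose proof (Cmod_dist_triangle e (en n) zt). rewrite (Cmod_dist_sym e (en n)) in H. pose proof (proj1 (Hen n)). lra.
- assert (Hlow : forall j, exp (Re (Z j) - 5) <= Cmod (seq_iter s j (Cexp e))).
  { intros j. apply le_epsilon. intros eps Heps.
    assert (Hent : entire_fun (fun w => seq_iter s j (Cexp w))) by (apply comp_exp_entire, seq_iter_entire; intros k; apply Hs).
    destruct (ccont_Cmod _ e (entire_cont _ e Hent) eps Heps) as [d [Hd K1]].
    destruct (He d Hd j) as [n [Hn1 Hn2]]. specialize (K1 _ Hn2). apply Rabs_def2 in K1.
    pose proof (proj2 (Hen n) j Hn1). lra. }
  intros M. destruct (INR_unbounded M) as [N HN]. exists N. intros n Hn.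
  apply Rlt_le_trans with (2 := Hlow n). assert (INR N <= INR n) by (apply le_INR; lia).
  specialize (HZ n). pose proof (exp_ineq1_le (Re (Z n) - 5)). lra.
Qed.

Lemma seq_iter_commute s s' n k z : (forall i j z, s i (s' j z) = s' j (s i z)) ->
  seq_iter s' k (seq_iter s n z) = seq_iter s n (seq_iter s' k z).
Proof.
intros H.
assert (H1 : forall i k z, seq_iter s' k (s i z) = s i (seq_iter s' k z)).
{ intros i k'. induction k' as [|k' IH]; intros z'; simpl; [reflexivity | rewrite IH; symmetry; apply H]. }
induction n as [|n IH]; simpl; [reflexivity|]. rewrite H1, IH. reflexivity.
Qed.

Lemma escapes_near_escaping s s' L X z0 eps : (forall k, tract_map (s k) L X) -> (forall k, tract_map (s' k) L X) ->
  (forall i j z, s i (s' j z) = s' j (s i z)) -> escapes s z0 -> 0 < eps ->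
  exists u, Cmod (u - z0) < eps /\ escapes s' u.
Proof.
intros Hs Hs' Hcom Hz He.
destruct (escaping_point_near s' L X Hs') as [Y HY].
(* The last argument makes the disc radius [(Re zt - L) / 2] at least 5, room for the escaping point
   found near [zt]. *)
destruct (escaping_blow_up s L X z0 eps (Rabs Y + Rabs L + 10) Hs Hz He) as [n [zt [Hzt Hcov]]].
pose proof (Rle_abs Y). pose proof (Rle_abs L). pose proof (Rabs_pos Y). pose proof (Rabs_pos L).
destruct (HY zt ltac:(lra)) as [et [Het Hesc]].
destruct (Hcov et ltac:(lra)) as [u [Hu1 Hu2]].
exists u. split; [exact Hu1|]. rewrite <- Hu2 in Hesc. intros M.
assert (Hent : entire_fun (seq_iter s n)) by (apply seq_iter_entire; intros k; apply Hs).
(* The map [seq_iter s n] is bounded by [B] on the disc of radius [Rabs M], so an image larger than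
   [B] forces the iterate of [u] to leave that disc. *)
destruct (disc_bound (seq_iter s n) 0%C (Rabs M) (Rabs_pos M) (fun z _ => entire_cont _ z Hent)) as [B HB].
destruct (Hesc B) as [N HN]. exists N. intros k Hk. apply Rnot_le_lt. intros Hle.
specialize (HN k Hk). rewrite seq_iter_commute in HN by exact Hcom.
specialize (HB (seq_iter s' k u)). replace (seq_iter s' k u - 0)%C with (seq_iter s' k u) in HB by ring.
pose proof (Rle_abs M). specialize (HB ltac:(lra)). lra.
Qed.

(** The bound is uniform in [s], because it is applied to the sequence shifted to an arbitrary
    starting time. *)
Lemma seq_iter_bounded f g k M : entire_fun f -> entire_fun g ->
  exists B, forall s w j, (forall n, s n = f \/ s n = g) -> Cmod w <= M -> (j <= k)%nat -> Cmod (seq_iter s j w) <= B.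
Proof.
intros Hf Hg. induction k as [|k [B IH]].
- exists M. intros s w j _ Hw Hj. replace j with 0%nat by lia. exact Hw.
- destruct (disc_bound f 0%C (Rabs B) (Rabs_pos B) (fun z _ => entire_cont f z Hf)) as [B1 H1].
  destruct (disc_bound g 0%C (Rabs B) (Rabs_pos B) (fun z _ => entire_cont g z Hg)) as [B2 H2].
  exists (Rmax B (Rmax B1 B2)). intros s w j Hs Hw Hj.
  destruct (Nat.eq_dec j (S k)) as [-> | Hne]; [|apply Rle_trans with B; [apply (IH s); auto; lia | apply Rmax_l]].
  specialize (IH s w k Hs Hw (le_n k)). simpl. set (x := seq_iter s k w) in *.
  assert (Hx : Cmod (x - 0) <= Rabs B) by (replace (x - 0)%C with x by ring; pose proof (Rle_abs B); lra).
  apply Rle_trans with (Rmax B1 B2); [|apply Rmax_r]. destruct (Hs k) as [E | E]; rewrite E.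
  + apply Rle_trans with B1; [apply H1, Hx | apply Rmax_l].
  + apply Rle_trans with B2; [apply H2, Hx | apply Rmax_r].
Qed.

(* If the orbit is in a bounded set at time [n], it is still in a bounded set at the next multiple of [k]. *)
Lemma escapes_iff_multiples f g s k z : entire_fun f -> entire_fun g -> (forall n, s n = f \/ s n = g) -> (0 < k)%nat ->
  (forall M, exists N : nat, forall n, (N <= n)%nat -> M < Cmod (seq_iter s (n * k) z)) <-> escapes s z.
Proof.
intros Hf Hg Hs Hk. split; intros H M.
- destruct (seq_iter_bounded f g k M Hf Hg) as [B HB]. destruct (H B) as [N HN].
  exists (N * k)%nat. intros n Hn. apply Rnot_le_lt. intros Hle.
  (* The next multiple strictly beyond [n], so [j] lies between 1 and [k]. *)
  set (q := S (n / k)). set (j := (k - n mod k)%nat).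
  assert (Hdiv := Nat.div_mod_eq n k). assert (Hmod := Nat.mod_upper_bound n k ltac:(lia)).
  assert (Eq : (q * k)%nat = (n + j)%nat) by (unfold q, j; nia).
  assert (Hq : (N <= q)%nat) by (unfold q; apply Nat.le_le_succ_r, Nat.div_le_lower_bound; lia).
  specialize (HN q Hq). rewrite Eq, seq_iter_add in HN.
  specialize (HB (fun i => s (n + i)%nat) (seq_iter s n z) j (fun i => Hs (n + i)%nat) Hle ltac:(unfold j; lia)). lra.
- destruct (H M) as [N HN]. exists N. intros n Hn. apply HN. nia.
Qed.

(** * Translation to the definitions of the statement *)

Lemma Cnorm_Cmod (z : C) : Defs.Cnorm z = Cmod z.
Proof. unfold Defs.Cnorm, Cmod. f_equal. ring. Qed.

Lemma has_cderiv_cderiv (f : C -> C) (z l : C) : Defs.has_cderiv f z l <-> cderiv f z l.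
Proof.
split; intros H eps He; destruct (H eps He) as [d [Hd K]]; exists d; (split; [exact Hd|]); intros h Hh.
- destruct (Ceq_dec h 0) as [-> | Hn].
  + replace (z + 0)%C with z by ring. replace (f z - f z - l * 0)%C with (RtoC 0) by ring. rewrite Cmod_0. lra.
  + apply Cmod_gt_0 in Hn. specialize (K h). rewrite !Cnorm_Cmod in K. apply K. split; assumption.
- rewrite Cnorm_Cmod in Hh. specialize (K h (proj2 Hh)). rewrite !Cnorm_Cmod. exact K.
Qed.

Lemma entire_entire_fun (f : C -> C) : Defs.entire f -> entire_fun f.
Proof. intros H z. destruct (H z) as [l Hl]. exists l. apply has_cderiv_cderiv, Hl. Qed.

Lemma closure_incl (S : C -> Prop) w : S w -> Defs.closure S w.
Proof.
intros H eps He. exists w. split; [exact H|]. rewrite Cnorm_Cmod. change (Cmod (w - w) < eps). rewrite Cmod_dist_refl. exact He.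
Qed.

(** Reparametrisation by [s -> T - T / (1 + s)], a [T]-Lipschitz map of the half-line onto
    [[0, T)]. *)
Lemma asymptotic_value_of_finite_path (f : C -> C) (a : C) T (z : R -> C) : 0 < T ->
  (forall t, 0 <= t < T -> forall eps, 0 < eps -> exists delta, 0 < delta /\
     forall s, 0 <= s < T -> Rabs (s - t) < delta -> Cmod (z s - z t) < eps) ->
  (forall M, exists t0, 0 <= t0 < T /\ forall t, t0 <= t < T -> M < Cmod (z t)) ->
  (forall eps, 0 < eps -> exists t0, 0 <= t0 < T /\ forall t, t0 <= t < T -> Cmod (f (z t) - a) < eps) ->
  Defs.asymptotic_value f a.
Proof.
intros HT Hc Hinf Hlim. set (r := fun s => T - T / (1 + s)).
assert (Hr : forall s, 0 <= s -> 0 <= r s < T).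
{ intros s Hs. unfold r. assert (0 < T / (1 + s)) by (apply Rdiv_lt_0_compat; lra).
  assert (T / (1 + s) <= T / 1) by (apply Rmult_le_compat_l; [lra | apply Rinv_le_contravar; lra]). lra. }
assert (Hlate : forall t0, 0 <= t0 < T -> exists S0, forall s, S0 <= s -> t0 <= r s < T).
{ intros t0 Ht0. exists (T / (T - t0)). intros s Hs.
  assert (0 < T / (T - t0)) by (apply Rdiv_lt_0_compat; lra).
  split; [|apply Hr; lra]. unfold r. assert (T / (1 + s) <= T - t0); [|lra].
  apply Rmult_le_reg_r with (1 + s); [lra|]. unfold Rdiv at 1. rewrite Rmult_assoc, Rinv_l, Rmult_1_r by lra.
  apply Rle_trans with ((T - t0) * (T / (T - t0))); [apply Req_le; field; lra | apply Rmult_le_compat_l; lra]. }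
exists (fun s => z (r s)). split; [|split].
- intros t Ht eps He. destruct (Hc (r t) (Hr t Ht) eps He) as [d [Hd K]].
  exists (d / T). split; [apply Rdiv_lt_0_compat; lra|]. intros s Hs Hst. rewrite Cnorm_Cmod.
  change (Cmod (z (r s) - z (r t)) < eps). apply K; [apply Hr, Hs|].
  replace (r s - r t) with ((s - t) * (T / ((1 + s) * (1 + t)))) by (unfold r; field; lra).
  rewrite Rabs_mult. assert (P : 1 <= (1 + s) * (1 + t)) by nra.
  rewrite (Rabs_pos_eq (T / ((1 + s) * (1 + t)))) by (apply Rlt_le, Rdiv_lt_0_compat; lra).
  apply Rle_lt_trans with (Rabs (s - t) * T).
  + apply Rmult_le_compat_l; [apply Rabs_pos|]. rewrite <- (Rmult_1_r T) at 2. apply Rmult_le_compat_l; [lra|].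
    rewrite <- Rinv_1. apply Rinv_le_contravar; lra.
  + apply Rlt_le_trans with (d / T * T); [apply Rmult_lt_compat_r; lra | apply Req_le; field; lra].
- intros M. destruct (Hinf M) as [t0 [Ht0 K]]. destruct (Hlate t0 Ht0) as [S0 HS]. exists S0. intros s Hs.
  rewrite Cnorm_Cmod. apply K, HS, Hs.
- intros eps He. destruct (Hlim eps He) as [t0 [Ht0 K]]. destruct (Hlate t0 Ht0) as [S0 HS]. exists S0. intros s Hs.
  rewrite Cnorm_Cmod. apply K, HS, Hs.
Qed.

Lemma bounded_type_no_singular (f : C -> C) : Defs.bounded_type f -> exists L, no_singular_beyond f L.
Proof.
intros [[Hf _] [B HB]].
assert (HBs : forall w, Defs.singular_value f w -> Cmod w <= B) by (intros w Hw; rewrite <- Cnorm_Cmod; apply HB, closure_incl, Hw).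
(* Exceeds the bound on the singular values and [Cmod (f 0)] at once; [L] is its logarithm. *)
set (R0 := Rabs B + Cmod (f 0%C) + 1).
pose proof (Rabs_pos B). pose proof (Cmod_ge_0 (f 0%C)). pose proof (Rle_abs B).
exists (ln R0). unfold no_singular_beyond. rewrite exp_ln by (unfold R0; lra).
split; [apply entire_entire_fun, Hf|]. split; [unfold R0; lra|]. split.
- intros z Hz Hd. specialize (HBs (f z)). unfold R0 in Hz.
  assert (Cmod (f z) <= B); [|lra]. apply HBs. left. exists z. split; [apply has_cderiv_cderiv, Hd | reflexivity].
- intros a T z Ha HT A1 A2 A3. unfold R0 in Ha.
  assert (Cmod a <= B); [|lra]. apply HBs. right. apply (asymptotic_value_of_finite_path f a T z); auto.
Qed.

Lemma transcendental_nonconstant (f : C -> C) : ~ Defs.is_polynomial f -> exists a b, f a <> f b.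
Proof.
intros Hp. apply NNPP. intros Hn. apply Hp. exists (f 0%C :: nil). intros z. rewrite poly_eval_cons.
transitivity (f 0%C).
- apply NNPP. intros H. apply Hn. exists z, 0%C. exact H.
- change (@eq C (f 0%C) (f 0%C + z * RtoC 0)%C). ring.
Qed.

Lemma bounded_type_tract_map (f : C -> C) : Defs.bounded_type f -> exists L X, tract_map f L X.
Proof.
intros H. destruct (bounded_type_no_singular f H) as [L HL]. destruct H as [[He Hp] _].
assert (Hf := entire_entire_fun f He).
destruct (transcendental_fast_growing f Hf Hp) as [X HX]. exists L, X.
split; [exact Hf|]. split; [apply transcendental_nonconstant, Hp|]. split; [|exact HX].
intros et0 zt0 zt H1 H2 H3. apply (log_expansion f L et0 zt0 zt); auto.
Qed.

(** Even times carry [g], the inner map of [f o g], so two steps from an even time are one step of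
    the composite. *)
Definition alternate (f g : C -> C) (n : nat) : C -> C := if Nat.even n then g else f.

Lemma alternate_cases f g n : alternate f g n = f \/ alternate f g n = g.
Proof. unfold alternate. destruct (Nat.even n); auto. Qed.

Lemma iter_const (f : C -> C) n (z : C) : Defs.iter n f z = seq_iter (fun _ => f) n z.
Proof. induction n as [|n IH]; [reflexivity|]. change (f (Defs.iter n f z) = f (seq_iter (fun _ => f) n z)). rewrite IH. reflexivity. Qed.

Lemma iter_comp_alternate (f g : C -> C) n (z : C) : Defs.iter n (fun z => f (g z)) z = seq_iter (alternate f g) (n * 2) z.
Proof.
induction n as [|n IH]; [reflexivity|].
change (f (g (Defs.iter n (fun z => f (g z)) z)) = alternate f g (S (n * 2)) (alternate f g (n * 2) (seq_iter (alternate f g) (n * 2) z))).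
rewrite IH. unfold alternate at 2 3. rewrite Nat.even_succ, <- Nat.negb_even.
replace (Nat.even (n * 2)) with true by (symmetry; apply Nat.even_spec; exists n; lia). reflexivity.
Qed.

Lemma iter_comp_power (f g : C -> C) m n z : (forall z, f (g z) = seq_iter (fun _ => f) (S m) z) ->
  Defs.iter n (fun z => f (g z)) z = seq_iter (fun _ => f) (n * S m) z.
Proof.
intros H. induction n as [|n IH]; [reflexivity|].
change (f (g (Defs.iter n (fun z => f (g z)) z)) = seq_iter (fun _ => f) (S n * S m) z).
rewrite IH, H. replace (S n * S m)%nat with (n * S m + S m)%nat by lia. symmetry.
apply (seq_iter_add (fun _ => f)).
Qed.

Lemma escaping_set_escapes (f : C -> C) (z : C) : Defs.escaping_set f z <-> escapes (fun _ => f) z.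
Proof.
split; intros H M; destruct (H M) as [N HN]; exists N; intros n Hn; specialize (HN n Hn).
- rewrite Cnorm_Cmod, iter_const in HN. exact HN.
- rewrite Cnorm_Cmod, iter_const. exact HN.
Qed.

Lemma escaping_set_comp f g z : entire_fun f -> entire_fun g ->
  Defs.escaping_set (fun z => f (g z)) z <-> escapes (alternate f g) z.
Proof.
intros Hf Hg. rewrite <- (escapes_iff_multiples f g (alternate f g) 2 z Hf Hg (alternate_cases f g)) by lia.
split; intros H M; destruct (H M) as [N HN]; exists N; intros n Hn; specialize (HN n Hn).
- rewrite Cnorm_Cmod, iter_comp_alternate in HN. exact HN.
- rewrite Cnorm_Cmod, iter_comp_alternate. exact HN.
Qed.

Lemma closure_subset (A B : C -> Prop) :
  (forall z eps, A z -> 0 < eps -> exists w, Cmod (w - z) < eps /\ B w) ->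
  forall z, Defs.closure A z -> Defs.closure B z.
Proof.
intros H z Hz eps He. destruct (Hz (eps / 2) ltac:(lra)) as [w [Hw1 Hw2]].
destruct (H w (eps / 2) Hw1 ltac:(lra)) as [x [Hx1 Hx2]]. exists x. split; [exact Hx2|].
rewrite Cnorm_Cmod in Hw2 |- *. change (Cmod (w - z) < eps / 2) in Hw2. change (Cmod (x - z) < eps).
pose proof (Cmod_dist_triangle x w z). lra.
Qed.

(** The two inclusions are one lemma, with the constant sequence [f] and the alternating one
    exchanging roles; [f] commutes with every map of both. *)
Lemma commuting_bounded_type_closure (f g : C -> C) : (forall z, f (g z) = g (f z)) -> Defs.bounded_type f -> Defs.bounded_type g ->
  Defs.same_set (Defs.closure (Defs.escaping_set f)) (Defs.closure (Defs.escaping_set (fun z => f (g z)))).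
Proof.
intros Hcom Hf Hg.
destruct (bounded_type_tract_map f Hf) as [L1 [X1 T1]]. destruct (bounded_type_tract_map g Hg) as [L2 [X2 T2]].
set (L := Rmax L1 L2). set (X := Rmax X1 X2).
assert (Tf : tract_map f L X) by (apply (tract_map_weaken f L1 X1); auto; apply Rmax_l).
assert (Tg : tract_map g L X) by (apply (tract_map_weaken g L2 X2); auto; apply Rmax_r).
assert (Ta : forall k, tract_map (alternate f g k) L X) by (intros k; destruct (alternate_cases f g k) as [E | E]; rewrite E; assumption).
assert (Hc : forall (j : nat) z, f (alternate f g j z) = alternate f g j (f z)).
{ intros j z. destruct (alternate_cases f g j) as [E | E]; rewrite E; auto. }
assert (Ef := proj1 Tf). assert (Eg := proj1 Tg).
intros z. split; apply closure_subset; clear z; intros z eps Hz He.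
- apply escaping_set_escapes in Hz.
  destruct (escapes_near_escaping (fun _ => f) (alternate f g) L X z eps) as [u [Hu1 Hu2]]; auto.
  exists u. split; [exact Hu1|]. apply escaping_set_comp; auto.
- apply escaping_set_comp in Hz; auto.
  destruct (escapes_near_escaping (alternate f g) (fun _ => f) L X z eps) as [u [Hu1 Hu2]]; auto.
  exists u. split; [exact Hu1|]. apply escaping_set_escapes, Hu2.
Qed.

Lemma periodic_shift_escaping (f g : C -> C) (c : C) m (z : C) : entire_fun f -> (forall z, f (z + c)%C = f z) ->
  (forall z, g z = (Defs.iter m f z + c)%C) ->
  Defs.escaping_set f z <-> Defs.escaping_set (fun z => f (g z)) z.
Proof.
intros Hf Hper Hg.
assert (H : forall z, f (g z) = seq_iter (fun _ => f) (S m) z) by (intros w; rewrite Hg, Hper, iter_const; reflexivity).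
rewrite escaping_set_escapes, <- (escapes_iff_multiples f f (fun _ => f) (S m) z) by (auto; lia).
split; intros HE M; destruct (HE M) as [N HN]; exists N; intros n Hn; specialize (HN n Hn).
- rewrite Cnorm_Cmod, (iter_comp_power f g m n z H). exact HN.
- rewrite Cnorm_Cmod, (iter_comp_power f g m n z H) in HN. exact HN.
Qed.

Import Pilot.Defs.

Theorem theorem9 (f g : Cplx -> Cplx)
  (hf : transcendental_entire f) (hg : transcendental_entire g) :
  ((forall z, f (g z) = g (f z)) -> bounded_type f -> bounded_type g ->
     same_set (closure (escaping_set f))
              (closure (escaping_set (fun z => f (g z)))))
  /\
  (forall (c : Cplx) (m : nat), c <> C0 -> (forall z, f (Cadd z c) = f z) ->
     (forall z, g z = Cadd (iter m f z) c) ->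
     same_set (closure (escaping_set f))
              (closure (escaping_set (fun z => f (g z))))).
Proof.
split.
- exact (commuting_bounded_type_closure f g).
- intros c m _ Hper Hg.
  assert (H := fun z => periodic_shift_escaping f g c m z (entire_entire_fun f (proj1 hf)) Hper Hg).
  intros z. split; intros Hz eps He; destruct (Hz eps He) as [w [Hw1 Hw2]]; exists w;
    (split; [apply H, Hw1 | exact Hw2]).
Qed.
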